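(* The following two statements are equivalent: (i) every connected plane graph $G$ satisfies $\chi_c(G) \leq \lfloor \frac{3}{2}\Delta^*(G)\rfloor$; (ii) every plane graph $G$ that is a subdivision of a simple $3$-connected plane graph satisfies $\chi_c(G) \leq \lfloor \frac{3}{2}\Delta^*(G)\rfloor$.
   Context: Plane graphs may have multiple edges but no loops; a simple graph has no multiple edges. The degree of a face is the number of vertices incident with it; $\Delta^*(G)$ is the maximum face degree. A cyclic coloring of a plane graph is a vertex coloring in which any two distinct vertices incident with a common face receive distinct colors; $\chi_c(G)$ is the minimum number of colors in a cyclic coloring of $G$. A subdivision of a graph is obtained by a sequence of operations each replacing an edge $uv$ by a path $u,w,v$ through a new vertex $w$. *)

(* Defs.v *)
From mathcomp Require Export all_boot.

Set Implicit Arguments.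
Unset Strict Implicit.
Unset Printing Implicit Defensive.

(* Finite loopless multigraphs.  Each edge is a pair {d, flip d} of opposite
   darts, d running from [source d] to [source (flip d)].  [flip] has no fixed point,
   because of [loopless]. *)
Record graph := Graph {
  vertex : finType;
  dart : finType;
  source : dart -> vertex;
  flip : dart -> dart;
  flipK : involutive flip;
  loopless : forall d, source (flip d) != source d
}.

Definition target (G : graph) (d : dart G) : vertex G := source (flip d).

Definition adj (G : graph) : rel (vertex G) :=
  [rel u v | [exists d : dart G, (source d == u) && (target d == v)]].

Definition simple_graph (G : graph) : Prop :=
  forall d e : dart G, source d = source e -> target d = target e -> d = e.

(* G - S is nonempty and connected. *)
Definition connected_minus (G : graph) (S : {set vertex G}) : Prop :=
  (exists v, v \notin S) /\
  (forall u v, u \notin S -> v \notin S ->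
     connect [rel x y | [&& x \notin S, y \notin S & adj x y]] u v).

Definition connected_graph (G : graph) : Prop :=
  connected_minus (set0 : {set vertex G}).

Definition three_connected (G : graph) : Prop :=
  3 < #|vertex G| /\
  (forall S : {set vertex G}, #|S| < 3 -> connected_minus S).

Definition graph_iso (G H : graph) : Prop :=
  exists (fV : vertex G -> vertex H) (fD : dart G -> dart H),
    [/\ bijective fV, bijective fD,
        (forall d, source (fD d) = fV (source d)) &
        (forall d, flip (fD d) = fD (flip d))].

(* Replacing the edge {d0, flip d0} by a path through the new vertex None:
   d0 and flip d0 now end at None, and their flips are the new darts
   inr false and inr true. *)
Definition subdivide_source (G : graph) (x : dart G + bool) : option (vertex G) :=
  match x with inl d => Some (source d) | inr _ => None end.

Definition subdivide_flip (G : graph) (d0 : dart G) (x : dart G + bool) :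
    dart G + bool :=
  match x with
  | inl d => if d == d0 then inr false
             else if d == flip d0 then inr true else inl (flip d)
  | inr false => inl d0
  | inr true => inl (flip d0)
  end.

Lemma subdivide_flipK (G : graph) (d0 : dart G) : involutive (subdivide_flip d0).
Proof.
have neq : (flip d0 == d0) = false.
  by apply/eqP => e; have := loopless d0; rewrite e eqxx.
case=> [d|[]] /=; rewrite ?neq ?eqxx //.
case: (altP (d =P d0)) => [-> //|d1]; case: (altP (d =P flip d0)) => [-> //|d2] /=.
have /negPf-> : flip d != d0 by apply: contraNneq d2 => <-; rewrite flipK.
have /negPf-> : flip d != flip d0 by rewrite (inj_eq (can_inj (@flipK G))).
by rewrite flipK.
Qed.

Lemma subdivide_loopless (G : graph) (d0 : dart G) (x : dart G + bool) :
  subdivide_source (subdivide_flip d0 x) != subdivide_source x.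
Proof.
case: x => [d|[]] //=; case: ifP => // _; case: ifP => // _ /=.
exact: loopless.
Qed.

Definition subdivide (G : graph) (d0 : dart G) : graph :=
  @Graph (option (vertex G)) (dart G + bool)%type (@subdivide_source G)
    (subdivide_flip d0) (subdivide_flipK d0) (subdivide_loopless d0).

Inductive subdivision_of (H : graph) : graph -> Prop :=
| Subdivision_refl G : graph_iso H G -> subdivision_of H G
| Subdivision_step G (d : dart G) G' :
    subdivision_of H G -> graph_iso (subdivide d) G' -> subdivision_of H G'.

(* Combinatorial description of a graph embedded in a surface.
   [rot] lists the darts leaving each vertex in cyclic order: by [rotP] it
   permutes the darts with a given source in a single cycle.
   The boundary walks of the faces are then the orbits of d |-> rot (flip d);
   [side d] is the face bordered by the walk through d.  Distinct walks may
   border the same face, as happens when the graph is disconnected.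
   [home v] is the face containing v when v is isolated; it is not used for
   other vertices. *)
Record embedded_graph := EmbeddedGraph {
  underlying :> graph;
  rot : dart underlying -> dart underlying;
  rotP : forall d e, fconnect rot d e = (source d == source e);
  face : finType;
  side : dart underlying -> face;
  sideP : forall d, side (rot (flip d)) = side d;
  home : vertex underlying -> face
}.

Definition isolated (G : graph) (v : vertex G) : bool :=
  [forall d : dart G, source d != v].

Definition incident (G : embedded_graph) (v : vertex G) (f : face G) : bool :=
  [exists d : dart G, (source d == v) && (side d == f)]
  || isolated v && (home v == f).

Definition incidence_rel (G : embedded_graph) : rel (vertex G + face G) :=
  fun x y => match x, y with
             | inl v, inr f | inr f, inl v => incident v f
             | _, _ => false
             end.

(* Embeddings in the sphere, hence plane graphs (which face is the unbounded
   one plays no role).  The surface is connected, and Euler's formula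
   |V| - |E| + |F| = 1 + c holds, c being the number of components of the graph.
   Let B be the number of boundary walks (an isolated vertex counting for one)
   and g >= 0 the sum of the genera of the components.  Then
   |V| - |E| + B = 2c - 2g, and connectedness gives B >= c + |F| - 1; so Euler's
   formula forces both g = 0 and a tree-like arrangement of the components
   inside each other's faces.  For a connected graph it says that each face has
   exactly one boundary walk and that the genus is 0. *)
Definition spherical (G : embedded_graph) : Prop :=
  (forall x y : vertex G + face G, connect (@incidence_rel G) x y) /\
  #|vertex G| + #|face G| = #|dart G|./2 + n_comp (@adj G) predT + 1.

Record plane_graph := PlaneGraph {
  embedding :> embedded_graph;
  plane_spherical : spherical embedding
}.

Definition face_degree (G : plane_graph) (f : face G) : nat :=
  #|[set v | incident v f]|.

Definition max_face_degree (G : plane_graph) : nat :=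
  \max_(f : face G) face_degree f.

Definition cyclic_coloring (G : plane_graph) (k : nat)
    (c : {ffun vertex G -> 'I_k}) : bool :=
  [forall f : face G, forall u, forall v,
     [&& u != v, incident u f & incident v f] ==> (c u != c v)].

Definition cyclically_colorable (G : plane_graph) (k : nat) : bool :=
  [exists c : {ffun vertex G -> 'I_k}, cyclic_coloring c].

Lemma cyclically_colorable_exists (G : plane_graph) :
  exists k, cyclically_colorable G k.
Proof.
exists #|vertex G|; apply/existsP; exists [ffun v => enum_rank v].
apply/forallP => f; apply/forallP => u; apply/forallP => v.
by apply/implyP => /and3P[uv _ _]; rewrite !ffunE (inj_eq enum_rank_inj).
Qed.

Definition cyclic_chromatic_number (G : plane_graph) : nat :=
  ex_minn (cyclically_colorable_exists G).

(* Main.v *)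
Require Import Defs.
From mathcomp Require Import all_boot all_fingroup zify.

Set Implicit Arguments.
Unset Strict Implicit.
Unset Printing Implicit Defensive.

Import GroupScope.

(** Only (ii) => (i) needs work.  A connected plane graph is treated as a map: two
    permutations of its darts, the flip [t] and the rotation [r]; vertices are the
    orbits of [r], faces those of [t * r], and a dart [x] stands for the corner where
    its vertex meets its face.  Multiplying [r] by [tperm x y] splits or merges at
    the same time the vertices and the faces of the corners [x] and [y]; watching
    Euler's formula under these moves gives the Jordan curve theorem.

    Let [m] be the maximum face degree and [k = floor (3m/2)].  The map is colored with
    [k] colors by induction.
    - If a vertex occurs twice on a face, cutting there separates the map into two
      smaller ones, whose colorings are glued after permuting the colors.
    - If two faces share two vertices [u], [v] and there are other faces on both sides
      of the resulting closed curve, take such a curve with as few corners as possible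
      on one side.  That side [B] then has at most [m] outer corners, all at distinct
      vertices, so [B] itself is colored by induction.  In the other side, [B] is
      replaced by an edge [uv].  If the two faces have [p1], [q1] vertices strictly
      inside the other side and [p2], [q2] inside [B], the colorings can be glued as
      soon as [p2 + q2 + min p1 q1 + 2 <= k], which follows from
      [p1 + p2 + 2 <= m], [q1 + q2 + 2 <= m] and [p2 + q2 + 2 <= m].
    - Otherwise, if there are at most three faces, then there are at most [3m/2]
      vertices since each lies on two faces; if there are more, suppressing the vertices
      of degree two leaves a simple 3-connected plane graph, and (ii) applies. *)

(** * Finite sets and types *)

Section FiniteSets.
Variable T : finType.
Implicit Types (A B C : {set T}) (s : seq T).

Lemma leq_card_imset_factor (R1 R2 : finType) (f : T -> R1) (g : T -> R2) A :
  {in A &, forall a b, g a = g b -> f a = f b} -> #|f @: A| <= #|g @: A|.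
Proof.
move=> fg; pose gf a := (g a, f a).
have <- : fst @: (gf @: A) = g @: A by rewrite -imset_comp.
have <- : snd @: (gf @: A) = f @: A by rewrite -imset_comp.
rewrite (@card_in_imset _ _ fst) ?leq_imset_card //.
by move=> _ _ /imsetP[a aA ->] /imsetP[b bA ->] /= gab; rewrite /gf gab (fg a b).
Qed.

Lemma imset_factor_inj (R1 R2 : finType) (f : T -> R1) (g : T -> R2) A :
  {in A &, forall a b, g a = g b -> f a = f b} -> #|g @: A| <= #|f @: A| ->
  {in A &, forall a b, f a = f b -> g a = g b}.
Proof.
move=> fg leGF a b aA bA fab; pose fg_pair c := (f c, g c).
have fE : fst @: (fg_pair @: A) = f @: A by rewrite -imset_comp.
have fst_inj : {in fg_pair @: A &, injective fst}.
  apply/imset_injP; rewrite eqn_leq leq_imset_card fE (leq_trans _ leGF) //.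
  by apply: leq_card_imset_factor => c d cA dA gcd; rewrite /fg_pair gcd (fg c d).
by have [] : fg_pair a = fg_pair b by apply: fst_inj; rewrite ?imset_f.
Qed.

Lemma ex_subset_card A n : n <= #|A| -> exists2 B : {set T}, B \subset A & #|B| = n.
Proof.
move=> nA; exists [set x in take n (enum A)].
  by apply/subsetP => x; rewrite inE => /mem_take; rewrite mem_enum.
by rewrite cardsE (card_uniqP _) ?take_uniq ?enum_uniq // size_takel // -cardE.
Qed.

Lemma ex_subset_between A C n : A \subset C -> #|A| <= n -> n <= #|C| ->
  exists B : {set T}, [/\ A \subset B, B \subset C & #|B| = n].
Proof.
move=> AC An nC; have cDA : #|C :\: A| = #|C| - #|A| by rewrite cardsDS.
have /ex_subset_card[B0 sB0 cB0] : n - #|A| <= #|C :\: A| by lia.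
exists (A :|: B0); split; first exact: subsetUl.
  by rewrite subUset AC (subset_trans sB0) ?subsetDl.
rewrite cardsU disjoint_setI0 ?cards0; first by lia.
by rewrite disjoint_sym; move: sB0; rewrite subsetD => /andP[].
Qed.

Lemma ex_disjoint_subsets A B m n : m <= #|A| -> n <= #|B| -> m + n <= #|A :|: B| ->
  exists A' B' : {set T},
    [/\ A' \subset A, B' \subset B, [disjoint A' & B'], #|A'| = m & #|B'| = n].
Proof.
move=> mA nB mnAB; have [mAB|/ltnW ABm] := leqP m #|A :\: B|.
  have [A' sA' cA'] := ex_subset_card mAB; have [B' sB' cB'] := ex_subset_card nB.
  move: sA'; rewrite subsetD => /andP[sA' dA'B].
  by exists A', B'; split=> //; rewrite disjoint_sym (disjointWl sB') // disjoint_sym.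
have [A' [sDA' sA' cA']] := ex_subset_between (subsetDl A B) ABm mA.
have AUB : A :|: B = A' :|: B :\: A'.
  apply/setP => a; rewrite !inE; have := subsetP sA' a; have := subsetP sDA' a.
  rewrite !inE; case: (a \in A') => /= [_ ->//|].
  by case: (a \in A); case: (a \in B) => //= ->.
have /ex_subset_card[B' sB' cB'] : n <= #|B :\: A'|.
  by have := leq_card_setU A' (B :\: A'); rewrite -AUB cA' => -[]; lia.
move: sB'; rewrite subsetD => /andP[sB' dB'A'].
by exists A', B'; split; rewrite // disjoint_sym.
Qed.

Lemma ex_perm_map s1 s2 : uniq s1 -> uniq s2 -> size s1 = size s2 ->
  exists p : {perm T}, map p s1 = s2.
Proof.
elim: s1 s2 => [|a s1 IHs] [|b s2] //=; first by exists 1.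
case/andP=> as1 us1 /andP[bs2 us2] [/(IHs _ us1 us2)[p ps]].
exists (p * tperm (p a) b); rewrite permM tpermL; congr (_ :: _).
rewrite -[RHS]ps; apply/eq_in_map => c cs; rewrite permM tpermD //.
  by rewrite (inj_eq perm_inj); apply: contraNneq as1 => ->.
by apply: contraNneq bs2 => ->; rewrite -ps map_f.
Qed.

Lemma uniq_cat_enum s A B : uniq s -> [disjoint s & A :|: B] -> [disjoint A & B] ->
  uniq (s ++ enum A ++ enum B).
Proof.
move=> us dsAB dAB; rewrite !cat_uniq us !enum_uniq /= andbT; apply/andP; split.
  apply/hasPn => c; rewrite mem_cat !mem_enum => cAB.
  by rewrite (disjointFl dsAB) // in_setU.
by apply/hasPn => c; rewrite !mem_enum => cB; rewrite (disjointFl dAB cB).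
Qed.

Lemma ex_perm_imset s1 s2 A B A' B' : uniq s1 -> uniq s2 -> size s1 = size s2 ->
  [disjoint s1 & A :|: B] -> [disjoint A & B] -> [disjoint s2 & A' :|: B'] ->
  [disjoint A' & B'] -> #|A| = #|A'| -> #|B| = #|B'| ->
  exists p : {perm T}, [/\ map p s1 = s2, p @: A = A' & p @: B = B'].
Proof.
move=> us1 us2 eqs ds1 dAB ds2 dA'B' cA cB.
have [p] : exists p : {perm T}, map p (s1 ++ enum A ++ enum B) = s2 ++ enum A' ++ enum B'.
  by apply: ex_perm_map; rewrite ?uniq_cat_enum // !size_cat -!cardE eqs cA cB.
rewrite !map_cat => /eqP; rewrite !eqseq_cat ?size_map -?cardE //.
case/and3P=> /eqP ps1 /eqP pA /eqP pB.
have img (C C' : {set T}) : map p (enum C) = enum C' -> p @: C = C'.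
  move=> pC; apply/setP => c; rewrite -(mem_enum C') -pC.
  by apply/imsetP/mapP => -[a aC ->]; exists a; rewrite ?mem_enum // -mem_enum.
by exists p; rewrite (img _ _ pA) (img _ _ pB).
Qed.

Lemma ex_perm_map_avoiding s1 s2 A B A' B' :
  uniq s1 -> uniq s2 -> size s1 = size s2 ->
  [disjoint s1 & A :|: B] -> [disjoint A & B] ->
  #|A| + #|A'| + size s2 <= #|T| -> #|B| + #|B'| + size s2 <= #|T| ->
  #|A| + #|B| + #|A' :&: B'| + size s2 <= #|T| ->
  exists p : {perm T},
    [/\ map p s1 = s2, [disjoint p @: A & A'] & [disjoint p @: B & B']].
Proof.
move=> us1 us2 eqs ds1 dAB leA leB leAB.
pose free C := ~: (C :|: [set c in s2]).
have card_free C : #|T| <= #|free C| + #|C| + size s2.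
  have card_s2 : #|[set c in s2]| = size s2 by rewrite cardsE (card_uniqP us2).
  have [+ _] := leq_card_setU C [set c in s2].
  by have := cardsC (C :|: [set c in s2]); rewrite -/(free C) card_s2; lia.
have freeI : free A' :|: free B' = free (A' :&: B') by rewrite /free -setCI setUIl.
have [||| X [Y [sX sY dXY cX cY]]] := @ex_disjoint_subsets (free A') (free B') #|A| #|B|.
- by have := card_free A'; lia.
- by have := card_free B'; lia.
- by rewrite freeI; have := card_free (A' :&: B'); lia.
have free_disjoint (C C' : {set T}) : C' \subset free C -> [disjoint C' & C].
  by rewrite /free setCU subsetI -!disjoints_subset => /andP[].
have [|p [ps1 pA pB]] := ex_perm_imset us1 us2 eqs ds1 dAB _ dXY (esym cX) (esym cY).
  have : X :|: Y \subset ~: [set c in s2].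
    by rewrite (subset_trans (setUSS sX sY)) // freeI setCS subsetUr.
  rewrite -disjoints_subset disjoint_sym => /pred0P ds2; apply/pred0P => c.
  by have := ds2 c; rewrite /= inE.
by exists p; rewrite pA pB !free_disjoint.
Qed.

Lemma ex_perm_avoiding a b A A' : a \notin A -> #|A| + #|A'| < #|T| ->
  exists2 p : {perm T}, p a = b & [disjoint p @: A & A'].
Proof.
move=> aA ltAA'; have cA : #|A| < #|T| by apply: leq_ltn_trans ltAA'; apply: leq_addr.
have T_gt0 : 0 < #|T| by apply: leq_ltn_trans cA.
have [p [[pa] pA _]] : exists p : {perm T},
    [/\ map p [:: a] = [:: b], [disjoint p @: A & A'] & [disjoint p @: set0 & set0]].
  apply: ex_perm_map_avoiding; rewrite ?setU0 ?setI0 ?cards0 ?addn0 ?addn1 //.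
    by rewrite disjoint_cons aA disjoint0.
  by rewrite disjoint_sym disjoints_subset sub0set.
by exists p.
Qed.

End FiniteSets.

Lemma connect_homo (T1 T2 : finType) (e1 : rel T1) (e2 : rel T2) (h : T1 -> T2) x y :
  (forall a b, e1 a b -> connect e2 (h a) (h b)) -> connect e1 x y -> connect e2 (h x) (h y).
Proof.
move=> homo_h /connectP[p + ->] {y}; elim: p x => [|a p IHp] x /=; first by rewrite connect0.
by case/andP => /homo_h xa /IHp; apply: connect_trans.
Qed.

Lemma inj_surj_bij (T1 T2 : finType) (f : T1 -> T2) :
  injective f -> (forall y, exists x, f x = y) -> bijective f.
Proof.
move=> f_inj f_surj; apply: inj_card_bij => //.
rewrite -(card_codom f_inj); apply/subset_leq_card/subsetP => y _.
by have [x <-] := f_surj y; apply: codom_f.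
Qed.

(** * Orbits of a permutation *)

Notation stable s A := (s \in 'N(A | 'P)).

Section Stable.
Variable T : finType.
Implicit Types (s : {perm T}) (A : {set T}).

Lemma homo_stable s A : (forall x, x \in A -> s x \in A) -> stable s A.
Proof. by move=> sA; rewrite !inE; apply/subsetP => x /sA; rewrite inE. Qed.

Lemma stable_mem s A x : stable s A -> (s x \in A) = (x \in A).
Proof. exact: astabs_act. Qed.

Lemma stableC s A : stable s A -> stable s (~: A).
Proof. by rewrite astabsC. Qed.

Lemma stableI s A B : stable s A -> stable s B -> stable s (A :&: B).
Proof. by move=> sA sB; apply: (subsetP (astabsI _ A B)); rewrite in_setI sA. Qed.

Lemma stableU s A B : stable s A -> stable s B -> stable s (A :|: B).
Proof. by move=> sA sB; apply: (subsetP (astabsU _ A B)); rewrite in_setI sA. Qed.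

Lemma stableD s A B : stable s A -> stable s B -> stable s (A :\: B).
Proof. by move=> sA sB; rewrite setDE stableI ?stableC. Qed.

Lemma stable_mul_tperm s A x y : (x \in A) = (y \in A) -> stable s A ->
  stable (s * tperm x y) A.
Proof.
move=> xyA sA; apply: groupM => //; apply: homo_stable => a aA.
by case: tpermP => [e|e|//]; rewrite -?xyA -?e // xyA -e.
Qed.

Lemma restr_perm_out s A x : x \notin A -> restr_perm A s x = x.
Proof. exact: out_perm (restr_perm_on A s). Qed.

End Stable.

Section Orbits.
Variable T : finType.
Implicit Types (s : {perm T}) (A : {set T}).

Lemma mem_porbit1 s x : s x \in porbit s x.
Proof. exact: (mem_porbit s 1). Qed.

Lemma porbit1 s x : porbit s (s x) = porbit s x.
Proof. exact: (porbit_perm s 1). Qed.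

Lemma eq_porbit s x y : y \in porbit s x -> porbit s y = porbit s x.
Proof. by rewrite -eq_porbit_mem => /eqP. Qed.

Lemma porbit_fconnect s x y : (y \in porbit s x) = fconnect s x y.
Proof.
apply/porbitP/idP => [[i ->]|/iter_findex <-]; first by rewrite permX fconnect_iter.
by exists (findex s x y); rewrite permX.
Qed.

Lemma porbit_invariant (R : Type) (f : T -> R) s x y :
  (forall a, f (s a) = f a) -> y \in porbit s x -> f y = f x.
Proof.
move=> fs /porbitP[i ->]; elim: i => [|i IHi]; first by rewrite expg0 perm1.
by rewrite expgSr permM fs.
Qed.

Lemma stable_porbit s x : stable s (porbit s x).
Proof. by apply: homo_stable => y; rewrite -!eq_porbit_mem porbit1. Qed.

Lemma porbit_mem_stable s A x y : stable s A -> y \in porbit s x -> (y \in A) = (x \in A).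
Proof. by move=> sA; apply: (@porbit_invariant _ (fun a => a \in A)) => a; rewrite stable_mem. Qed.

Lemma porbit_sub_stable s A x : stable s A -> x \in A -> porbit s x \subset A.
Proof. by move=> sA xA; apply/subsetP => y /(porbit_mem_stable sA)->. Qed.

Lemma porbit_exit s A x y : x \in A -> y \in porbit s x -> y \notin A ->
  exists a, [/\ a \in porbit s x, a \in A & s a \notin A].
Proof.
move=> xA yx yA; suff /existsP[a /and3P[ax aA saA]] :
    [exists a, [&& a \in porbit s x, a \in A & s a \notin A]] by exists a.
apply: contraNT yA => /existsPn stays; have sub : stable s (porbit s x :&: A).
  apply: homo_stable => a; rewrite !inE => /andP[ax aA]; rewrite stable_mem ?stable_porbit //.
  by have := stays a; rewrite ax aA /= negbK.
by have := porbit_mem_stable sub yx; rewrite !inE yx porbit_id xA.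
Qed.

Lemma porbit_fix s x : s x = x -> porbit s x = [set x].
Proof.
move=> sx; apply/eqP; rewrite eqEsubset sub1set porbit_id andbT.
by apply: porbit_sub_stable; rewrite ?set11 //; apply: homo_stable => a /set1P->; rewrite sx set11.
Qed.

Lemma porbit_invol s x : s (s x) = x -> porbit s x = [set x; s x].
Proof.
move=> ssx; apply/eqP; rewrite eqEsubset subUset !sub1set porbit_id mem_porbit1 !andbT.
apply: porbit_sub_stable; last by rewrite set21.
by apply: homo_stable => a /set2P[]->; rewrite ?ssx ?set21 ?set22.
Qed.

Lemma porbit_order3_sub s x : s (s (s x)) = x -> porbit s x \subset [set x; s x; s (s x)].
Proof.
move=> sssx; apply: porbit_sub_stable; last by rewrite !inE eqxx.
by apply: homo_stable => a; rewrite !inE -!orbA => /or3P[]/eqP->; rewrite ?sssx eqxx ?orbT.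
Qed.

Lemma porbit_moved s x y : y \in porbit s x -> x != y -> s x != x.
Proof. by move=> yx; apply: contraNneq => sx; move: yx; rewrite porbit_fix // => /set1P->. Qed.

Lemma eq_porbit_in s s' A d : stable s A -> {in A, s =1 s'} -> d \in A ->
  porbit s' d = porbit s d.
Proof.
move=> sA eqs dA; apply/setP => y.
suff powE i : (s' ^+ i) d = (s ^+ i) d by apply/porbitP/porbitP => -[i ->]; exists i; rewrite powE.
elim: i => [|i IHi]; first by rewrite !expg0.
by rewrite !expgSr !permM IHi eqs // (porbit_mem_stable sA (mem_porbit s i d)).
Qed.

Lemma porbit_restr_perm s A d : stable s A -> d \in A -> porbit (restr_perm A s) d = porbit s d.
Proof. by move=> sA; apply: eq_porbit_in => // a aA; rewrite restr_permE. Qed.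

Lemma porbit_restr_perm_out s A d : d \notin A -> porbit (restr_perm A s) d = [set d].
Proof. by move=> dA; rewrite porbit_fix ?restr_perm_out. Qed.

Lemma porbit_partition s A : stable s A -> partition (porbit s @: A) A.
Proof. by move=> sA; rewrite porbitE; apply: orbit_partition; rewrite gen_subG sub1set. Qed.

Lemma card_porbit_invol s A : stable s A ->
  {in A, forall x, s (s x) = x /\ s x != x} -> #|porbit s @: A|.*2 = #|A|.
Proof.
move=> sA inv; rewrite -muln2; apply/esym/card_uniform_partition/porbit_partition => //.
by move=> _ /imsetP[x /inv[ssx sx] ->]; rewrite porbit_invol // cards2 eq_sym sx.
Qed.

Lemma porbitsT s : porbits s = porbit s @: [set: T].
Proof. by apply/setP => A; apply/imsetP/imsetP => -[x _ ->]; exists x. Qed.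

Lemma card_porbits_stable s A : stable s A ->
  #|porbits s| = #|porbit s @: A| + #|porbit s @: ~: A|.
Proof.
move=> sA; rewrite -cardsUI disjoint_setI0 ?cards0 ?addn0.
  by rewrite -imsetU setUCr porbitsT.
apply/pred0P => B; apply/negP => /andP[/imsetP[a aA ->] /imsetP[b bA ab]].
by move: bA; rewrite in_setC (@porbit_mem_stable s A a b) ?aA // ab porbit_id.
Qed.

End Orbits.

Section MulTperm.
Variable T : finType.
Implicit Types (s : {perm T}) (F : {set T}).

Lemma mulr_tpermK s x y : s * tperm x y * tperm x y = s.
Proof. by rewrite -mulgA tperm2 mulg1. Qed.

Lemma tperm_commute (a b c d : T) : a != c -> a != d -> b != c -> b != d ->
  tperm a b * tperm c d = tperm c d * tperm a b.
Proof. by move=> ac ad bc bd; rewrite conjgC tpermJ !tpermD // eq_sym. Qed.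

Lemma mul_tperm_invariant (R : Type) (f : T -> R) s x y a :
  f x = f y -> f ((s * tperm x y) a) = f a -> f (s a) = f a.
Proof. by move=> fxy <-; rewrite permM; case: tpermP => [->|->|]. Qed.

Lemma card_porbits_mul_tperm s x y :
  #|porbits (s * tperm x y)| + (x \notin porbit s y).*2 = #|porbits s| + (x != y).
Proof.
have := porbits_mul_tperm s^-1 x y; rewrite /= porbitV porbitsV => <-.
by rewrite -porbitsV invMg tpermV.
Qed.

Lemma card_porbits_split s x y : x != y -> y \in porbit s x ->
  #|porbits (s * tperm x y)| = #|porbits s|.+1.
Proof. by move=> xy yx; have := card_porbits_mul_tperm s x y; rewrite porbit_sym yx xy; lia. Qed.

Lemma card_porbits_merge s x y : y \notin porbit s x ->
  #|porbits s| = #|porbits (s * tperm x y)|.+1.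
Proof.
move=> yx; have xy : x != y by apply: contraNneq yx => ->; apply: porbit_id.
by have := card_porbits_mul_tperm s x y; rewrite porbit_sym yx xy; lia.
Qed.

Lemma mem_porbit_merge s x y : y \notin porbit s x -> y \in porbit (s * tperm x y) x.
Proof.
move=> yx; apply: contraT => yx'.
have := card_porbits_merge yx; have := card_porbits_merge yx'.
by rewrite mulr_tpermK; lia.
Qed.

Lemma porbit_split s x y : y \in porbit s x ->
  porbit s x = porbit (s * tperm x y) x :|: porbit (s * tperm x y) y.
Proof.
move=> yx; have st : stable (s * tperm x y) (porbit s x).
  by apply: stable_mul_tperm (stable_porbit s x); rewrite yx porbit_id.
apply/eqP; rewrite eqEsubset subUset !(porbit_sub_stable st) ?porbit_id // !andbT.
apply: porbit_sub_stable; last by rewrite inE porbit_id.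
rewrite -{1}(mulr_tpermK s x y); apply: stable_mul_tperm.
  by rewrite !inE !porbit_id orbT.
by apply: stableU; apply: stable_porbit.
Qed.

Lemma porbit_merge s x y : y \notin porbit s x ->
  porbit (s * tperm x y) x = porbit s x :|: porbit s y.
Proof. by move=> yx; rewrite {1}(porbit_split (mem_porbit_merge yx)) mulr_tpermK. Qed.

Lemma porbit_tperm_out s x y a : a \notin porbit s x -> a \notin porbit s y ->
  porbit (s * tperm x y) a = porbit s a.
Proof.
move=> ax ay; apply: (@eq_porbit_in _ _ _ (porbit s a)); rewrite ?stable_porbit ?porbit_id //.
move=> b ba; have sba : s b \in porbit s a by rewrite stable_mem ?stable_porbit.
rewrite permM tpermD //.
  by apply: contraNneq ax => ->; rewrite porbit_sym.
by apply: contraNneq ay => ->; rewrite porbit_sym.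
Qed.

Lemma porbit_tperm_sub s x y d : y \in porbit s x -> porbit (s * tperm x y) d \subset porbit s d.
Proof.
move=> yx; apply: porbit_sub_stable; rewrite ?porbit_id //.
apply: stable_mul_tperm; last exact: stable_porbit.
by rewrite ![_ \in porbit s d]porbit_sym (eq_porbit yx).
Qed.

(* The [s * u]-orbit of [e] enters [F] at [e] by a jump of [u], so it also leaves
   [F] by a jump of [u]. *)
Lemma porbit_reroute s u A F e e' :
  stable (s * u) A -> stable s F -> e \in A -> e \in F -> u e' = e -> e' \notin F ->
  exists b, [/\ b \in F, u b \in A & u b \notin F].
Proof.
move=> sA sF eA eF ue' e'F.
have [||a [ae aF aF']] := @porbit_exit _ (s * u) F e (s^-1 e') eF.
- by rewrite porbit_sym (_ : e = (s * u) (s^-1 e')) ?mem_porbit1 // permM permKV.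
- by rewrite stable_mem ?groupV.
exists (s a); rewrite -permM stable_mem // stable_mem //; split=> //.
by rewrite (porbit_mem_stable sA ae).
Qed.

Definition skip s c := s * tperm c (s c).

Lemma skip_id s c : skip s c c = c.
Proof. by rewrite permM tpermR. Qed.

Lemma skip_neq s c d : d != c -> s d != c -> skip s c d = s d.
Proof. by move=> dc sdc; rewrite permM tpermD // eq_sym // (inj_eq perm_inj). Qed.

Lemma porbit_skip s c d : d != c -> porbit (skip s c) d = porbit s d :\ c.
Proof.
move=> dc; have [cd|cd] := boolP (c \in porbit s d); last first.
  rewrite /skip porbit_tperm_out ?porbit1 1?porbit_sym //.
  by apply/esym/setDidPl; rewrite disjoint_sym disjoints1.
have sc := porbit_fix (skip_id s c); have := porbit_split (mem_porbit1 s c).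
rewrite (eq_porbit cd) -/(skip s c) sc => split_d.
have dsc : d \in porbit (skip s c) (s c).
  by have := porbit_id s d; rewrite split_d in_setU1 (negPf dc).
rewrite split_d (eq_porbit dsc) setU1K // porbit_sym sc in_set1.
by apply: contra dc => /eqP scc; move: dsc; rewrite scc sc in_set1.
Qed.

End MulTperm.

Section Moved.
Variable T : finType.
Implicit Types (s : {perm T}) (A : {set T}).

Definition moved s := [set x | s x != x].

Lemma stable_moved s : stable s (moved s).
Proof. by apply: homo_stable => x; rewrite !inE (inj_eq perm_inj). Qed.

Lemma notin_moved s x : x \notin moved s -> s x = x.
Proof. by rewrite inE negbK => /eqP. Qed.

Lemma card_porbits_moved s : #|porbits s| = #|porbit s @: moved s| + #|~: moved s|.
Proof.
rewrite (card_porbits_stable (stable_moved s)); congr (_ + _)%N; apply: card_in_imset => a b.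
by rewrite !in_setC => /notin_moved/porbit_fix-> /notin_moved/porbit_fix-> /set1_inj.
Qed.

Lemma moved_mul_tperm s x y : s x != x -> s y != y -> moved (s * tperm x y) \subset moved s.
Proof.
move=> sx sy; apply/subsetP => a; rewrite !inE; apply: contra => /eqP sa.
by rewrite permM sa tpermD //; apply/eqP => e; rewrite e sa eqxx in sx sy.
Qed.

Lemma moved_skip s c : moved (skip s c) \subset moved s :\ c.
Proof.
apply/subsetP => a; rewrite !inE; have [->|ac] /= := eqVneq a c; first by rewrite skip_id eqxx.
by apply: contra => /eqP sa; rewrite skip_neq // ?sa.
Qed.

Lemma moved_restr_perm s A : stable s A -> moved (restr_perm A s) \subset moved s :&: A.
Proof.
move=> sA; apply/subsetP => x; rewrite !inE; have [xA|xA] := boolP (x \in A).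
  by rewrite restr_permE // andbT.
by rewrite restr_perm_out ?eqxx.
Qed.

End Moved.

(** * Euler's formula for combinatorial maps *)

Section Components.
Variables (D : finType) (t : {perm D}).
Implicit Types (r : {perm D}) (x y d : D) (S : {set D}).

Definition component r x := orbit 'P <<[set t; r]>> x.
Definition components r := component r @: [set: D].

Lemma mem_component_id r x : x \in component r x.
Proof. exact: orbit_refl. Qed.

Lemma component_sym r x y : (x \in component r y) = (y \in component r x).
Proof. exact: orbit_sym. Qed.

Lemma eq_component r x y : y \in component r x -> component r y = component r x.
Proof. by move/orbit_eqP. Qed.

Lemma component_flip r x : stable t (component r x).
Proof. by rewrite (subsetP (acts_orbit 'P x (subsetT _))) // mem_gen // set21. Qed.

Lemma component_rot r x : stable r (component r x).
Proof. by rewrite (subsetP (acts_orbit 'P x (subsetT _))) // mem_gen // set22. Qed.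

Lemma component_sub_stable r S x : stable t S -> stable r S -> x \in S -> component r x \subset S.
Proof. by move=> tS rS xS; rewrite acts_sub_orbit // gen_subG subUset !sub1set tS. Qed.

Lemma component_invariant (R : eqType) (f : D -> R) r x y :
  (forall a, f (t a) = f a) -> (forall a, f (r a) = f a) -> y \in component r x -> f y = f x.
Proof.
move=> ft fr; pose S := [set a | f a == f x]; have xS : x \in S by rewrite inE.
have stS (s : {perm D}) : (forall a, f (s a) = f a) -> stable s S.
  by move=> fs; apply: homo_stable => a; rewrite !inE fs.
by move/(subsetP (component_sub_stable (stS t ft) (stS r fr) xS)); rewrite inE => /eqP.
Qed.

Lemma porbit_sub_component r x : porbit r x \subset component r x.
Proof. by apply: porbit_sub_stable (component_rot r x) _; apply: mem_component_id. Qed.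

Lemma face_sub_component r x : porbit (t * r) x \subset component r x.
Proof.
apply: porbit_sub_stable (mem_component_id r x).
by rewrite groupM ?component_flip ?component_rot.
Qed.

Lemma card_invariant_components (R : finType) (f : D -> R) r :
  (forall a, f (t a) = f a) -> (forall a, f (r a) = f a) ->
  #|f @: [set: D]| <= #|components r|.
Proof.
move=> ft fr; apply: leq_card_imset_factor => a b _ _ ab.
by apply: component_invariant ft fr _; rewrite -ab mem_component_id.
Qed.

Lemma card_components_mul_tperm r x y :
  #|components (r * tperm x y)| <= #|components r|.+1.
Proof.
set r' := r * tperm x y.
pose f a := if a \in component r' y then component r' x else component r' a.
have f_r' s a : stable s (component r' a) -> stable s (component r' y) -> f (s a) = f a.
  move=> sa sy; rewrite /f stable_mem //; case: ifP => // _.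
  by apply: eq_component; rewrite stable_mem ?mem_component_id.
have le_f : #|f @: [set: D]| <= #|components r|.
  apply: card_invariant_components => a; first by rewrite f_r' ?component_flip.
  apply: (@mul_tperm_invariant _ _ f r x y); last by rewrite f_r' ?component_rot.
  by rewrite /f mem_component_id; case: ifP.
suff sub : components r' \subset component r' y |: f @: [set: D].
  rewrite (leq_trans (subset_leq_card sub)) // cardsU1 -(add1n #|components r|) leq_add //.
  by case: (_ \notin _).
apply/subsetP => _ /imsetP[a _ ->]; rewrite in_setU1.
have [ay|ay] := boolP (a \in component r' y); first by rewrite (eq_component ay) eqxx.
by apply/orP; right; apply/imsetP; exists a; rewrite /f ?(negPf ay).
Qed.

Section Joined.
Variables (r : {perm D}) (x y : D).
Let r' := r * tperm x y.
Hypothesis joined : y \in component r' x.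

Lemma component_joined_rot a : component r' (r a) = component r' a.
Proof.
apply: (@mul_tperm_invariant _ _ _ r x y); first by rewrite (eq_component joined).
by apply: eq_component; rewrite stable_mem ?component_rot ?mem_component_id.
Qed.

Lemma component_joined_flip a : component r' (t a) = component r' a.
Proof. by apply: eq_component; rewrite stable_mem ?component_flip ?mem_component_id. Qed.

Lemma card_components_joined : #|components r'| <= #|components r|.
Proof.
by apply: card_invariant_components => a; rewrite ?component_joined_rot ?component_joined_flip.
Qed.

Lemma ltn_card_components_joined : y \notin component r x -> #|components r'| < #|components r|.
Proof.
move=> yx; pose f a := if a \in component r x then None else Some (component r' a).
have le_f : #|f @: [set: D]| <= #|components r|.
  apply: card_invariant_components => a; rewrite /f stable_mem ?component_flip ?component_rot //.
    by rewrite component_joined_flip.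
  by rewrite component_joined_rot.
apply: leq_trans le_f; have SomeI : injective (@Some {set D}) by move=> A B [].
rewrite /components -(card_imset _ SomeI) -imset_comp -add1n.
have <- : (None \notin (Some \o component r') @: [set: D]) = 1%N :> nat.
  by apply/eqP; rewrite eqb1; apply/negP => /imsetP[].
rewrite -cardsU1; apply/subset_leq_card/subsetP => o; rewrite in_setU1.
case/orP=> [/eqP->|/imsetP[a _ ->]].
  by apply/imsetP; exists x; rewrite /f ?mem_component_id.
apply/imsetP; rewrite /f /=; have [ax|ax] := boolP (a \in component r x).
  exists y => //; rewrite (negPf yx) (eq_component joined); congr Some.
  by apply: component_invariant ax => b; rewrite ?component_joined_rot ?component_joined_flip.
by exists a; rewrite // (negPf ax).
Qed.

End Joined.
End Components.

Section Euler.
Variables (D : finType) (t : {perm D}).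
Implicit Types (r : {perm D}) (x y d : D) (S : {set D}).

Definition euler_excess n r :=
  #|D|./2 + #|components t r|.*2 + n <= #|porbits r| + #|porbits (t * r)|.

(* Only this half of Euler's formula depends on the map; the other one is [euler_le]. *)
Definition planar r := euler_excess 0 r.

Lemma face_mul_tperm r x y : t * (r * tperm x y) = t * r * tperm x y.
Proof. exact: mulgA. Qed.

Lemma euler_mul_tperm n r x y : euler_excess n r -> x != y ->
  [|| y \in porbit r x, y \in porbit (t * r) x | y \notin component t r x] ->
  euler_excess n (r * tperm x y).
Proof.
rewrite /euler_excess face_mul_tperm => pl xy.
have joined := card_components_joined (t := t) (r := r) (x := x) (y := y).
have [rxy _|nrxy] := boolP (y \in porbit r x).
  have Vs := card_porbits_split xy rxy.
  have [fxy|nfxy] := boolP (y \in porbit (t * r) x).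
    have Fs := card_porbits_split xy fxy.
    by have := card_components_mul_tperm t r x y; lia.
  have Fm := card_porbits_merge nfxy; suff /joined : y \in component t (r * tperm x y) x by lia.
  by rewrite (subsetP (face_sub_component _ _ _)) // face_mul_tperm mem_porbit_merge.
have cxy : y \in component t (r * tperm x y) x.
  by rewrite (subsetP (porbit_sub_component _ _ _)) // mem_porbit_merge.
have Vm := card_porbits_merge nrxy; have Cl := joined cxy.
have [fxy _|nfxy ncxy] := boolP (y \in porbit (t * r) x).
  by have Fs := card_porbits_split xy fxy; lia.
have Fm := card_porbits_merge nfxy.
by have Cm := ltn_card_components_joined cxy ncxy; lia.
Qed.

(* The darts outside [S] are split off one at a time. *)
Lemma euler_restr_perm n r S : stable r S -> euler_excess n r -> euler_excess n (restr_perm S r).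
Proof.
have [m] := ubnP #|moved r :\: S|; elim: m r => // m IHm r.
rewrite ltnS => cnt rS er; have [out0|/set0Pn[x]] := boolP (moved r :\: S == set0).
  suff -> : restr_perm S r = r by [].
  apply/permP => d; have [dS|dS] := boolP (d \in S); first exact: restr_permE.
  by rewrite restr_perm_out // notin_moved //; apply: contra dS; apply: subsetP; rewrite -setD_eq0.
rewrite in_setD inE => /andP[xS rx].
have skipS : stable (skip r x) S by rewrite stable_mul_tperm ?stable_mem.
have -> : restr_perm S r = restr_perm S (skip r x).
  apply/permP => d; have [dS|dS] := boolP (d \in S); last by rewrite !restr_perm_out.
  rewrite !restr_permE // skip_neq //; first by apply: contraNneq xS => <-.
  by apply: contraNneq xS => <-; rewrite stable_mem.
apply: IHm => //; last by rewrite euler_mul_tperm ?mem_porbit1 // eq_sym.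
apply: leq_trans cnt; apply/proper_card/properP; split.
  exact: setSD (subset_trans (moved_skip r x) (subsetDl _ _)).
by exists x; rewrite !inE ?xS // skip_id eqxx.
Qed.

Hypotheses (tK : involutive t) (tN : forall d, t d != d).

Lemma card_porbits_flip : #|porbits t|.*2 = #|D|.
Proof. by rewrite porbitsT card_porbit_invol ?cardsT //; apply: homo_stable => x; rewrite !inE. Qed.

Lemma euler_le r : #|porbits r| + #|porbits (t * r)| <= #|D|./2 + #|components t r|.*2.
Proof.
rewrite leqNgt; apply/negP => lt.
have st : stable r set0 by apply: homo_stable => d; rewrite inE.
have /(euler_restr_perm st) : euler_excess 1 r by rewrite /euler_excess addn1.
have -> : restr_perm set0 r = 1 by apply/permP => d; rewrite restr_perm_out ?inE ?perm1.
rewrite /euler_excess mulg1.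
have : #|porbits t| <= #|components t 1|.
  by rewrite porbitsT card_invariant_components // => a; rewrite ?porbit1 ?perm1.
have := card_porbits_flip; have : #|porbits (1 : {perm D})| <= #|D| by apply: leq_imset_card.
by lia.
Qed.

Lemma euler_formula r : planar r ->
  #|porbits r| + #|porbits (t * r)| = #|D|./2 + #|components t r|.*2.
Proof. by rewrite /planar /euler_excess addn0 => pl; apply/eqP; rewrite eqn_leq euler_le. Qed.

(* The Jordan curve runs inside a face from the corner [x] to the corner [y] of the
   same vertex. *)
Lemma jordan r x y : planar r -> x != y -> y \in porbit r x -> y \in porbit (t * r) x ->
  y \notin component t (r * tperm x y) x.
Proof.
move=> /euler_formula pl xy rxy fxy; apply/negP => /card_components_joined.
have := euler_le (r * tperm x y); rewrite face_mul_tperm.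
by rewrite (card_porbits_split xy rxy) (card_porbits_split xy fxy); lia.
Qed.

End Euler.

(** * Colorings of maps *)

Section Colorings.
Variables (D : finType) (t : {perm D}).
Implicit Types (r : {perm D}) (x y d : D) (S F : {set D}).

Definition loopless_map r := forall d, t d \notin porbit r d.

Definition facial_degree r d := #|porbit r @: porbit (t * r) d|.

Record bounded_map m r : Prop := BoundedMap {
  bounded_planar : planar t r;
  bounded_loopless : loopless_map r;
  bounded_degree : forall d, facial_degree r d <= m
}.

Lemma mem_face_succ r d : r (t d) \in porbit (t * r) d.
Proof. by rewrite -permM mem_porbit1. Qed.

Lemma bounded_map_gt1 m r d : bounded_map m r -> 1 < m.
Proof.
case=> _ ll /(_ d); apply: leq_trans; rewrite /facial_degree.
have -> : 2 = #|[set porbit r d; porbit r (t d)]|.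
  by rewrite cards2 eq_porbit_mem porbit_sym (negPf (ll d)).
apply/subset_leq_card/subsetP => A /set2P[]->; first by rewrite imset_f ?porbit_id.
by rewrite -porbit1 imset_f ?mem_face_succ.
Qed.

Section Coloring.
Variable k : nat.
Implicit Types c : D -> 'I_k.

Definition proper_on r c F := {in F &, forall d e, c d = c e -> e \in porbit r d}.

Definition proper_in r S c := {in S, forall d,
  c (r d) = c d /\ proper_on r c (porbit (t * r) d)}.

Definition proper_map r c := proper_in r [set: D] c.

Definition colorable r := exists c, proper_map r c.

Lemma proper_in_vertex r S c d e : stable r S -> proper_in r S c ->
  d \in S -> e \in porbit r d -> c e = c d.
Proof.
move=> rS pc dS /porbitP[i ->]; elim: i => [|i IHi]; first by rewrite expg0 perm1.
rewrite expgSr permM -IHi; have [|-> //] := pc ((r ^+ i) d).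
by rewrite (porbit_mem_stable rS (mem_porbit r i d)).
Qed.

Lemma proper_vertex r c d e : proper_map r c -> e \in porbit r d -> c e = c d.
Proof. by move=> pc; apply: porbit_invariant => a; have [] := pc a (in_setT a). Qed.

Lemma proper_face r c d e : proper_map r c -> e \in porbit (t * r) d -> c d = c e ->
  e \in porbit r d.
Proof. by move=> pc de; have [_] := pc d (in_setT d); apply; rewrite ?porbit_id. Qed.

Lemma proper_on_sub r r' c F : (forall d, porbit r' d \subset porbit r d) ->
  proper_on r' c F -> proper_on r c F.
Proof. by move=> sub pF d e dF eF cde; apply/(subsetP (sub d))/pF. Qed.

Lemma proper_onU r c F F' : proper_on r c F -> proper_on r c F' ->
  (forall a b, a \in F -> b \in F' -> c a = c b -> b \in porbit r a) -> proper_on r c (F :|: F').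
Proof.
move=> pF pF' cross a b; rewrite !in_setU => /orP[]aF /orP[]bF cab; first exact: pF.
- exact: cross.
- by rewrite porbit_sym; apply: cross.
- exact: pF'.
Qed.

Lemma proper_recolor r S c (p : {perm 'I_k}) : proper_in r S c -> proper_in r S (p \o c).
Proof.
move=> pc d dS; have [cd cF] := pc d dS; split; first by rewrite /= cd.
by move=> a b aF bF /perm_inj; apply: cF.
Qed.

Definition glue S c1 c2 : D -> 'I_k := fun d => if d \in S then c1 d else c2 d.

Lemma glue_in S c1 c2 d : d \in S -> glue S c1 c2 d = c1 d.
Proof. by rewrite /glue => ->. Qed.

Lemma glue_out S c1 c2 d : d \notin S -> glue S c1 c2 d = c2 d.
Proof. by rewrite /glue => /negPf->. Qed.

Lemma eq_proper_on r c c' F : {in F, c =1 c'} -> proper_on r c F -> proper_on r c' F.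
Proof. by move=> ecc' pF d e dF eF; rewrite -!ecc' //; apply: pF. Qed.

Lemma proper_glue r S c1 c2 : stable t S -> stable r S ->
  proper_in r S c1 -> proper_in r (~: S) c2 -> proper_map r (glue S c1 c2).
Proof.
move=> tS rS p1 p2 d _; have fS : stable (t * r) S by rewrite groupM.
have same a : a \in porbit (t * r) d -> (a \in S) = (d \in S) by apply: porbit_mem_stable.
have [dS|dS] := boolP (d \in S).
  have [cd cF] := p1 d dS; split; first by rewrite !glue_in ?stable_mem.
  by apply: eq_proper_on cF => a /same aS; rewrite glue_in ?aS.
have [cd cF] : c2 (r d) = c2 d /\ proper_on r c2 (porbit (t * r) d) by apply: p2; rewrite in_setC.
split; first by rewrite !glue_out ?stable_mem.
by apply: eq_proper_on cF => a /same aS; rewrite glue_out ?aS.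
Qed.

End Coloring.

Section Restriction.
Hypotheses (tK : involutive t) (tN : forall d, t d != d).
Variables (r : {perm D}) (S : {set D}).
Hypotheses (tS : stable t S) (rS : stable r S).

Lemma face_restr_perm d : d \in S -> porbit (t * restr_perm S r) d = porbit (t * r) d.
Proof.
apply: eq_porbit_in; first by rewrite groupM.
by move=> a aS; rewrite !permM restr_permE // stable_mem.
Qed.

Lemma face_restr_perm_out d : d \notin S -> porbit (t * restr_perm S r) d = [set d; t d].
Proof.
by move=> dS; rewrite porbit_invol !permM !restr_perm_out ?stable_mem // tK.
Qed.

Lemma bounded_restr_perm m : 1 < m -> planar t r -> loopless_map r ->
  {in S, forall d, facial_degree r d <= m} -> bounded_map m (restr_perm S r).
Proof.
move=> m1 pl ll deg; split=> [|d|d]; first exact: euler_restr_perm.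
  have [dS|dS] := boolP (d \in S); first by rewrite porbit_restr_perm.
  by rewrite porbit_restr_perm_out // in_set1 tN.
rewrite /facial_degree; have [dS|dS] := boolP (d \in S).
  rewrite face_restr_perm //; apply: leq_trans (deg d dS).
  rewrite (@eq_in_imset _ _ _ (porbit r)) // => a ad; rewrite porbit_restr_perm //.
  by rewrite (porbit_mem_stable _ ad) ?groupM.
rewrite face_restr_perm_out // (leq_trans (leq_imset_card _ _)) // (leq_trans _ m1) //.
by rewrite cards2; case: (d != t d).
Qed.

Lemma proper_in_restr_perm k (c : D -> 'I_k) : proper_map (restr_perm S r) c -> proper_in r S c.
Proof.
move=> pc d dS; have [cd cF] := pc d (in_setT d).
rewrite restr_permE // face_restr_perm // in cd cF; split=> // a b aF bF cab.
by rewrite -(porbit_restr_perm rS) ?cF // (porbit_mem_stable _ aF) ?groupM.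
Qed.

End Restriction.

End Colorings.

(** * Cutting at a vertex that occurs twice on a face *)

Section CutVertex.
Variables (D : finType) (t : {perm D}).
Hypotheses (tK : involutive t) (tN : forall d, t d != d).
Implicit Types (r : {perm D}) (x y d : D) (S : {set D}).

Definition smaller_colorable m k r := forall r', bounded_map t m r' ->
  #|moved r'| < #|moved r| -> colorable t k r'.

Lemma colorable_disconnected m k r x y : bounded_map t m r -> smaller_colorable m k r ->
  x \in moved r -> y \in moved r -> y \notin component t r x -> colorable t k r.
Proof.
move=> br IH xm ym nxy; have [pl ll deg] := br.
pose S := component t r x; have [tS rS] := (component_flip t r x, component_rot t r x).
have side S' z : stable t S' -> stable r S' -> z \in moved r -> z \notin S' ->
    exists c : D -> 'I_k, proper_in t r S' c.
  move=> tS' rS' zm zS'; have [|||c pc] := IH _ (bounded_restr_perm tK tN tS' rS' _ pl ll _).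
  - exact: bounded_map_gt1 x br.
  - by [].
  - apply/proper_card/(sub_proper_trans (moved_restr_perm rS')).
    apply/properP; split; first exact: subsetIl.
    by exists z; rewrite // in_setI (negPf zS') andbF.
  by exists c; apply: proper_in_restr_perm pc.
have [c1 p1] := side S y tS rS ym nxy.
have [c2 p2] : exists c : D -> 'I_k, proper_in t r (~: S) c.
  by apply: (side _ x); rewrite ?stableC // in_setC negbK mem_component_id.
by exists (glue S c1 c2); apply: proper_glue.
Qed.

Lemma proper_mul_tperm k r x y (c : D -> 'I_k) (r1 := r * tperm x y) :
  y \in porbit r x -> y \in porbit (t * r) x -> proper_map t r1 c -> c x = c y ->
  [disjoint c @: porbit (t * r1) x :\ c x & c @: porbit (t * r1) y :\ c y] ->
  proper_map t r c.
Proof.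
move=> ryx fyx p1 cxy disj.
have sub d : porbit r1 d \subset porbit r d by apply: porbit_tperm_sub.
have c_r d : c (r d) = c d.
  by apply: mul_tperm_invariant cxy _; have [] := p1 d (in_setT d).
have p1F d : proper_on r c (porbit (t * r1) d).
  by apply: proper_on_sub sub _; have [] := p1 d (in_setT d).
move=> d _; split=> //; have [dx|dx] := boolP (d \in porbit (t * r) x); last first.
  by have := p1F d; rewrite face_mul_tperm porbit_tperm_out // (eq_porbit fyx).
rewrite (eq_porbit dx) (porbit_split fyx) -face_mul_tperm -/r1; apply: proper_onU => //.
move=> a b ax by_ cab; have inV u v : v \in porbit (t * r1) u -> c u = c v -> v \in porbit r u.
  by move=> uv cuv; apply/(subsetP (sub u))/(proper_face p1).
have [cax|cax] := eqVneq (c a) (c x).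
  have bx := inV _ _ by_ (etrans (esym cxy) (etrans (esym cax) cab)).
  rewrite porbit_sym in bx.
  by rewrite (eq_porbit (inV _ _ ax (esym cax))) -(eq_porbit ryx) porbit_sym.
have : c a \in c @: porbit (t * r1) x :\ c x by rewrite !inE cax imset_f.
by move/(disjointFr disj); rewrite !inE -cxy cax cab imset_f.
Qed.

Section CutSide.
Variables (r : {perm D}) (x y : D) (S : {set D}).
Let r1 := r * tperm x y.
Hypotheses (ryx : y \in porbit r x) (fyx : y \in porbit (t * r) x).
Hypotheses (tS : stable t S) (r1S : stable r1 S) (xS : x \in S) (yS : y \notin S).

Lemma mem_side_face d a : a \in porbit (t * r1) d -> (a \in S) = (d \in S).
Proof. by apply: porbit_mem_stable; rewrite groupM. Qed.

Lemma cut_vertex_out d : d \notin porbit r x -> porbit r1 d = porbit r d.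
Proof. by move=> dx; rewrite porbit_tperm_out // (eq_porbit ryx). Qed.

Lemma cut_vertex_side a b : (a \in S) = (b \in S) -> b \in porbit r a -> b \in porbit r1 a.
Proof.
move=> abS ba; have [ax|ax] := boolP (a \in porbit r x); last by rewrite cut_vertex_out.
have bx : b \in porbit r x by rewrite -(eq_porbit ax).
have inS d z : d \in porbit r1 z -> (d \in S) = (z \in S) by apply: porbit_mem_stable.
move: ax bx; rewrite (porbit_split ryx) -/r1 !in_setU.
case/orP=> az /orP[]bz; move: (inS _ _ az) (inS _ _ bz) abS;
  by rewrite ?xS ?(negPf yS) (eq_porbit az) // => -> ->.
Qed.

Lemma cut_face_sub d : porbit (t * r1) d \subset porbit (t * r) d.
Proof. by rewrite face_mul_tperm porbit_tperm_sub. Qed.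

Lemma cut_degree d : facial_degree t r1 d <= facial_degree t r d.
Proof.
apply: leq_trans (subset_leq_card (imsetS _ (cut_face_sub d))).
apply: leq_card_imset_factor => a b ad bd ab; apply/esym/eq_porbit/cut_vertex_side.
  by rewrite (mem_side_face ad) (mem_side_face bd).
by rewrite ab porbit_id.
Qed.

Lemma cut_side_bounded m : bounded_map t m r -> bounded_map t m (restr_perm S r1).
Proof.
move=> br; have [pl ll deg] := br.
apply: bounded_restr_perm => //; first exact: bounded_map_gt1 x br.
- by apply: euler_mul_tperm => //; [apply: contraNneq yS => <-|rewrite ryx].
- by move=> d; apply: contra (ll d); apply: (subsetP (porbit_tperm_sub _ ryx)).
- by move=> d _; apply: leq_trans (cut_degree d) (deg d).
Qed.

Lemma cut_side_moved : #|moved (restr_perm S r1)| < #|moved r|.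
Proof.
have xy : x != y by apply: contraNneq yS => <-.
have rx := porbit_moved ryx xy.
have ry : r y != y by apply: (@porbit_moved _ _ y x); rewrite 1?porbit_sym 1?eq_sym.
apply/proper_card/(sub_proper_trans (moved_restr_perm r1S))/properP; split.
  by rewrite subIset // moved_mul_tperm.
by exists y; rewrite ?inE // (negPf yS) andbF.
Qed.

Lemma cut_side_colorable m k : bounded_map t m r -> smaller_colorable m k r ->
  exists c : D -> 'I_k, proper_in t r1 S c.
Proof.
move=> br /(_ _ (cut_side_bounded br) cut_side_moved)[c pc].
by exists c; apply: (proper_in_restr_perm tS r1S).
Qed.

Lemma cut_side_colors k (c : D -> 'I_k) : proper_in t r1 S c ->
  #|c @: porbit (t * r1) x :\ c x| <= #|porbit r @: (porbit (t * r1) x :\: porbit r x)|.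
Proof.
move=> pc; set F := porbit (t * r1) x.
have FS a : a \in F -> a \in S by move/mem_side_face->.
have cV a b : a \in F -> b \in S -> a \in porbit r b -> c a = c b.
  move=> aF bS ab; apply: (proper_in_vertex r1S pc) => //.
  by apply: cut_vertex_side; rewrite ?bS ?FS.
apply: leq_trans (_ : _ <= #|c @: (F :\: porbit r x)|) _.
  apply/subset_leq_card/subsetP => v /setD1P[vx /imsetP[a aF va]]; rewrite va in vx *.
  by rewrite imset_f // in_setD aF andbT; apply: contra vx => ax; rewrite (cV a x).
apply: leq_card_imset_factor => a b /setDP[aF _] /setDP[bF _] ab.
by apply: cV; rewrite ?FS // -ab porbit_id.
Qed.

Lemma cut_faces_degree :
  #|porbit r @: (porbit (t * r1) x :\: porbit r x)| +
  #|porbit r @: (porbit (t * r1) y :\: porbit r x)| < facial_degree t r x.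
Proof.
set A := porbit r @: _; set B := porbit r @: _.
have disjAB : [disjoint A & B].
  apply/pred0P => V; apply/negP => /andP[/imsetP[a /setDP[aF ax] ->] /imsetP[b /setDP[bF bx] ab]].
  have : b \in porbit r1 a by rewrite cut_vertex_out // ab porbit_id.
  move/(porbit_mem_stable r1S); rewrite (mem_side_face aF) (mem_side_face bF) xS.
  by rewrite (negPf yS).
have xAB : porbit r x \notin A :|: B.
  have notin F : porbit r x \notin porbit r @: (F :\: porbit r x).
    by apply/imsetP => -[a /setDP[_ ax] e]; rewrite e porbit_id in ax.
  by rewrite in_setU negb_or !notin.
have cAB : #|porbit r x |: (A :|: B)| = (#|A| + #|B|).+1.
  by rewrite cardsU1 xAB cardsU disjoint_setI0 // cards0 subn0.
rewrite -cAB; apply/subset_leq_card; rewrite subUset sub1set imset_f ?porbit_id //= -imsetU.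
by rewrite -setDUl imsetS // subDset (porbit_split fyx) face_mul_tperm subsetUr.
Qed.

End CutSide.

Lemma colorable_cut_vertex m k r x y : m <= k -> bounded_map t m r -> smaller_colorable m k r ->
  x != y -> y \in porbit r x -> y \in porbit (t * r) x -> colorable t k r.
Proof.
move=> mk br IH xy ryx fyx; have [pl _ deg] := br.
pose r1 := r * tperm x y; pose S := component t r1 x.
have [tS r1S] : stable t S /\ stable r1 S by rewrite component_flip component_rot.
have [xS yS] : x \in S /\ y \notin S by rewrite mem_component_id jordan.
have [tS' r1S'] : stable t (~: S) /\ stable (r * tperm y x) (~: S) by rewrite tpermC !stableC.
have [xS' yS'] : x \notin ~: S /\ y \in ~: S by rewrite !in_setC negbK.
have [ryx' fyx'] : x \in porbit r y /\ x \in porbit (t * r) y by rewrite ![x \in _]porbit_sym.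
have [c1 p1] := cut_side_colorable ryx fyx tS r1S xS yS br IH.
have [c2 p2] := cut_side_colorable ryx' fyx' tS' r1S' yS' xS' br IH.
pose F1 := porbit (t * r1) x; pose F2 := porbit (t * r1) y.
have cards : #|c1 @: F1 :\ c1 x| + #|c2 @: F2 :\ c2 y| < k.
  apply: leq_trans mk; apply: leq_trans (deg x).
  apply: leq_ltn_trans (cut_faces_degree ryx fyx tS r1S xS yS).
  have le2 := cut_side_colors ryx' tS' r1S' yS' xS' p2; rewrite tpermC (eq_porbit ryx) in le2.
  exact: leq_add (cut_side_colors ryx tS r1S xS yS p1) le2.
rewrite tpermC in p2.
have [p py disj] : exists2 p : {perm 'I_k}, p (c2 y) = c1 x
    & [disjoint p @: (c2 @: F2 :\ c2 y) & c1 @: F1 :\ c1 x].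
  by apply: ex_perm_avoiding; rewrite ?card_ord 1?addnC // !inE eqxx.
have pr1 := proper_glue tS r1S p1 (proper_recolor p p2).
set c := glue S c1 (p \o c2) in pr1; exists c.
have [cx cy] : c x = c1 x /\ c y = c1 x by rewrite /c glue_in // glue_out //= py.
apply: proper_mul_tperm pr1 _ _ => //; first by rewrite cx cy.
have -> : c @: porbit (t * r1) x = c1 @: F1.
  apply: eq_in_imset => a aF; rewrite /c glue_in //.
  by rewrite (mem_side_face tS r1S aF).
have -> : c @: porbit (t * r1) y = p @: (c2 @: F2).
  rewrite -imset_comp; apply: eq_in_imset => a aF; rewrite /c glue_out //.
  by rewrite (mem_side_face tS r1S aF).
rewrite cx cy disjoint_sym; apply: disjointWl disj.
apply/subsetP => b /setD1P[bx /imsetP[a aF2 ba]]; rewrite ba -py (inj_eq perm_inj) in bx *.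
by rewrite imset_f // !inE bx.
Qed.

End CutVertex.

(** * Closed curves through two vertices *)

Section Curves.
Variables (D : finType) (t : {perm D}).
Hypotheses (tK : involutive t) (tN : forall d, t d != d).
Implicit Types (r : {perm D}) (x y z w d : D) (S : {set D}).

(* The closed curve leaves the vertex of [x] and [y] through the corner [x], crosses a
   face to the corner [z] of a second vertex, and returns from its corner [w] to [y]
   through another face. *)
Definition curve r x y z w :=
  [&& y \in porbit r x, w \in porbit r z, z \notin porbit r x,
      z \in porbit (t * r) x, w \in porbit (t * r) y & y \notin porbit (t * r) x].

Definition swap x y z w : {perm D} := tperm x y * tperm z w.

Definition curve_cut r x y z w := r * swap x y z w.

Lemma curve_cutE r x y z w : curve_cut r x y z w = r * tperm x y * tperm z w.
Proof. exact: mulgA. Qed.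

Lemma face_curve_cut r x y z w : t * curve_cut r x y z w = t * r * swap x y z w.
Proof. exact: mulgA. Qed.

Lemma curveE r x y z w : curve r x y z w =
  [&& porbit r y == porbit r x, porbit r w == porbit r z, porbit r z != porbit r x,
      porbit (t * r) z == porbit (t * r) x, porbit (t * r) w == porbit (t * r) y
    & porbit (t * r) y != porbit (t * r) x].
Proof. by rewrite !eq_porbit_mem. Qed.

Lemma curve_sym r x y z w : curve r x y z w -> curve r y x w z.
Proof.
rewrite !curveE => /and5P[/eqP-> /eqP-> zx /eqP-> /andP[/eqP-> yx]].
by rewrite !eqxx zx eq_sym yx.
Qed.

Lemma curve_rev r x y z w : curve r x y z w -> curve r w z y x.
Proof.
rewrite !curveE => /and5P[/eqP-> /eqP-> zx /eqP-> /andP[/eqP-> yx]].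
by rewrite !eqxx eq_sym zx eq_sym yx.
Qed.

Lemma swap_sym x y z w : swap y x w z = swap x y z w.
Proof. by rewrite /swap tpermC [tperm w z]tpermC. Qed.

Section OneCurve.
Variables (r : {perm D}) (x y z w : D).
Hypothesis xyzw : curve r x y z w.
Let f := porbit (t * r) x.
Let g := porbit (t * r) y.
Let cut := curve_cut r x y z w.

Lemma curve_faces : [/\ x \in f, z \in f, y \in g & w \in g].
Proof. by case/and5P: xyzw => _ _ _ zf /andP[wg _]; rewrite !porbit_id. Qed.

Lemma curve_faces_disjoint : [disjoint f & g].
Proof.
apply/pred0P => d; apply/negP => /andP[df dg]; case/and5P: xyzw => _ _ _ _ /andP[_ /negP[]].
by rewrite -(eq_porbit df) (eq_porbit dg) porbit_id.
Qed.

Lemma curve_neq : [/\ x != y, z != w, x != z & [/\ x != w, y != z & y != w]].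
Proof.
have [xf zf yg wg] := curve_faces; have dfg := disjointFr curve_faces_disjoint.
have face_neq a b : a \in f -> b \in g -> a != b.
  by move=> af bg; apply: contraTneq bg => <-; rewrite dfg.
have [ryx rwz rzx _ _] := and5P xyzw.
split; last split; rewrite 1?[y == z]eq_sym; try exact: face_neq.
  by apply: contraNneq rzx => <-; apply: porbit_id.
by apply: contraNneq rzx => yw; rewrite -(eq_porbit ryx) yw porbit_sym.
Qed.

Lemma swap_rev : swap w z y x = swap x y z w.
Proof.
have [xy zw xz [xw yz yw]] := curve_neq.
by rewrite /swap [tperm w z]tpermC [tperm y x]tpermC tperm_commute // eq_sym.
Qed.

Variant swap_spec d : D -> Type :=
  | SwapX of d = x : swap_spec d y
  | SwapY of d = y : swap_spec d x
  | SwapZ of d = z : swap_spec d w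
  | SwapW of d = w : swap_spec d z
  | SwapNone of d != x & d != y & d != z & d != w : swap_spec d d.

Lemma swapP d : swap_spec d (swap x y z w d).
Proof.
have [xy zw xz [xw yz yw]] := curve_neq; rewrite permM.
case: (tpermP x y d) => [->|->|/eqP dx /eqP dy].
- by rewrite tpermD 1?eq_sym //; apply: SwapX.
- by rewrite tpermD 1?eq_sym //; apply: SwapY.
by case: tpermP => [->|->|/eqP dz /eqP dw]; [apply: SwapZ|apply: SwapW|apply: SwapNone].
Qed.

Lemma swapE : [/\ swap x y z w x = y, swap x y z w y = x, swap x y z w z = w
  & swap x y z w w = z].
Proof.
have [xy zw xz [xw yz yw]] := curve_neq.
split; rewrite permM.
- by rewrite tpermL tpermD // eq_sym.
- by rewrite tpermR tpermD // eq_sym.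
- by rewrite (tpermD xz yz) tpermL.
- by rewrite (tpermD xw yw) tpermR.
Qed.

Lemma curve_outer : f :|: g = porbit (t * cut) z :|: porbit (t * cut) w.
Proof.
have [xf zf yg wg] := curve_faces.
have nfy : y \notin f by rewrite (disjointFl curve_faces_disjoint yg).
rewrite /cut curve_cutE !face_mul_tperm -(porbit_merge nfy).
have zx : z \in porbit (t * r * tperm x y) x by rewrite porbit_merge // in_setU zf.
rewrite -(eq_porbit zx); apply: porbit_split.
by rewrite (eq_porbit zx) porbit_merge // in_setU wg orbT.
Qed.

Lemma curve_face_out d : d \notin f -> d \notin g -> porbit (t * cut) d = porbit (t * r) d.
Proof.
move=> df dg; have [xf zf yg wg] := curve_faces.
apply: (@eq_porbit_in _ _ _ (porbit (t * r) d)); rewrite ?stable_porbit ?porbit_id // => a ad.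
rewrite face_curve_cut [RHS]permM.
have : (t * r) a \in porbit (t * r) d by rewrite stable_mem ?stable_porbit.
have notin b : b \in f :|: g -> b \notin porbit (t * r) d.
  have fg_stable : stable (t * r) (f :|: g) by apply: stableU; apply: stable_porbit.
  by apply: contraL => /(porbit_mem_stable fg_stable)->; rewrite in_setU negb_or df.
by case: (swapP ((t * r) a)) => // ->; rewrite (negPf (notin _ _)) // in_setU ?xf ?zf ?yg ?wg ?orbT.
Qed.

Lemma curve_vertex_out d : d \notin porbit r x -> d \notin porbit r z -> porbit cut d = porbit r d.
Proof.
have [ryx rwz _ _ _] := and5P xyzw; move=> dx dz.
apply: (@eq_porbit_in _ _ _ (porbit r d)); rewrite ?stable_porbit ?porbit_id // => a ad.
rewrite permM; have : r a \in porbit r d by rewrite stable_mem ?stable_porbit.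
case: (swapP (r a)) => // ->; rewrite porbit_sym ?(negPf dx) ?(negPf dz) //.
  by rewrite (eq_porbit ryx) (negPf dx).
by rewrite (eq_porbit rwz) (negPf dz).
Qed.

Let r1 := r * tperm x y.

Let porbit_r1z : porbit r1 z = porbit r z.
Proof.
have [ryx _ rzx _ _] := and5P xyzw.
by rewrite porbit_tperm_out // (eq_porbit ryx).
Qed.

Lemma curve_vertex_sub d : porbit cut d \subset porbit r d.
Proof.
have [ryx rwz _ _ _] := and5P xyzw; rewrite /cut curve_cutE.
by rewrite (subset_trans (porbit_tperm_sub _ _)) ?porbit_tperm_sub // porbit_r1z.
Qed.

Hypothesis pl : planar t r.

Let pl1 : planar t r1.
Proof.
have [xy _ _ _] := curve_neq; case/and5P: xyzw => ryx _ _ _ _.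
by apply: euler_mul_tperm => //; rewrite ryx.
Qed.

Let face_r1z : w \in porbit (t * r1) z.
Proof.
have [xf zf yg wg] := curve_faces.
have nfy : y \notin f by rewrite (disjointFl curve_faces_disjoint yg).
have out : porbit (t * r1) x = f :|: g by rewrite face_mul_tperm porbit_merge.
have zx : z \in porbit (t * r1) x by rewrite out in_setU zf.
by rewrite (eq_porbit zx) out in_setU wg orbT.
Qed.

Lemma curve_cut_planar : planar t cut.
Proof.
have [_ zw _ _] := curve_neq; rewrite /cut curve_cutE.
by apply: euler_mul_tperm => //; rewrite face_r1z orbT.
Qed.

Lemma curve_cut_separates : w \notin component t cut z.
Proof.
have [_ rwz _ _ _] := and5P xyzw; have [_ zw _ _] := curve_neq; rewrite /cut curve_cutE.
by apply: jordan => //; rewrite porbit_r1z.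
Qed.

End OneCurve.

Definition separation r x y z w S :=
  [&& curve r x y z w, stable t S, stable (curve_cut r x y z w) S, x \in S & y \notin S].

Section SeparationFields.
Variables (r : {perm D}) (x y z w : D) (S : {set D}).
Hypothesis sep : separation r x y z w S.

Lemma separation_curve : curve r x y z w. Proof. by case/and5P: sep. Qed.
Lemma separation_flip : stable t S. Proof. by case/and5P: sep. Qed.
Lemma separation_rot : stable (curve_cut r x y z w) S. Proof. by case/and5P: sep. Qed.
Lemma separation_x : x \in S. Proof. by case/and5P: sep. Qed.
Lemma separation_y : y \notin S. Proof. by case/and5P: sep. Qed.

End SeparationFields.

Lemma ex_separation r x y z w : planar t r -> curve r x y z w ->
  exists S, separation r x y z w S.
Proof.
move=> pl xyzw; exists (component t (curve_cut r x y z w) x); apply/and5P; split=> //.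
- exact: component_flip.
- exact: component_rot.
- exact: mem_component_id.
have := curve_cut_separates (curve_rev (curve_sym xyzw)) pl.
by rewrite /curve_cut (swap_rev (curve_sym xyzw)) swap_sym component_sym.
Qed.

Lemma separation_sym r x y z w S : separation r x y z w S -> separation r y x w z (~: S).
Proof.
case/and5P=> xyzw tS cS xS yS.
by rewrite /separation curve_sym // /curve_cut swap_sym !stableC // !in_setC yS xS.
Qed.

Lemma separation_w r x y z w S : separation r x y z w S -> w \in S.
Proof.
case/and5P=> xyzw tS cS xS yS; have [xf zf yg wg] := curve_faces xyzw.
have dfg := disjointFl (curve_faces_disjoint xyzw).
have [_ sy _ _] := swapE xyzw.
have [|||b [bf]] := @porbit_reroute _ (t * r) _ S (porbit (t * r) x) x y _ _ xS xf sy.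
- by rewrite -face_curve_cut groupM.
- exact: stable_porbit.
- by rewrite dfg.
case: (swapP xyzw b) => [_|_|_|_|_ _ _ _]; rewrite ?(negPf yS) ?bf //.
  by rewrite xf.
by rewrite zf.
Qed.

Lemma separation_z r x y z w S : separation r x y z w S -> z \notin S.
Proof. by move/separation_sym/separation_w; rewrite in_setC. Qed.

Lemma separation_rev r x y z w S : separation r x y z w S -> separation r w z y x S.
Proof.
move=> sep; have [xyzw tS cS _ _] := and5P sep.
rewrite /separation curve_rev // /curve_cut (swap_rev xyzw) tS cS.
by rewrite (separation_w sep) (separation_z sep).
Qed.

Lemma separation_outer r x y z w S : separation r x y z w S ->
  porbit (t * curve_cut r x y z w) x = (porbit (t * r) x :|: porbit (t * r) y) :&: S.
Proof.
move=> sep; have [xyzw tS cS xS _] := and5P sep; set cut := curve_cut r x y z w in cS *.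
have [xf _ _ _] := curve_faces xyzw; have fS : stable (t * cut) S by rewrite groupM.
have inS a b : a \in porbit (t * cut) b -> (a \in S) = (b \in S) by apply: porbit_mem_stable.
have outer_w : porbit (t * cut) w = (porbit (t * r) x :|: porbit (t * r) y) :&: S.
  rewrite (curve_outer xyzw) -/cut; apply/setP => a; rewrite in_setI in_setU.
  have [aw|aw] := boolP (a \in porbit (t * cut) w).
    by rewrite orbT (inS _ _ aw) (separation_w sep).
  by rewrite orbF; apply/esym/negP => /andP[/inS->]; rewrite (negPf (separation_z sep)).
have xw : x \in porbit (t * cut) w by rewrite outer_w in_setI in_setU xf.
by rewrite (eq_porbit xw).
Qed.

Lemma separation_outer_out r x y z w S : separation r x y z w S ->
  porbit (t * curve_cut r x y z w) y = (porbit (t * r) x :|: porbit (t * r) y) :\: S.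
Proof.
move/separation_sym/separation_outer; rewrite /curve_cut swap_sym => ->.
by rewrite setUC setDE.
Qed.

Lemma curve_moved r x y z w : curve r x y z w ->
  [/\ x \in moved r, y \in moved r, z \in moved r & w \in moved r].
Proof.
move=> xyzw; have [ryx rwz _ _ _] := and5P xyzw; have [xy zw _ _] := curve_neq xyzw.
by split; rewrite inE; [apply: porbit_moved ryx xy|apply: (porbit_moved (y := x))
  |apply: porbit_moved rwz zw|apply: (porbit_moved (y := z))]; rewrite 1?porbit_sym 1?eq_sym.
Qed.

End Curves.

(** * Curves with other faces on both sides *)

Section Reducing.
Variables (D : finType) (t : {perm D}).
Hypotheses (tK : involutive t) (tN : forall d, t d != d).
Implicit Types (r : {perm D}) (x y z w d e : D) (S T : {set D}).

Definition nonrepeating r := forall x y, y \in porbit r x -> y \in porbit (t * r) x -> x = y.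

Definition off_faces r x y d :=
  [&& d \in moved r, d \notin porbit (t * r) x & d \notin porbit (t * r) y].

Definition reducing r x y z w S :=
  [&& separation t r x y z w S, [exists d in S, off_faces r x y d]
    & [exists d in ~: S, off_faces r x y d]].

Definition outer_corners r x y S := (porbit (t * r) x :|: porbit (t * r) y) :\: S.

Lemma off_faces_sym r x y d : off_faces r y x d = off_faces r x y d.
Proof. by rewrite /off_faces [X in _ && X]andbC. Qed.

Lemma reducing_sym r x y z w S : reducing r x y z w S -> reducing r y x w z (~: S).
Proof.
case/and3P=> sep offS offC; rewrite /reducing separation_sym //= setCK.
by apply/andP; split; [apply: etrans offC|apply: etrans offS];
  apply: eq_existsb => d; rewrite off_faces_sym.
Qed.

Section SecondCut.
Variables (r : {perm D}) (x y z w e e' : D) (S : {set D}).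
Hypotheses (nr : nonrepeating r) (sep : separation t r x y z w S).
Hypotheses (ex : e \in porbit (t * r) x) (eS : e \notin S).
Hypotheses (e'y : e' \in porbit (t * r) y) (e'S : e' \notin S) (ree' : e' \in porbit r e).
Let cut := curve_cut r x y z w.

Let xyzw := separation_curve sep.

Lemma second_cut_vertex : e \notin porbit r x /\ e \notin porbit r z.
Proof.
have [_ _ _ xS _] := and5P sep; have [_ _ _ wy] := curve_faces xyzw.
have [_ rwz _ _ _] := and5P xyzw; split.
  by apply: contra eS => rex; rewrite -(nr rex ex).
apply: contra e'S => rez; have we' : e' \in porbit r w.
  by rewrite (eq_porbit rwz) -(eq_porbit rez).
by rewrite -(nr we') ?(separation_w sep) // (eq_porbit wy).
Qed.

Lemma second_cut_neq : {in porbit r e, forall a, a \notin [:: x; y; z; w]}.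
Proof.
move=> a ae; have [nex nez] := second_cut_vertex; have [ryx rwz _ _ _] := and5P xyzw.
rewrite !inE; apply/negP => /or4P[]/eqP aq; move: ae nex nez; rewrite aq porbit_sym.
- by move->.
- by rewrite (eq_porbit ryx) => ->.
- by move->.
- by rewrite (eq_porbit rwz) => ->.
Qed.

Lemma ex_second_cut : planar t r -> exists T : {set D},
  [/\ stable t T, stable (cut * tperm e e') T, [disjoint T & S], e \in T & e' \notin T].
Proof.
move=> pl; have [_ tS cS _ _] := and5P sep; pose cut2 := cut * tperm e e'.
have cut2S : stable cut2 S by rewrite stable_mul_tperm // (negPf eS) (negPf e'S).
exists (component t cut2 e); rewrite component_flip component_rot mem_component_id; split=> //.
  by rewrite disjoints_subset component_sub_stable ?stableC // in_setC.
have [nex nez] := second_cut_vertex; apply: jordan => //; first exact: curve_cut_planar.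
- by apply: contraTneq e'y => <-; rewrite (disjointFr (curve_faces_disjoint xyzw) ex).
- by rewrite (curve_vertex_out xyzw).
have ey : e \in porbit (t * cut) y by rewrite (separation_outer_out sep) !inE ex eS.
by rewrite (eq_porbit ey) (separation_outer_out sep) !inE e'y e'S orbT.
Qed.

Variable T : {set D}.
Hypotheses (tT : stable t T) (cT : stable (cut * tperm e e') T).
Hypotheses (dTS : [disjoint T & S]) (eT : e \in T) (e'T : e' \notin T).

Lemma second_cut_y : y \in T.
Proof.
have [xf zf yg wg] := curve_faces xyzw; have dfg := disjointFl (curve_faces_disjoint xyzw).
have [ne ne'] := (second_cut_neq (porbit_id r e), second_cut_neq ree').
have quad_neq a : a \in [:: x; y; z; w] -> tperm e e' a = a.
  by move=> aq; rewrite tpermD //; apply: contraTneq aq => <-.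
have jump_e' : (swap x y z w * tperm e e') e' = e.
  rewrite permM; case: (swapP xyzw e') ne' => [->|->|->|->|_ _ _ _]; rewrite ?tpermR //;
    by rewrite !inE eqxx ?orbT.
have [|||b [bf]] := @porbit_reroute _ (t * r) _ T (porbit (t * r) x) e e' _ _ eT ex jump_e'.
- by rewrite mulgA -face_curve_cut -mulgA groupM.
- exact: stable_porbit.
- by rewrite dfg.
rewrite permM; case: (swapP xyzw b) => [_|by_|_|bw|_ _ _ _].
- by rewrite quad_neq // !inE eqxx orbT.
- by rewrite by_ dfg in bf.
- by rewrite quad_neq ?(disjointFl dTS (separation_w sep)) // !inE eqxx !orbT.
- by rewrite bw dfg in bf.
- case: tpermP => [_|be'|_ _]; rewrite ?(negPf e'T) ?bf //.
  by rewrite be' dfg in bf.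
Qed.

Hypothesis zT : z \notin T.

Lemma second_cut_reducing : [exists d in S, off_faces r x y d] ->
  [exists d in T, off_faces r x y d] -> reducing r x y e e' (~: T).
Proof.
move=> /exists_inP[d dS offd] offT; have [_ _ _ xS _] := and5P sep.
have inS a : a \in S -> a \notin T by move/(disjointFl dTS)->.
have [nex _] := second_cut_vertex; have [ryx _ _ _ /andP[_ fyx]] := and5P xyzw.
apply/and3P; split; last by rewrite setCK.
  apply/and5P; split; rewrite ?in_setC ?(inS x) ?negbK ?second_cut_y ?stableC //.
    by rewrite /curve ryx ree' nex ex e'y.
  suff -> : curve_cut r x y e e' = cut * tperm e e' * tperm z w.
    by apply: stable_mul_tperm cT; rewrite (negPf zT) (negPf (inS _ (separation_w sep))).
  have neq a b : a \in porbit r e -> b \in [:: x; y; z; w] -> a != b.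
    by move=> ae; apply: contraTneq => <-; apply: second_cut_neq.
  rewrite /cut !curve_cutE -!mulgA [tperm e e' * _]tperm_commute ?mulgA ?mulr_tpermK //;
    by rewrite neq ?porbit_id // !inE eqxx ?orbT.
by apply/exists_inP; exists d; rewrite // in_setC inS.
Qed.

Lemma second_cut_proper : outer_corners r x y (~: T) \proper outer_corners r x y S.
Proof.
have [_ zf _ _] := curve_faces xyzw; apply/properP; split.
  apply/subsetP => a; rewrite !in_setD in_setC negbK => /andP[aT ->].
  by rewrite (disjointFr dTS aT).
by exists z; rewrite in_setD in_setU zf ?in_setC ?negbK ?(negPf zT) // (separation_z sep).
Qed.

End SecondCut.

Lemma off_faces_rev r x y z w d : curve t r x y z w -> off_faces r w z d = off_faces r x y d.
Proof.
case/and5P=> _ _ _ zx /andP[wy _].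
by rewrite /off_faces (eq_porbit zx) (eq_porbit wy) [X in _ && X]andbC.
Qed.

Lemma outer_corners_rev r x y z w S : curve t r x y z w ->
  outer_corners r w z S = outer_corners r x y S.
Proof.
case/and5P=> _ _ _ zx /andP[wy _].
by rewrite /outer_corners (eq_porbit zx) (eq_porbit wy) setUC.
Qed.

(* A second vertex on both faces cuts the side in two pieces, and one of them
   keeps the dart off the two faces. *)
Lemma reducing_smaller r x y z w S e e' :
  nonrepeating r -> planar t r -> reducing r x y z w S ->
  e \in porbit (t * r) x -> e \notin S -> e' \in porbit (t * r) y -> e' \notin S ->
  e' \in porbit r e ->
  exists x' y' z' w' S', reducing r x' y' z' w' S' /\
    #|outer_corners r x' y' S'| < #|outer_corners r x y S|.
Proof.
move=> nr pl /and3P[sep offS offC] ex eS e'y e'S ree'.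
have [xyzw tS _ _ _] := and5P sep; have sep' := separation_rev sep.
have re'e : e \in porbit r e' by rewrite porbit_sym.
have [e'w ez] : e' \in porbit (t * r) w /\ e \in porbit (t * r) z.
  by case/and5P: xyzw => _ _ _ zx /andP[wy _]; rewrite (eq_porbit zx) (eq_porbit wy).
have [T [tT cT dTS eT e'T]] := ex_second_cut nr sep ex eS e'y e'S ree' pl.
have cutS : stable (curve_cut r x y z w * tperm e e') S.
  by rewrite stable_mul_tperm ?(negPf eS) ?(negPf e'S) //; case/and5P: sep.
pose T' := ~: S :&: ~: T.
have [tT' cT'] : stable t T' /\ stable (curve_cut r w z y x * tperm e' e) T'.
  by rewrite /curve_cut (swap_rev xyzw) [tperm e' e]tpermC !(stableI, stableC).
have dT'S : [disjoint T' & S] by rewrite disjoints_subset subsetIl.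
have [eT' e'T'] : e \notin T' /\ e' \in T' by rewrite !in_setI !in_setC eT e'T e'S andbF.
have yT : y \in T
  := second_cut_y nr sep ex eS e'y e'S ree' tT cT dTS eT e'T.
have zT' : z \in T'
  := second_cut_y nr sep' e'w e'S ez eS re'e tT' cT' dT'S e'T' eT'.
have zT : z \notin T by move: zT'; rewrite !in_setI !in_setC => /andP[].
have yT' : y \notin T' by rewrite in_setI !in_setC yT andbF.
have [d dS offd] := exists_inP offC; have [dT|dT] := boolP (d \in T).
  exists x, y, e, e', (~: T); split.
    apply: (second_cut_reducing nr sep ex eS e'y e'S ree' tT cT dTS eT e'T zT offS).
    by apply/exists_inP; exists d.
  exact: proper_card (second_cut_proper sep dTS zT).
exists w, z, e', e, (~: T'); rewrite -(outer_corners_rev S xyzw); split; last first.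
  exact: proper_card (second_cut_proper sep' dT'S yT').
have offE a : off_faces r w z a = off_faces r x y a by apply: off_faces_rev.
apply: (second_cut_reducing nr sep' e'w e'S ez eS re'e tT' cT' dT'S e'T' eT' yT').
  by have [a aS offa] := exists_inP offS; apply/exists_inP; exists a; rewrite ?offE.
by apply/exists_inP; exists d; rewrite ?offE // !in_setI dS in_setC.
Qed.

End Reducing.

(** * Replacing one side of a curve by an edge *)

Section AddEdge.
Variables (D : finType) (t : {perm D}).
Hypotheses (tK : involutive t) (tN : forall d, t d != d).
Implicit Types (s : {perm D}) (x w a d : D).

(* The ends [a] and [t a] of an isolated edge are attached at the corners [x] and [w]. *)
Definition add_edge s x w a := s * tperm x a * tperm w (t a).

Definition attachable s x w a :=
  [&& s a == a, s (t a) == t a, x \notin [set a; t a], w \notin [set a; t a],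
      w \in porbit (t * s) x & w \notin porbit s x].

Variables (s : {perm D}) (x w a : D).
Hypothesis xwa : attachable s x w a.
Let s' := add_edge s x w a.

Let sa : s a = a. Proof. by case/and5P: xwa => /eqP. Qed.
Let sta : s (t a) = t a. Proof. by case/and5P: xwa => _ /eqP. Qed.
Let xa : x \notin [set a; t a]. Proof. by case/and5P: xwa. Qed.
Let wa : w \notin [set a; t a]. Proof. by case/and5P: xwa. Qed.
Let fwx : w \in porbit (t * s) x. Proof. by case/and5P: xwa => _ _ _ _ /andP[]. Qed.
Let nwx : w \notin porbit s x. Proof. by case/and5P: xwa => _ _ _ _ /andP[]. Qed.

Let notin_end d : d \notin [set a; t a] -> d != a /\ d != t a.
Proof. by rewrite in_set2 negb_or => /andP[]. Qed.

Let xw : x != w. Proof. by apply: contraNneq nwx => <-; apply: porbit_id. Qed.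

Lemma add_edge_rev : add_edge s w x (t a) = s'.
Proof.
have [[xa1 xa2] [wa1 wa2]] := (notin_end xa, notin_end wa).
by rewrite /s' /add_edge tK -!mulgA [tperm w _ * _]tperm_commute // eq_sym.
Qed.

Lemma add_edge_a : s' a = x.
Proof.
have [_ xa2] := notin_end xa.
by rewrite 2!permM sa tpermR tpermD // eq_sym.
Qed.

Lemma add_edge_ta : s' (t a) = w.
Proof.
have [_ xa2] := notin_end xa.
by rewrite 2!permM sta (tpermD (z := t a)) ?tpermR // eq_sym.
Qed.

Lemma add_edge_skip : skip (skip s' (t a)) a = s.
Proof.
have -> : skip s' (t a) = s * tperm x a.
  by rewrite /skip add_edge_ta /s' /add_edge [tperm w _]tpermC mulr_tpermK.
by rewrite /skip permM sa tpermR tpermC mulr_tpermK.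
Qed.

Lemma add_edge_vertex d e : d \notin [set a; t a] -> e \notin [set a; t a] ->
  (e \in porbit s' d) = (e \in porbit s d).
Proof.
move=> /notin_end[da dta] /notin_end[ea eta].
by rewrite -[in RHS]add_edge_skip !porbit_skip // !in_setD1 ea eta.
Qed.

Lemma add_edge_porbit_a : porbit s' a = porbit s' x.
Proof. by rewrite -porbit1 add_edge_a. Qed.

Lemma add_edge_porbit_ta : porbit s' (t a) = porbit s' w.
Proof. by rewrite -porbit1 add_edge_ta. Qed.

Lemma add_edge_face_ta : porbit (t * s') (t a) = porbit (t * s') x.
Proof. by rewrite -porbit1 permM tK add_edge_a. Qed.

Let face_ends : porbit (t * s) a = [set a; t a].
Proof.
have tsa : (t * s) a = t a by rewrite permM sta.
by rewrite porbit_invol tsa // permM tK sa.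
Qed.

Let face_half : porbit (t * (s * tperm x a)) x = porbit (t * s) x :|: [set a; t a].
Proof.
have [xa1 _] := notin_end xa; rewrite face_mul_tperm porbit_merge ?face_ends //.
by rewrite porbit_sym face_ends.
Qed.

Let ta_face_w : t a \in porbit (t * (s * tperm x a)) w.
Proof.
have wx : w \in porbit (t * (s * tperm x a)) x by rewrite face_half in_setU fwx.
by rewrite (eq_porbit wx) face_half in_setU set22 orbT.
Qed.

Lemma add_edge_faces : porbit (t * s') x :|: porbit (t * s') w = porbit (t * s) x :|: [set a; t a].
Proof.
have wx : w \in porbit (t * (s * tperm x a)) x by rewrite face_half in_setU fwx.
rewrite -face_half -(eq_porbit wx) (porbit_split ta_face_w) -face_mul_tperm.
by rewrite -/(add_edge s x w a) -/s' add_edge_face_ta setUC.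
Qed.

Lemma add_edge_face_out d : d \notin porbit (t * s) x -> d \notin [set a; t a] ->
  porbit (t * s') d = porbit (t * s) d.
Proof.
move=> dx da; have wx : w \in porbit (t * (s * tperm x a)) x by rewrite face_half in_setU fwx.
have dw : d \notin porbit (t * (s * tperm x a)) w.
  by rewrite (eq_porbit wx) face_half in_setU negb_or dx.
by rewrite face_mul_tperm porbit_tperm_out ?(eq_porbit ta_face_w) // face_mul_tperm
  porbit_tperm_out // face_ends.
Qed.

Lemma add_edge_planar : planar t s -> planar t s'.
Proof.
move=> pl; have [[xa1 _] [_ wa2]] := (notin_end xa, notin_end wa).
apply: euler_mul_tperm => //; last by rewrite ta_face_w orbT.
apply: euler_mul_tperm => //; suff -> : a \notin component t s x by rewrite !orbT.
rewrite component_sym; apply: contra xa; apply/subsetP/component_sub_stable; last exact: set21.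
  by apply: homo_stable => d /set2P[]->; rewrite ?tK ?set21 ?set22.
by apply: homo_stable => d /set2P[]->; rewrite ?sa ?sta ?set21 ?set22.
Qed.

Lemma add_edge_loopless : loopless_map t s -> loopless_map t s'.
Proof.
move=> ll d; have wx : w \notin porbit s' x by rewrite add_edge_vertex.
have [/set2P[]->|da] := boolP (d \in [set a; t a]).
- by rewrite -eq_porbit_mem add_edge_porbit_ta add_edge_porbit_a eq_porbit_mem.
- by rewrite tK -eq_porbit_mem add_edge_porbit_ta add_edge_porbit_a eq_porbit_mem porbit_sym.
rewrite add_edge_vertex //; apply: contra da => /set2P[td|/perm_inj->]; last exact: set21.
by rewrite -td tK set22.
Qed.

End AddEdge.

Section Shrink.
Variables (D : finType) (t : {perm D}).
Hypotheses (tK : involutive t) (tN : forall d, t d != d).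
Implicit Types (r : {perm D}) (x y z w a d : D) (S : {set D}).

(* The side of the curve other than [S] is replaced by the edge [{a, t a}]. *)
Definition shrink r x y z w S a := add_edge t (restr_perm S (curve_cut r x y z w)) x w a.

Section ShrinkSide.
Variables (r : {perm D}) (x y z w a : D) (S : {set D}).
Hypotheses (sep : separation t r x y z w S) (aS : a \notin S).
Let f := porbit (t * r) x.
Let g := porbit (t * r) y.
Let cut := curve_cut r x y z w.
Let side := restr_perm S cut.
Let r' := shrink r x y z w S a.

Let xyzw := separation_curve sep.
Let tS := separation_flip sep.
Let cS := separation_rot sep.
Let xS := separation_x sep.
Let wS := separation_w sep.

Lemma notin_ends d : d \in S -> d \notin [set a; t a].
Proof. by move=> dS; apply/set2P => -[] e; move: dS; rewrite e ?stable_mem // (negPf aS). Qed.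

Lemma side_outer : porbit (t * side) x = (f :|: g) :&: S.
Proof. by rewrite face_restr_perm // (separation_outer sep). Qed.

Lemma side_vertex_sub d : d \in S -> porbit side d \subset porbit r d.
Proof. by move=> dS; rewrite porbit_restr_perm // (curve_vertex_sub xyzw). Qed.

Lemma side_attachable : attachable t side x w a.
Proof.
have [_ _ _ wg] := curve_faces xyzw; have [_ rwz rzx _ _] := and5P xyzw.
rewrite /attachable !notin_ends // !restr_perm_out ?stable_mem // !eqxx /=.
rewrite side_outer in_setI in_setU wg orbT wS /=.
apply: contra rzx => /(subsetP (side_vertex_sub xS)) wx.
by rewrite -(eq_porbit wx) porbit_sym.
Qed.

Lemma shrink_rev : shrink r w z y x S (t a) = r'.
Proof.
rewrite /shrink /curve_cut (swap_rev xyzw).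
exact: add_edge_rev side_attachable.
Qed.

Lemma shrink_vertex d e : d \in S -> e \in S -> e \in porbit r' d -> e \in porbit r d.
Proof.
move=> dS eS; rewrite (add_edge_vertex tN side_attachable) ?notin_ends //.
by move/(subsetP (side_vertex_sub dS)).
Qed.

Lemma shrink_vertex_a : a \in porbit r' x.
Proof. by rewrite -(add_edge_porbit_a side_attachable) porbit_id. Qed.

Lemma shrink_vertex_ta : t a \in porbit r' w.
Proof. by rewrite -(add_edge_porbit_ta tN side_attachable) porbit_id. Qed.

Lemma shrink_face_sub : porbit (t * r') x \subset t a |: (f :&: S).
Proof.
have [xf zf yg wg] := curve_faces xyzw; have dfg := disjointFl (curve_faces_disjoint xyzw).
have notin d : d \in S -> d != a /\ d != t a.
  by move/notin_ends; rewrite in_set2 negb_or => /andP[].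
apply: porbit_sub_stable; last by rewrite in_setU1 in_setI xf xS orbT.
apply: homo_stable => d; rewrite in_setU1 => /predU1P[->|/setIP[df dS]].
  by rewrite permM tK (add_edge_a side_attachable) in_setU1 in_setI xf xS orbT.
have [nxa nwa] := (notin x xS, notin w wS).
have tdf : (t * r) d \in f by rewrite stable_mem ?stable_porbit.
have tdS : t d \in S by rewrite stable_mem.
have : cut (t d) \in S by rewrite stable_mem.
rewrite permM /r' /shrink /add_edge 2!permM restr_permE // /cut /curve_cut permM -(permM t r).
case: (swapP xyzw ((t * r) d)) => [_|e|_|e|dx dy dz dw].
- by case/and5P: sep => _ _ _ _ /negPf->.
- by rewrite e dfg in tdf.
- have [_ _ _ [xw _ _]] := curve_neq xyzw; have [wna _] := nwa.
  by rewrite (@tpermD _ x a) ?tpermL ?in_setU1 ?eqxx // eq_sym.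
- by rewrite e dfg in tdf.
move=> dS'; have [nda ndta] := notin _ dS'.
by rewrite (@tpermD _ x a) 1?eq_sym // tpermD 1?eq_sym // in_setU1 in_setI tdf dS' orbT.
Qed.

End ShrinkSide.

Section ShrinkFaces.
Variables (r : {perm D}) (x y z w a : D) (S : {set D}).
Hypotheses (sep : separation t r x y z w S) (aS : a \notin S).
Let f := porbit (t * r) x.
Let g := porbit (t * r) y.
Let r' := shrink r x y z w S a.

Let xyzw := separation_curve sep.
Let tS := separation_flip sep.
Let taS : t a \notin S. Proof. by rewrite stable_mem. Qed.

Let face_w : porbit (t * r) w = g.
Proof. by have [_ _ _ wg] := curve_faces xyzw; rewrite (eq_porbit wg). Qed.

Lemma shrink_faces : porbit (t * r') x :|: porbit (t * r') w = (f :|: g) :&: S :|: [set a; t a].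
Proof. by rewrite (add_edge_faces tK (side_attachable sep aS)) (side_outer sep). Qed.

Lemma shrink_face : porbit (t * r') x = t a |: (f :&: S).
Proof.
apply/eqP; rewrite eqEsubset shrink_face_sub //; apply/subsetP => d dx.
have : d \in porbit (t * r') x :|: porbit (t * r') w.
  rewrite shrink_faces !(in_setU, in_setI, in_set1).
  by move: dx; rewrite in_setU1 in_setI => /orP[->|/andP[-> ->]//]; rewrite !orbT.
rewrite in_setU => /orP[//|]; rewrite /r' -(shrink_rev sep aS).
move/(subsetP (shrink_face_sub (separation_rev sep) taS)).
rewrite tK face_w in_setU1 => /predU1P[da|/setIP[dg dS]]; move: dx; rewrite in_setU1 in_setI.
  by rewrite da (negPf aS) andbF orbF eq_sym (negPf (tN a)).
rewrite (disjointFl (curve_faces_disjoint xyzw) dg) orbF => /eqP dta.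
by rewrite dta (negPf taS) in dS.
Qed.

Lemma shrink_face_out d : d \notin (f :|: g) :&: S -> d \notin [set a; t a] ->
  porbit (t * r') d = porbit (t * restr_perm S (curve_cut r x y z w)) d.
Proof.
by move=> dO da; rewrite (add_edge_face_out tK (side_attachable sep aS)) ?side_outer.
Qed.

End ShrinkFaces.

Lemma nonrepeating_face m r d : bounded_map t m r -> nonrepeating t r -> #|porbit (t * r) d| <= m.
Proof.
case=> _ _ deg nr; apply: leq_trans (deg d); rewrite /facial_degree card_in_imset //.
by move=> a b ad bd ab; apply: nr; [rewrite ab porbit_id|rewrite (eq_porbit ad)].
Qed.

Lemma leq_facial_degree r d : facial_degree t r d <= #|porbit (t * r) d|.
Proof. exact: leq_imset_card. Qed.

Lemma nonrepeating_moved r : nonrepeating t r -> stable t (moved r).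
Proof.
move=> nr; apply: homo_stable => d; rewrite !inE; apply: contra => /eqP rtd.
apply/eqP/esym/nr; first exact: mem_porbit1.
have face_td : porbit (t * r) (t d) = porbit (t * r) d by rewrite -{1}rtd -permM porbit1.
by rewrite -face_td -[r d](congr1 r (tK d)) mem_face_succ.
Qed.

Section ShrinkBounded.
Variables (m : nat) (r : {perm D}) (x y z w a : D) (S : {set D}).
Hypotheses (br : bounded_map t m r) (nr : nonrepeating t r).
Hypotheses (sep : separation t r x y z w S) (aS : a \notin S).
Let cut := curve_cut r x y z w.

Let xyzw := separation_curve sep.
Let tS := separation_flip sep.

Lemma curve_cut_loopless : loopless_map t cut.
Proof.
by move=> d; apply: contra (bounded_loopless br d); apply: (subsetP (curve_vertex_sub xyzw d)).
Qed.

Lemma curve_cut_face_out d : d \notin porbit (t * r) x :|: porbit (t * r) y ->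
  facial_degree t cut d <= m.
Proof.
rewrite in_setU negb_or => /andP[dx dy]; apply: leq_trans (leq_facial_degree _ _) _.
by rewrite (curve_face_out xyzw) // nonrepeating_face.
Qed.

Lemma leq_shrink_face : #|porbit (t * shrink r x y z w S a) x| <= m.
Proof.
have [_ zf _ _] := curve_faces xyzw; apply: leq_trans (nonrepeating_face x br nr).
rewrite shrink_face // cardsU1 in_setI [t a \in S]stable_mem // (negPf aS) andbF.
rewrite (cardsD1 z (porbit (t * r) x)) zf leq_add2l; apply/subset_leq_card/subsetP => d.
by rewrite !inE => /andP[-> dS]; rewrite andbT; apply: contraTneq dS => ->; apply: separation_z sep.
Qed.

End ShrinkBounded.

Section ShrinkSmaller.
Variables (m : nat) (r : {perm D}) (x y z w : D) (S : {set D}).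
Hypotheses (br : bounded_map t m r) (nr : nonrepeating t r).
Hypothesis sep : separation t r x y z w S.
Let cut := curve_cut r x y z w.

Let xyzw := separation_curve sep.
Let tS := separation_flip sep.
Let cS := separation_rot sep.

Lemma shrink_bounded a : a \notin S -> bounded_map t m (shrink r x y z w S a).
Proof.
move=> aS; have att := side_attachable sep aS; have [pl ll deg] := br.
have m1 := bounded_map_gt1 x br; have taS : t a \notin S by rewrite stable_mem.
have llS : loopless_map t (restr_perm S cut).
  move=> d; have [dS|dS] := boolP (d \in S).
    by rewrite porbit_restr_perm // (curve_cut_loopless br sep).
  by rewrite porbit_restr_perm_out // in_set1 tN.
split=> [||d].
- by apply: add_edge_planar => //; apply: euler_restr_perm cS (curve_cut_planar xyzw pl).
- exact: add_edge_loopless.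
apply: leq_trans (leq_facial_degree _ _) _.
pose f' := porbit (t * shrink r x y z w S a).
have [|dO] := boolP (d \in f' x :|: f' w).
  rewrite in_setU => /orP[]/eq_porbit->; first exact: leq_shrink_face.
  by rewrite -(shrink_rev sep aS); apply: leq_shrink_face (separation_rev sep) taS.
rewrite shrink_faces // in_setU negb_or in dO; case/andP: dO => dO da.
rewrite shrink_face_out //; have [dS|dS] := boolP (d \in S); last first.
  by rewrite face_restr_perm_out // (leq_trans _ m1) // cards2; case: (_ != _).
rewrite face_restr_perm // (curve_face_out xyzw) ?nonrepeating_face //;
  by apply: contra dO; rewrite in_setI in_setU dS => ->; rewrite ?orbT.
Qed.

Lemma curve_cut_moved : moved cut \subset moved r.
Proof.
have [] := curve_moved xyzw; rewrite !inE => rx ry rz rw.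
apply/subsetP => d; rewrite !inE; apply: contra => /eqP rd.
by rewrite permM rd; case: (swapP xyzw d) => // e; move: rx ry rz rw; rewrite -e rd eqxx.
Qed.

Lemma shrink_moved : [exists d in ~: S, off_faces t r x y d] ->
  #|moved (shrink r x y z w S y)| < #|moved r|.
Proof.
case/exists_inP=> d; rewrite in_setC => dS /and3P[dm dx dy].
have [xm ym zm wm] := curve_moved xyzw; have [xf zf yg wg] := curve_faces xyzw.
have tym : t y \in moved r by rewrite stable_mem ?nonrepeating_moved.
have [xS wS] : x \in S /\ w \in S by case/and5P: sep => _ _ _ -> _; rewrite (separation_w sep).
have sub : moved (shrink r x y z w S y) \subset moved r :&: S :|: [set y; t y].
  apply/subsetP => e; rewrite in_setU; apply: contraLR; rewrite negb_or => /andP[emS ey].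
  have side_e : restr_perm S cut e = e.
    have [eS|eS] := boolP (e \in S); last exact: restr_perm_out.
    rewrite restr_permE // notin_moved //; apply: contra emS => /(subsetP curve_cut_moved).
    by rewrite in_setI eS => ->.
  have neq b : b \in moved r :&: S -> b != e by apply: contraTneq => ->.
  have [nye ntye] : y != e /\ t y != e.
    by move: ey; rewrite in_set2 negb_or ![e == _]eq_sym => /andP[].
  by rewrite inE negbK /shrink /add_edge 2!permM side_e !tpermD // neq // in_setI ?xm ?wm.
have [b [bm bS by_ bty]] : exists b, [/\ b \in moved r, b \notin S, b != y & b != t y].
  have zS := separation_z sep; have [_ _ _ [_ yz _]] := curve_neq xyzw.
  have [dty|dty] := eqVneq d (t y); last first.
    by exists d; split=> //; apply: contraNneq dy => ->; apply: porbit_id.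
  exists z; split; rewrite // 1?eq_sym // -dty; apply: contraNneq dx => ->; exact: zf.
apply/proper_card/(sub_proper_trans sub)/properP; split.
  by rewrite subUset subsetIl /=; apply/subsetP => e /set2P[]->.
by exists b; rewrite // in_setU in_setI in_set2 (negPf bS) (negPf by_) (negPf bty) andbF.
Qed.

Lemma other_side_bounded : #|outer_corners t r x y S| <= m ->
  bounded_map t m (restr_perm (~: S) cut).
Proof.
move=> small; have [pl ll _] := br; apply: bounded_restr_perm; rewrite ?stableC //.
- exact: bounded_map_gt1 x br.
- exact: curve_cut_planar xyzw pl.
- exact: curve_cut_loopless br sep.
move=> d; rewrite in_setC => dS.
have [dO|] := boolP (d \in porbit (t * r) x :|: porbit (t * r) y); last first.
  exact: curve_cut_face_out br nr sep d.
apply: leq_trans (leq_facial_degree _ _) _.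
have dy : d \in porbit (t * cut) y by rewrite (separation_outer_out sep) in_setD dS.
by rewrite (eq_porbit dy) (separation_outer_out sep).
Qed.

Lemma other_side_moved : #|moved (restr_perm (~: S) cut)| < #|moved r|.
Proof.
have [xm _ _ _] := curve_moved xyzw.
apply/proper_card/(sub_proper_trans (moved_restr_perm (stableC cS)))/properP; split.
  by rewrite subIset // curve_cut_moved.
by exists x; rewrite // in_setI in_setC; case/and5P: sep => _ _ _ -> _; rewrite andbF.
Qed.

End ShrinkSmaller.
End Shrink.

(** * Gluing the colorings of the two sides of a curve *)

Section Gluing.
Variables (D : finType) (t : {perm D}).
Hypotheses (tK : involutive t) (tN : forall d, t d != d).
Variables (m k : nat) (r : {perm D}).
Hypotheses (br : bounded_map t m r) (nr : nonrepeating t r).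
Implicit Types (x y z w d : D) (S : {set D}) (c : D -> 'I_k).

Definition inside x S := (porbit (t * r) x :&: S) :\ x.
Definition outside z S := (porbit (t * r) z :\: S) :\ z.

Lemma same_face_eq a b d : a \in porbit (t * r) d -> b \in porbit (t * r) d ->
  b \in porbit r a -> a = b.
Proof. by move=> ad bd ab; apply: nr; rewrite // (eq_porbit ad). Qed.

Section Sides.
Variables (x y z w a : D) (S : {set D}) (c1 c2 : D -> 'I_k).
Hypotheses (sep : separation t r x y z w S) (aS : a \notin S).
Hypothesis p1 : proper_map t (shrink t r x y z w S a) c1.
Hypothesis p2 : proper_in t (curve_cut r x y z w) (~: S) c2.
Let f := porbit (t * r) x.
Let g := porbit (t * r) y.
Let cut := curve_cut r x y z w.

Let xyzw := separation_curve sep.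
Let cS := separation_rot sep.
Let xS := separation_x sep.
Let yS := separation_y sep.
Let wS := separation_w sep.
Let zS := separation_z sep.
Let xf : x \in f. Proof. by case: (curve_faces xyzw). Qed.
Let zf : z \in f. Proof. by case: (curve_faces xyzw). Qed.
Let yg : y \in g. Proof. by case: (curve_faces xyzw). Qed.

Lemma shrink_color_cut d : d \in S -> c1 (cut d) = c1 d.
Proof.
move=> dS; have [cd _] := p1 (in_setT d); rewrite -[RHS]cd /shrink /add_edge 2!permM restr_permE //.
have c1x : c1 a = c1 x := proper_vertex p1 (shrink_vertex_a sep aS).
have c1w : c1 (t a) = c1 w := proper_vertex p1 (shrink_vertex_ta tN sep aS).
have c1_tperm u v e : c1 u = c1 v -> c1 (tperm u v e) = c1 e by case: tpermP => [->|->|].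
by rewrite !c1_tperm.
Qed.

Lemma shrink_color_face : proper_on r c1 (f :&: S).
Proof.
move=> d e /setIP[df dS] /setIP[ef eS] cde; apply: (shrink_vertex tN sep aS) => //.
apply: (proper_face p1) cde; have fx := shrink_face tK tN sep aS.
have dx : d \in porbit (t * shrink t r x y z w S a) x by rewrite fx in_setU1 in_setI df dS orbT.
by rewrite (eq_porbit dx) fx in_setU1 in_setI ef eS orbT.
Qed.

Lemma shrink_color_w d : d \in f -> d \in S -> c1 d != c1 w.
Proof.
move=> df dS; have [_ rwz _ _ _] := and5P xyzw; apply/eqP => cdw.
have wta := shrink_vertex_ta tN sep aS; have fx := shrink_face tK tN sep aS.
have : t a \in porbit (shrink t r x y z w S a) d.
  apply: (proper_face p1); last by rewrite cdw (proper_vertex p1 wta).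
  have dx : d \in porbit (t * shrink t r x y z w S a) x by rewrite fx in_setU1 in_setI df dS orbT.
  by rewrite (eq_porbit dx) fx setU11.
rewrite -eq_porbit_mem (eq_porbit wta) eq_porbit_mem => /(shrink_vertex tN sep aS dS wS) wd.
have zd : z \in porbit r d by rewrite -(eq_porbit wd) porbit_sym.
by move: zS; rewrite -(same_face_eq df zf zd) dS.
Qed.

Lemma other_color_outer : proper_on r c2 ((f :|: g) :\: S).
Proof.
have yS' : y \in ~: S by rewrite in_setC.
have [_ +] := p2 yS'; rewrite (separation_outer_out sep).
by apply: proper_on_sub => d; apply: curve_vertex_sub xyzw d.
Qed.

Let outer_f d : d \in f -> d \notin S -> d \in (f :|: g) :\: S.
Proof. by move=> df dS; rewrite !inE dS df. Qed.

Let outer_y : y \in (f :|: g) :\: S. Proof. by rewrite !inE yS yg orbT. Qed.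

Lemma outsideP d : d \in outside z S -> [/\ d \in f, d \notin S & d != z].
Proof. by rewrite !inE (eq_porbit zf) => /and3P[-> -> ->]. Qed.

Lemma outside_color d : d \in outside z S -> c2 d != c2 y /\ c2 d != c2 z.
Proof.
case/outsideP=> df dS dz; have [ryx _ _ _ _] := and5P xyzw; split.
  apply: contra (dS) => /eqP/(other_color_outer (outer_f df dS) outer_y) yd.
  by rewrite -(same_face_eq xf df) // -(eq_porbit ryx) porbit_sym.
apply: contra dz => /eqP/(other_color_outer (outer_f df dS) (outer_f zf zS)) zd.
by apply/eqP/(same_face_eq df zf).
Qed.

Lemma leq_inside_outside : #|inside x S| + #|outside z S| + 2 <= m.
Proof.
have leq_f : #|f| <= m := nonrepeating_face x br nr.
have cf : #|f :&: S| + #|f :\: S| = #|f| := cardsID S f.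
have c_in : #|f :&: S| = #|inside x S|.+1 by rewrite (cardsD1 x) in_setI xf xS.
have c_out : #|f :\: S| = #|outside z S|.+1.
  by rewrite (cardsD1 z) in_setD zf zS /outside (eq_porbit zf).
by move: leq_f; rewrite -cf c_in c_out; clear; lia.
Qed.

Variable p : {perm 'I_k}.
Hypotheses (py : p (c2 y) = c1 x) (pz : p (c2 z) = c1 w).
Hypothesis disj : [disjoint p @: (c2 @: outside z S) & c1 @: inside x S].

Lemma glued_color_face : proper_on r (glue S c1 (p \o c2)) f.
Proof.
rewrite -(setID f S); apply: proper_onU => [||d e /setIP[df dS] /setDP[ef eS]].
- by apply: eq_proper_on shrink_color_face => d /setIP[_ dS]; rewrite glue_in.
- apply: (eq_proper_on (c := p \o c2)) => [d /setDP[_ dS]|d e]; first by rewrite glue_out.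
  move=> /setDP[df dS] /setDP[ef eS] /perm_inj.
  exact: other_color_outer (outer_f df dS) (outer_f ef eS).
rewrite glue_in // glue_out //= => cde; exfalso; move: cde; apply/eqP.
have [->|ez] := eqVneq e z; first by rewrite pz shrink_color_w.
have eout : e \in outside z S by rewrite !inE ez eS (eq_porbit zf).
have [->|dx] := eqVneq d x.
  by rewrite -py (inj_eq perm_inj) eq_sym; case: (outside_color eout).
have din : c1 d \in c1 @: inside x S by rewrite imset_f // !inE dx df.
by apply: contraTneq din => ->; rewrite (disjointFr disj) // !imset_f.
Qed.

End Sides.

Hypothesis km : k = (3 * m) %/ 2.

Section BothSides.
Variables (x y z w a : D) (S : {set D}) (c1 c2 : D -> 'I_k).
Hypotheses (sep : separation t r x y z w S) (aS : a \notin S).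
Hypothesis p1 : proper_map t (shrink t r x y z w S a) c1.
Hypothesis p2 : proper_in t (curve_cut r x y z w) (~: S) c2.
Hypothesis small : #|outer_corners t r x y S| <= m.
Let f := porbit (t * r) x.
Let g := porbit (t * r) y.
Hypothesis no_common_vertex : forall e e', e \in f -> e \notin S -> e' \in g -> e' \notin S ->
  e' \notin porbit r e.

Let xyzw := separation_curve sep.
Let tS := separation_flip sep.
Let cS := separation_rot sep.
Let xS := separation_x sep.
Let yS := separation_y sep.

Let sep' : separation t r w z y x S. Proof. exact: separation_rev. Qed.
Let taS : t a \notin S. Proof. by rewrite stable_mem. Qed.
Let p1' : proper_map t (shrink t r w z y x S (t a)) c1. Proof. by rewrite (shrink_rev tK tN). Qed.
Let p2' : proper_in t (curve_cut r w z y x) (~: S) c2.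
Proof. by rewrite /curve_cut (swap_rev xyzw). Qed.
Let face_w : porbit (t * r) w = g.
Proof. by have [_ _ _ wg] := curve_faces xyzw; rewrite (eq_porbit wg). Qed.

Lemma leq_outside_outside : #|outside z S| + #|outside y S| + 2 <= m.
Proof.
have [xf zf yg wg] := curve_faces xyzw; apply: leq_trans small.
have c_f : #|f :\: S| = #|outside z S|.+1.
  by rewrite (cardsD1 z) in_setD zf (separation_z sep) /outside (eq_porbit zf).
have c_g : #|g :\: S| = #|outside y S|.+1 by rewrite (cardsD1 y) in_setD yg yS.
have dfg : [disjoint f :\: S & g :\: S].
  by apply: disjointW (curve_faces_disjoint xyzw); apply: subsetDl.
rewrite /outer_corners setDUl cardsU disjoint_setI0 // cards0 subn0 -/f -/g c_f c_g.
by rewrite addn2 addSn addnS.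
Qed.

Lemma ex_recoloring : exists p : {perm 'I_k}, [/\ p (c2 y) = c1 x, p (c2 z) = c1 w,
  [disjoint p @: (c2 @: outside z S) & c1 @: inside x S]
  & [disjoint p @: (c2 @: outside y S) & c1 @: inside w S]].
Proof.
have leq_f := leq_inside_outside sep; have leq_g := leq_inside_outside sep'.
have leq_o := leq_outside_outside.
have leq_inI : #|c1 @: inside x S :&: c1 @: inside w S| <= minn #|inside x S| #|inside w S|.
  rewrite leq_min; apply/andP; split; apply: leq_trans (leq_imset_card c1 _).
    exact/subset_leq_card/subsetIl.
  exact/subset_leq_card/subsetIr.
have leq_im (c : D -> 'I_k) A : #|c @: A| <= #|A| := leq_imset_card c A.
have [zf yg] : z \in f /\ y \in g by have [_ ? ? _] := curve_faces xyzw.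
have outer d : d \notin S -> d \in f \/ d \in g -> d \in (f :|: g) :\: S.
  by rewrite in_setD in_setU => -> /orP.
have [p [[py pz] disj disj']] : exists p : {perm 'I_k}, [/\
    map p [:: c2 y; c2 z] = [:: c1 x; c1 w],
    [disjoint p @: (c2 @: outside z S) & c1 @: inside x S]
    & [disjoint p @: (c2 @: outside y S) & c1 @: inside w S]]; last by exists p.
have zS := separation_z sep; have [ryx _ rzx _ _] := and5P xyzw.
apply: ex_perm_map_avoiding; rewrite ?card_ord //=.
- rewrite inE andbT; apply: contra rzx => /eqP/(other_color_outer sep p2) yz.
  by rewrite -(eq_porbit ryx) yz //; apply: outer; auto.
- by rewrite inE andbT (shrink_color_w sep aS p1) // porbit_id.
- rewrite !disjoint_cons disjoint0 andbT !in_setU !negb_or.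
  apply/andP; split; apply/andP; split; apply/imsetP => -[d dout e].
  + by have [/eqP[]] := outside_color sep p2 dout.
  + by have [_ /eqP[]] := outside_color sep' p2' dout.
  + by have [_ /eqP[]] := outside_color sep p2 dout.
  + by have [/eqP[]] := outside_color sep' p2' dout.
- apply/pred0P => c; apply/negP => /andP[/imsetP[d dout ->] /imsetP[e eout]].
  have [df dS _] := outsideP sep dout; have [eg eS _] := outsideP sep' eout.
  rewrite face_w in eg; move/(other_color_outer sep p2) => de.
  by case/negP: (no_common_vertex df dS eg eS); apply: de; apply: outer; auto.
- apply: leq_trans (leq_add (leq_add (leq_im _ _) (leq_im _ _)) (leqnn 2)) _.
  by move: leq_f km; clear; lia.
- apply: leq_trans (leq_add (leq_add (leq_im _ _) (leq_im _ _)) (leqnn 2)) _.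
  by move: leq_g km; clear; lia.
- apply: leq_trans (leq_add (leq_add (leq_add (leq_im _ _) (leq_im _ _)) leq_inI) (leqnn 2)) _.
  by move: leq_f leq_g leq_o km; clear; lia.
Qed.

Lemma glued_color_swap c d : c x = c y -> c z = c w -> c (swap x y z w d) = c d.
Proof. by move=> cxy czw; case: (swapP xyzw d) => // ->. Qed.

Lemma colorable_glued : colorable t k r.
Proof.
have [p [py pz disj disj']] := ex_recoloring.
have [zS wS] := (separation_z sep, separation_w sep).
pose c := glue S c1 (p \o c2); exists c => d _.
have c_swap e : c (swap x y z w e) = c e.
  by apply: glued_color_swap; rewrite /c ?(glue_in _ _ xS) ?(glue_in _ _ wS)
    ?(glue_out _ _ yS) ?(glue_out _ _ zS) /= ?py ?pz.
split.
  rewrite -[LHS]c_swap -permM -/(curve_cut r x y z w) /c /glue stable_mem //.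
  case: ifPn => dS; first by rewrite (shrink_color_cut sep aS p1).
  by have /p2[/= ->] : d \in ~: S by rewrite in_setC.
have [/eq_porbit->|df] := boolP (d \in f).
  exact: (glued_color_face sep aS p1 p2 py pz disj).
have [/eq_porbit->|dg] := boolP (d \in g).
  by rewrite -[porbit _ y]face_w; apply: (glued_color_face sep' taS p1' p2' pz py disj').
have inS e : e \in porbit (t * r) d -> (e \in S) = (d \in S).
  by rewrite -(curve_face_out xyzw df dg); apply: porbit_mem_stable; rewrite groupM.
have [dS|dS] := boolP (d \in S).
  apply: (eq_proper_on (c := c1)) => [e /inS eS|]; first by rewrite /c glue_in ?eS.
  have dO : d \notin (f :|: g) :&: S by rewrite in_setI in_setU (negPf df) (negPf dg).
  move=> e e' ed e'd cee'; apply: (shrink_vertex tN sep aS); rewrite ?inS //.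
  have := p1 (in_setT d); rewrite (shrink_face_out tK sep aS dO) ?(notin_ends sep aS) //.
  by rewrite face_restr_perm // (curve_face_out xyzw df dg) => -[_]; apply.
apply: (eq_proper_on (c := p \o c2)) => [e /inS eS|]; first by rewrite /c glue_out ?eS.
move=> e e' ed e'd /perm_inj cee'; apply: (subsetP (curve_vertex_sub xyzw e)).
have /p2[_] : d \in ~: S by rewrite in_setC.
by rewrite (curve_face_out xyzw df dg); apply.
Qed.

End BothSides.

Lemma leq_outer_corners_sym x y S : m < #|outer_corners t r x y S| ->
  #|outer_corners t r y x (~: S)| < #|outer_corners t r x y S|.
Proof.
have leq_x := nonrepeating_face x br nr; have leq_y := nonrepeating_face y br nr.
have [leq_U _] := leq_card_setU (porbit (t * r) x) (porbit (t * r) y).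
have -> : outer_corners t r y x (~: S) = (porbit (t * r) x :|: porbit (t * r) y) :&: S.
  by rewrite /outer_corners setUC setDE setCK.
rewrite /outer_corners; move: (cardsID S (porbit (t * r) x :|: porbit (t * r) y)) leq_x leq_y leq_U.
by clear; lia.
Qed.

Lemma colorable_reducing x y z w S : smaller_colorable t m k r ->
  reducing t r x y z w S -> colorable t k r.
Proof.
move=> IH; have [n] := ubnP #|outer_corners t r x y S|.
elim: n x y z w S => // n IHn x y z w S; rewrite ltnS => leq_n red.
have [big|small] := ltnP m #|outer_corners t r x y S|.
  by apply: IHn (reducing_sym red); apply: leq_trans (leq_outer_corners_sym big) leq_n.
have [sep offS offC] := and3P red; have [xyzw tS cS xS yS] := and5P sep.
have [/exists_inP[e /setDP[ef eS] /exists_inP[e' /setDP[e'g e'S] ee']]|no_common] := boolP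
  [exists e in porbit (t * r) x :\: S, exists e' in porbit (t * r) y :\: S, e' \in porbit r e].
  have [|x' [y' [z' [w' [S' [red' lt]]]]]] := reducing_smaller tK tN nr _ red ef eS e'g e'S ee'.
    exact: bounded_planar br.
  by apply: IHn red'; apply: leq_trans lt leq_n.
have [c1 p1] := IH _ (shrink_bounded tK tN br nr sep yS) (shrink_moved tK nr sep offC).
have [c2 p2] := IH _ (other_side_bounded tK tN br nr sep small) (other_side_moved sep).
apply: (colorable_glued sep yS p1 (proper_in_restr_perm (stableC tS) (stableC cS) p2) small).
move=> e e' ef eS e'g e'S; apply: contra no_common => ee'.
by apply/exists_inP; exists e; rewrite ?inE ?eS //; apply/exists_inP; exists e'; rewrite ?inE ?e'S.
Qed.

End Gluing.

(** * Irreducible maps *)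

Section Irreducible.
Variables (D : finType) (t : {perm D}).
Hypotheses (tK : involutive t) (tN : forall d, t d != d).
Implicit Types (r : {perm D}) (x y z w d e : D) (S : {set D}).

Definition linked r := {in moved r &, forall d e, e \in component t r d}.

Record irreducible r : Prop := Irreducible {
  irreducible_planar : planar t r;
  irreducible_loopless : loopless_map t r;
  irreducible_nonrepeating : nonrepeating t r;
  irreducible_linked : linked r;
  irreducible_not_reducing : forall x y z w S, ~~ reducing t r x y z w S;
  irreducible_faces : 3 < #|porbit (t * r) @: moved r|
}.

Lemma face_moved r : nonrepeating t r -> stable (t * r) (moved r).
Proof. by move=> nr; rewrite groupM ?stable_moved ?nonrepeating_moved. Qed.

Lemma face_notin_moved r d : nonrepeating t r -> d \notin moved r ->
  porbit (t * r) d = [set d; t d].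
Proof.
move=> nr dm; have tm := nonrepeating_moved tK nr.
have td : (t * r) d = t d by rewrite permM notin_moved // stable_mem.
by rewrite porbit_invol td // permM tK notin_moved.
Qed.

Section Coloring.
Variable k : nat.

Lemma colorable_moved r (c : D -> 'I_k) : nonrepeating t r -> 1 < k ->
  proper_in t r (moved r) c -> colorable t k r.
Proof.
move=> nr k_gt1 pc; have tm := nonrepeating_moved tK nr.
pose color0 := Ordinal (ltnW k_gt1); pose color1 := Ordinal k_gt1.
pose c' d := if enum_rank d < enum_rank (t d) then color0 else color1.
exists (glue (moved r) c c'); apply: proper_glue; rewrite ?stable_moved // => d.
rewrite in_setC => dm; rewrite (notin_moved dm) face_notin_moved //; split=> // e e'.
have c't b : c' b <> c' (t b).
  by rewrite /c' tK; case: ltngtP => [_ /(congr1 val)|_ /(congr1 val)|/val_inj/enum_rank_inj/eqP];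
    rewrite // eq_sym (negPf (tN b)).
by move=> /set2P[]-> /set2P[]->; rewrite ?porbit_id // => e_c; case: (c't d).
Qed.

Lemma colorable_few_vertices r : nonrepeating t r -> 1 < k ->
  #|porbit r @: moved r| <= k -> colorable t k r.
Proof.
move=> nr k_gt1 leVk; pose V := porbit r @: moved r.
pose index_of d := index (porbit r d) (enum V).
have index_lt d : d \in moved r -> index_of d < k.
  by move=> dm; apply: leq_trans leVk; rewrite cardE index_mem mem_enum imset_f.
apply: (@colorable_moved r (fun d => Ordinal (ltn_pmod (index_of d) (ltnW k_gt1)))) => // d dm.
split=> [|e e' ed e'd /(congr1 val) /=]; first by apply: val_inj; rewrite /= /index_of porbit1.
have [em e'm] : e \in moved r /\ e' \in moved r.
  by rewrite !(porbit_mem_stable (face_moved nr) (x := d)).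
rewrite !modn_small ?index_lt // => eq_index; have : porbit r e = porbit r e'.
  have nthE a : a \in moved r -> nth set0 (enum V) (index_of a) = porbit r a.
    by move=> am; rewrite nth_index // mem_enum imset_f.
  by rewrite -(nthE e) // eq_index nthE.
by move=> ->; apply: porbit_id.
Qed.

Lemma leq_card_vertices m r : bounded_map t m r -> nonrepeating t r ->
  #|porbit r @: moved r| * 2 <= #|porbit (t * r) @: moved r| * m.
Proof.
move=> br nr; apply: (@leq_trans #|moved r|).
  rewrite (card_partition (porbit_partition (stable_moved r))) -sum_nat_const.
  apply: leq_sum => _ /imsetP[d dm ->].
  have -> : 2 = #|[set d; r d]| by rewrite cards2 eq_sym; move: dm; rewrite inE => ->.
  by rewrite subset_leq_card // subUset !sub1set porbit_id mem_porbit1.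
rewrite (card_partition (porbit_partition (face_moved nr))) -sum_nat_const.
by apply: leq_sum => _ /imsetP[d dm ->]; apply: nonrepeating_face.
Qed.

Lemma colorable_few_faces m r : k = (3 * m) %/ 2 -> bounded_map t m r -> nonrepeating t r ->
  1 < k -> #|porbit (t * r) @: moved r| <= 3 -> colorable t k r.
Proof.
move=> km br nr k_gt1 few; apply: colorable_few_vertices => //.
have := leq_card_vertices br nr; have : #|porbit (t * r) @: moved r| * m <= 3 * m.
  by rewrite leq_mul2r few orbT.
by move: km; clear; lia.
Qed.

Lemma colorable_bounded m : k = (3 * m) %/ 2 ->
  (forall r, bounded_map t m r -> irreducible r -> colorable t k r) ->
  forall r, bounded_map t m r -> colorable t k r.
Proof.
move=> km base r; have mk : m <= k by rewrite km; clear; lia.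
have [n] := ubnP #|moved r|; elim: n r => // n IHn r; rewrite ltnS => moved_le br.
have [D0|/card_gt0P[d0 _]] := posnP #|D|.
  have no d : False by have /card0_eq/(_ d) := D0.
  by exists (fun d => False_rect _ (no d)) => d; case: (no d).
have k_gt1 : 1 < k := leq_trans (bounded_map_gt1 d0 br) mk.
have IH : smaller_colorable t m k r.
  by move=> r' br' lt; apply: IHn => //; apply: leq_trans moved_le.
have [/exists_inP[d dm /exists_inP[e em]]|all_linked] := boolP
  [exists d in moved r, exists e in moved r, e \notin component t r d].
  exact: (colorable_disconnected tK tN br IH dm em).
have [/existsP[x /existsP[y /and3P[xy ryx fyx]]]|no_repetition] := boolP
  [exists x, exists y, [&& x != y, y \in porbit r x & y \in porbit (t * r) x]].
  exact: (colorable_cut_vertex tK tN mk br IH xy ryx fyx).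
have nr : nonrepeating t r.
  move=> x y ryx fyx; apply/eqP; apply: contraNT no_repetition => xy.
  by apply/existsP; exists x; apply/existsP; exists y; apply/and3P.
have [/existsP[x /existsP[y /existsP[z /existsP[w /existsP[S red]]]]]|no_reducing] := boolP
  [exists x, exists y, exists z, exists w, exists S, reducing t r x y z w S].
  exact: (colorable_reducing tK tN br nr km IH red).
have [few|many] := leqP #|porbit (t * r) @: moved r| 3.
  exact: (colorable_few_faces km br nr k_gt1 few).
apply: base => //; case: (br) => pl ll _; split=> // [d e dm em|x y z w S].
  apply: contraNT all_linked => de; apply/exists_inP; exists d => //.
  by apply/exists_inP; exists e.
apply: contra no_reducing => red; apply/existsP; exists x; apply/existsP; exists y.
by apply/existsP; exists z; apply/existsP; exists w; apply/existsP; exists S.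
Qed.

End Coloring.

Section IrreducibleMap.
Variable r : {perm D}.
Hypothesis irr : irreducible r.

Let pl := irreducible_planar irr.
Let ll := irreducible_loopless irr.
Let nr := irreducible_nonrepeating irr.
Let all_linked := irreducible_linked irr.
Let tm : stable t (moved r) := nonrepeating_moved tK nr.
Let rm : stable r (moved r) := stable_moved r.

Lemma linked_stable S d : stable t S -> stable r S -> d \in S -> d \in moved r ->
  moved r \subset S.
Proof.
move=> tS rS dS dm; apply/subsetP => e em.
exact: (subsetP (component_sub_stable tS rS dS)) (all_linked dm em).
Qed.

Lemma mem_moved_porbit d e : e \in porbit r d -> (e \in moved r) = (d \in moved r).
Proof. exact: porbit_mem_stable. Qed.

(* If there are only two vertices, then every face has a corner at each of them. *)
Lemma two_vertices_degree x : x \in moved r ->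
  stable t (porbit r x :|: porbit r (t x)) -> 3 < #|porbit r x|.
Proof.
move=> xm tQ; apply: leq_trans (irreducible_faces irr) _.
apply: leq_trans (leq_imset_card (porbit (t * r)) _).
apply/subset_leq_card/subsetP => _ /imsetP[d dm ->].
have rQ : stable r (porbit r x :|: porbit r (t x)) by apply: stableU; apply: stable_porbit.
have xQ : x \in porbit r x :|: porbit r (t x) by rewrite in_setU porbit_id.
have := subsetP (linked_stable tQ rQ xQ xm) _ dm; rewrite in_setU => /orP[dx|dtx].
  exact: imset_f.
have tdx : t d \in porbit r x.
  have : t d \in porbit r x :|: porbit r (t x) by rewrite stable_mem // in_setU dtx orbT.
  by rewrite in_setU -(eq_porbit dtx) (negPf (ll d)) orbF.
by rewrite -porbit1 imset_f // permM -eq_porbit_mem porbit1 eq_porbit_mem.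
Qed.

Hypothesis deg3 : {in moved r, forall d, r (r d) != d}.

(* Three darts of one vertex cannot all lie on two nonrepeating faces. *)
Lemma ex_off_faces x y d : d \in moved r -> exists2 e, e \in porbit r d & off_faces t r x y e.
Proof.
move=> dm; apply/exists_inP; apply: contraT => /exists_inPn none.
have on_face e : e \in porbit r d -> (e \in porbit (t * r) x) || (e \in porbit (t * r) y).
  by move=> ed; have := none e ed; rewrite /off_faces (mem_moved_porbit ed) dm /= negb_and !negbK.
have [rd rrd] : r d \in porbit r d /\ r (r d) \in porbit r d.
  by rewrite -!eq_porbit_mem !porbit1.
have neq_d : d != r d by move: dm; rewrite inE eq_sym.
have same u v w : u \in porbit r d -> v \in porbit r d -> u \in porbit (t * r) w ->
    v \in porbit (t * r) w -> u = v.
  by move=> ud vd uw vw; apply: (same_face_eq nr uw vw); rewrite (eq_porbit ud).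
have [d_rd rd_rrd d_rrd] : [/\ d <> r d, r d <> r (r d) & d <> r (r d)].
  by split; apply/eqP; rewrite // ?(inj_eq perm_inj) // eq_sym deg3.
have dd := porbit_id r d.
case/orP: (on_face _ dd) => fd; case/orP: (on_face _ rd) => frd; case/orP: (on_face _ rrd) => frrd;
  by [case: (d_rd (same _ _ _ dd rd fd frd)) | case: (rd_rrd (same _ _ _ rd rrd frd frrd))
     | case: (d_rrd (same _ _ _ dd rrd fd frrd))].
Qed.

Section TrivialSide.
Variables (x y z w : D) (S : {set D}).
Hypothesis sep : separation t r x y z w S.
Hypothesis on_faces : {in S, forall d, ~~ off_faces t r x y d}.

Let xyzw := separation_curve sep.
Let tS := separation_flip sep.
Let cS := separation_rot sep.
Let xS := separation_x sep.
Let xm : x \in moved r. Proof. by case: (curve_moved xyzw). Qed.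

Let on_face d : d \in S -> d \in moved r -> d \in porbit (t * r) x \/ d \in porbit (t * r) y.
Proof.
move=> dS dm; have := on_faces dS; rewrite /off_faces dm /= negb_and !negbK.
by case/orP; [left|right].
Qed.

Lemma trivial_side_flip : t x = w.
Proof.
have [_ zf yg wg] := curve_faces xyzw; have [_ rwz _ _ _] := and5P xyzw.
have txm : t x \in moved r by rewrite stable_mem.
have tz : t x \in porbit r z.
  have [e e_tx] := ex_off_faces x y txm; apply: contraLR => tz; apply: on_faces.
  by rewrite (porbit_mem_stable cS (x := t x)) ?stable_mem // (curve_vertex_out xyzw).
have [txf|txg] := on_face (etrans (stable_mem _ tS) xS) txm.
  have zS := separation_z sep; rewrite (same_face_eq nr zf txf tz) in zS.
  by rewrite stable_mem ?xS in zS.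
by apply: (same_face_eq nr txg wg); rewrite (eq_porbit tz).
Qed.

Lemma trivial_side_rot : r x = y.
Proof.
have [xf _ yg _] := curve_faces xyzw; have [ryx _ _ _ _] := and5P xyzw.
have [_ sy _ _] := swapE xyzw; pose c := curve_cut r x y z w.
have cx : c x \in porbit r x := subsetP (curve_vertex_sub xyzw x) _ (mem_porbit1 c x).
have cxS : c x \in S by rewrite (stable_mem _ cS).
suff cxx : c x = x by apply: (@perm_inj _ (swap x y z w)); rewrite sy -permM.
have [cxf|cxg] := on_face cxS (etrans (mem_moved_porbit cx) xm).
  by apply/esym/(same_face_eq nr xf cxf).
have ycx : y = c x by apply: (same_face_eq nr yg cxg); rewrite (eq_porbit ryx).
by case/and5P: sep => _ _ _ _; rewrite ycx cxS.
Qed.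

End TrivialSide.

Lemma irreducible_curve x y z w : curve t r x y z w ->
  (r x = y /\ t x = w) \/ (r y = x /\ t y = z).
Proof.
move=> xyzw; have [S sep] := ex_separation tK tN pl xyzw.
have := irreducible_not_reducing irr x y z w S; rewrite /reducing sep /= negb_and.
case/orP=> /exists_inPn none; [left|right].
  by rewrite (trivial_side_rot sep) ?(trivial_side_flip sep).
have none' : {in ~: S, forall d, ~~ off_faces t r y x d}.
  by move=> d /none; rewrite off_faces_sym.
by rewrite (trivial_side_rot (separation_sym sep)) ?(trivial_side_flip (separation_sym sep)).
Qed.

Definition parallel x e := (e \in porbit r x) && (t e \in porbit r (t x)).

Lemma parallel_sym x e : parallel x e -> parallel e x.
Proof. by rewrite /parallel porbit_sym [t e \in _]porbit_sym. Qed.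

Lemma parallel_trans x e u : parallel x e -> parallel e u -> parallel x u.
Proof. by case/andP=> ex tex; rewrite /parallel (eq_porbit ex) (eq_porbit tex). Qed.

Lemma parallel_digon x e : e != x -> parallel x e ->
  (r x = e /\ t x = r (t e)) \/ (r e = x /\ t e = r (t x)).
Proof.
move=> ex /andP[rex rte]; apply: irreducible_curve.
rewrite /curve rex !mem_face_succ -!eq_porbit_mem !porbit1 !eq_porbit_mem rte ll /=.
by apply: contra ex => fex; rewrite eq_sym; apply/eqP/nr.
Qed.

Lemma parallel_next x : x \in moved r -> parallel x (r x) -> t x = r (t (r x)).
Proof.
move=> xm par; have xr : r x != x by move: xm; rewrite inE.
case: (parallel_digon xr par) => -[] // rrx; have := deg3 xm.
by rewrite rrx eqxx.
Qed.

Lemma parallel_third x : x \in moved r -> parallel x (r x) ->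
  r (r (r x)) = x /\ t (r (r x)) = r (t x).
Proof.
move=> xm /andP[rex rte]; set e := r x in rex rte *.
have em : e \in moved r by rewrite stable_mem.
have : curve t r x (r e) (r (t x)) (t e).
  have face_re : t e \in porbit (t * r) (r e) by rewrite porbit_sym -{1}(tK e) mem_face_succ.
  have re_x : r e \in porbit r x by rewrite stable_mem ?stable_porbit.
  have rtx : r (t x) \notin porbit r x by rewrite stable_mem ?stable_porbit.
  rewrite /curve re_x porbit1 rte rtx mem_face_succ face_re /=.
  by apply: contra (deg3 xm) => fx; apply/eqP/esym/nr.
by case/irreducible_curve => // -[ee _]; move: em; rewrite inE -/e -ee eqxx.
Qed.

Lemma parallel_next_false x : x \in moved r -> ~~ parallel x (r x).
Proof.
move=> xm; apply/negP => par; have [rx3 trrx] := parallel_third xm par.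
have rxm : r x \in moved r by rewrite stable_mem.
have trx := parallel_next xm par.
have par2 : parallel (r x) (r (r x)).
  apply: parallel_trans (parallel_sym par) _; rewrite /parallel trrx mem_porbit1.
  by rewrite stable_mem ?mem_porbit1 ?stable_porbit.
have trrx' := parallel_next rxm par2.
have sub_x := porbit_order3_sub rx3.
have sub_tx : porbit r (t x) \subset [set t x; t (r (r x)); t (r x)].
  by have := @porbit_order3_sub _ r (t x); rewrite -trrx -trrx' -trx; apply.
have : 3 < #|porbit r x|; last first.
  apply/negP; rewrite -leqNgt; apply: leq_trans (subset_leq_card sub_x) _.
  by rewrite setUC cardsU1 cards2; case: (_ \notin _); case: (_ != _).
apply: two_vertices_degree => //; apply: homo_stable => d; rewrite !in_setU => /orP[dx|dtx].
  apply/orP; right; have := subsetP sub_x _ dx; rewrite !inE -!orbA => /or3P[]/eqP->.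
  - exact: porbit_id.
  - by case/andP: par.
  - by rewrite trrx mem_porbit1.
apply/orP; left; have := subsetP sub_tx _ dtx; rewrite !inE -!orbA => /or3P[]/eqP->; rewrite tK.
- exact: porbit_id.
- by rewrite stable_mem ?mem_porbit1 ?stable_porbit.
- exact: mem_porbit1.
Qed.

Lemma parallel_eq x e : x \in moved r -> parallel x e -> e = x.
Proof.
move=> xm par; apply/eqP; apply: contraT => ex.
case: (parallel_digon ex par) => -[rxe _].
  by move: par; rewrite -rxe (negPf (parallel_next_false xm)).
have em : e \in moved r by case/andP: par => /mem_moved_porbit->.
by move: (parallel_sym par); rewrite -rxe (negPf (parallel_next_false em)).
Qed.

(* [X] is the set of darts of a union of components of the graph minus the vertices
   of [K], and there are at most two of the latter. *)
Record vertex_cut (X K : {set D}) : Prop := VertexCut {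
  vertex_cut_rot : stable r X;
  vertex_cut_sub : X \subset moved r :\: K;
  vertex_cut_flip : {in X, forall d, t d \in X :|: K};
  cutset_rot : stable r K;
  cutset_moved : K \subset moved r;
  cutset_two_vertices : {in K & &, forall a b c,
    b \notin porbit r a -> c \notin porbit r a -> c \in porbit r b}
}.

Definition edges_of (X : {set D}) := [set d | (d \in X) || (t d \in X)].

Lemma edges_of_flip (X : {set D}) : stable t (edges_of X).
Proof. by apply: homo_stable => d; rewrite !inE tK orbC. Qed.

Section VertexCut.
Variables X K : {set D}.
Hypothesis XK : vertex_cut X K.
Let E := edges_of X.

Let rX := vertex_cut_rot XK.
Let X_sub := vertex_cut_sub XK.
Let tX := vertex_cut_flip XK.
Let rK := cutset_rot XK.
Let K2 := cutset_two_vertices XK.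

Let X_notin_K d : d \in X -> d \notin K.
Proof. by move/(subsetP X_sub); rewrite in_setD => /andP[]. Qed.

Let E_outside d : d \notin X -> d \notin K -> d \notin E.
Proof.
move=> dX dK; rewrite inE negb_or dX; apply/negP => /tX.
by rewrite tK in_setU (negPf dX) (negPf dK).
Qed.

Lemma edges_switch d : (d \in E) != (r d \in E) -> d \in K.
Proof.
apply: contraR => dK; have [dX|dX] := boolP (d \in X).
  by have rdX := stable_mem d rX; rewrite !inE rdX dX.
by rewrite (negPf (E_outside dX dK)) (negPf (E_outside _ _)) // stable_mem.
Qed.

(* Walking along the face of the corner [u], which is at the border of [F], one leaves
   [F] at the other vertex of the cut. *)
Lemma face_exit (F : {set D}) u : stable t F ->
  (forall d, (d \in F) != (r d \in F) -> d \in K) -> u \in K -> u \in F -> r^-1 u \notin F ->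
  exists z, [/\ z \in K, z \in porbit (t * r) u, z \notin porbit r u & z \notin F].
Proof.
move=> tF switchF uK uF ruF.
have [||a [au aF zF]] := @porbit_exit _ (t * r) F u (t (r^-1 u)) uF.
- by rewrite porbit_sym -{1}(permKV r u) -{1}(tK (r^-1 u)) mem_face_succ.
- by rewrite stable_mem.
have zu : (t * r) a \in porbit (t * r) u by rewrite stable_mem ?stable_porbit.
exists ((t * r) a); split=> //; last by apply: contra zF => zr; rewrite -(nr zr zu).
rewrite permM stable_mem //; apply: switchF.
by rewrite -permM (negPf zF) stable_mem // aF.
Qed.

Hypotheses (X_neq0 : X != set0) (out_neq0 : ~~ (moved r \subset X :|: K)).

Lemma ex_edges_exit : exists a, [/\ a \in K, a \in E & r a \notin E].
Proof.
have [d dX] := set0Pn _ X_neq0; have [e em eXK] := subsetPn out_neq0.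
have dE : d \in E by rewrite inE dX.
have dm : d \in moved r by have := subsetP X_sub _ dX; rewrite in_setD => /andP[].
have eE : e \notin E by move: eXK; rewrite in_setU negb_or => /andP[]; apply: E_outside.
suff /exists_inP[a aE raE] : [exists a in E, r a \notin E].
  by exists a; rewrite (@edges_switch a) ?aE ?(negPf raE).
apply: contraNT eE => /exists_inPn stays; apply: (subsetP (linked_stable _ _ dE dm) e em).
  exact: edges_of_flip.
by apply: homo_stable => a aE; have := stays a aE; rewrite negbK.
Qed.

Lemma cut_edge : exists y, [/\ y \in K, t y \in K, r y \in E & r (t y) \in E].
Proof.
have [a [aK aE raE]] := ex_edges_exit.
have [|||b [ba bE]] := @porbit_exit _ r (~: E) (r a) a.
- by rewrite in_setC.
- by rewrite porbit1 porbit_id.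
- by rewrite in_setC negbK.
rewrite porbit1 in ba; rewrite in_setC in bE; rewrite in_setC negbK => rbE.
pose x := r b; pose y := r a.
have ryx : y \in porbit r x by rewrite -eq_porbit_mem !porbit1 eq_porbit_mem porbit_sym.
have [xK yK] : x \in K /\ y \in K by rewrite !stable_mem // (porbit_mem_stable rK ba).
have tE : stable t E := edges_of_flip X.
have [|z [zK fzx rzx zE]] := face_exit tE edges_switch xK rbE; first by rewrite permK.
have [|||w [wK fwy rwy wE]] := @face_exit (~: E) y (stableC tE) _ yK.
- by move=> d; rewrite !in_setC (inj_eq negb_inj); apply: edges_switch.
- by rewrite in_setC.
- by rewrite in_setC permK negbK.
rewrite in_setC negbK in wE.
have rwz : w \in porbit r z by apply: K2 (xK) zK wK rzx _; rewrite -(eq_porbit ryx).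
have fyx : y \notin porbit (t * r) x by apply: contra raE => fyx; rewrite -/y -(nr ryx fyx).
have xyzw : curve t r x y z w by rewrite /curve ryx rwz rzx fzx fwy.
case: (irreducible_curve xyzw) => [[_ txw]|[ryx' tyz]].
  have : x \in E := rbE; rewrite inE txw => /orP[]/X_notin_K; rewrite ?xK ?wK //.
exists y; split; rewrite ?ryx' ?tyz //.
suff -> : r z = w by [].
apply: (same_face_eq nr _ fwy); first by rewrite -tyz mem_face_succ.
by rewrite porbit1.
Qed.

End VertexCut.

Lemma vertex_cut_compl (X K : {set D}) : vertex_cut X K -> vertex_cut (moved r :\: (X :|: K)) K.
Proof.
case=> rX X_sub tX rK Km K2; split=> // [||d].
- by rewrite stableD ?stableU.
- by rewrite setDUr subsetIr.
rewrite !in_setU !in_setD !in_setU negb_or => /andP[/andP[dX dK] dm].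
have [//|tdK] := boolP (t d \in K); rewrite ?orbT // !orbF (stable_mem _ tm) dm andbT.
by apply/negP => /tX; rewrite tK in_setU (negPf dX) (negPf dK).
Qed.

Lemma edges_of_disjoint (X K : {set D}) : vertex_cut X K ->
  [disjoint edges_of X & edges_of (moved r :\: (X :|: K))].
Proof.
case=> _ _ tX _ _ _; set Y := moved r :\: (X :|: K).
have XY b : b \in X -> b \notin Y by rewrite in_setD in_setU => ->.
have XtY b : b \in X -> t b \notin Y by move/tX; rewrite in_setD => ->.
apply/pred0P => a /=; rewrite [a \in edges_of X]in_set [a \in edges_of _]in_set.
apply/negP => /andP[/orP[] aX].
  by rewrite (negPf (XY _ aX)) (negPf (XtY _ aX)).
by have := XtY _ aX; rewrite tK (negPf (XY _ aX)) orbF => /negPf->.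
Qed.

Lemma cut_edge_unique (X K : {set D}) y y' : vertex_cut X K ->
  y \in K -> t y \in K -> y' \in K -> t y' \in K -> y' = y \/ y' = t y.
Proof.
case=> _ _ _ _ /subsetP Km K2 yK tyK y'K ty'K.
have [yy'|nyy'] := boolP (y' \in porbit r y); [left|right]; apply: parallel_eq (Km _ _) _ => //.
  by rewrite /parallel yy' (K2 y) // -(eq_porbit yy').
have y'ty : y' \in porbit r (t y) by apply: (K2 y).
by rewrite /parallel y'ty tK (K2 (t y)) // -?(eq_porbit y'ty) // porbit_sym.
Qed.

(* Otherwise the only edge joining the two vertices of [K] would follow an edge of
   [X] and an edge of the complementary side. *)
Lemma vertex_cut_total (X K : {set D}) : vertex_cut X K -> X != set0 -> moved r \subset X :|: K.
Proof.
move=> XK X_neq0; apply: contraT => out_neq0; have XK' := vertex_cut_compl XK.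
set Y := moved r :\: _ in XK'; have Y_neq0 : Y != set0 by rewrite setD_eq0.
have out'_neq0 : ~~ (moved r \subset Y :|: K).
  have [d dX] := set0Pn _ X_neq0; apply/subsetPn; exists d; case: XK => _ /subsetP/(_ d dX).
    by rewrite in_setD => /andP[].
  by rewrite !inE dX => /andP[/negPf-> _].
have [y [yK tyK ryX rtyX]] := cut_edge XK X_neq0 out_neq0.
have [y' [y'K ty'K ry'Y _]] := cut_edge XK' Y_neq0 out'_neq0.
have ry'X : r y' \notin edges_of X by rewrite (disjointFl (edges_of_disjoint XK) ry'Y).
by move: ry'X; case: (cut_edge_unique XK yK tyK y'K ty'K) => ->; rewrite ?ryX ?rtyX.
Qed.

End IrreducibleMap.
End Irreducible.

(** * Suppression of a vertex of degree two *)

Section Suppress.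
Variables (D : finType) (t : {perm D}).
Hypotheses (tK : involutive t) (tN : forall d, t d != d).
Implicit Types (x y z w d e : D) (S : {set D}).

(* With [q := r p], the edge [{q, t q}] is contracted and left isolated: [p] takes the
   place of [t q]. *)
Definition relabel (r : {perm D}) p : {perm D} := tperm p (t (r p)).
Definition suppress r p := skip r p ^ relabel r p.

Variables (r : {perm D}) (p : D).
Hypotheses (irr : irreducible t r) (pm : p \in moved r) (deg2 : r (r p) = p).
Let q := r p.
Let r' := suppress r p.
Let sigma := relabel r p.

Let ll := irreducible_loopless irr.
Let nr := irreducible_nonrepeating irr.
Let tm : stable t (moved r) := nonrepeating_moved tK nr.

Let pq : p != q. Proof. by move: pm; rewrite inE eq_sym. Qed.
Let qm : q \in moved r. Proof. by rewrite stable_mem ?stable_moved. Qed.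
Let porbit_p : porbit r p = [set p; q]. Proof. exact: porbit_invol. Qed.

Let flip_out a : a \in [set p; q] -> t a \notin [set p; q].
Proof. by rewrite -{1}porbit_p => /eq_porbit ap; rewrite -porbit_p -ap ll. Qed.

Let tp_out : t p \notin [set p; q]. Proof. by rewrite flip_out ?set21. Qed.
Let tq_out : t q \notin [set p; q]. Proof. by rewrite flip_out ?set22. Qed.
Let tqp : t q != p. Proof. by move: tq_out; rewrite in_set2 negb_or => /andP[]. Qed.
Let tpq : t p != q. Proof. by move: tp_out; rewrite in_set2 negb_or => /andP[]. Qed.

Lemma relabel_out d : d \notin [set q; t q] -> sigma d \notin [set p; q].
Proof.
rewrite !in_set2 !negb_or => /andP[dq dtq].
rewrite /sigma /relabel; case: tpermP => [_|e|/eqP dp _].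
- by rewrite tqp tN.
- by rewrite e eqxx in dtq.
- by rewrite dp dq.
Qed.

Lemma relabel_in d : d \notin [set p; q] -> sigma d \notin [set q; t q].
Proof.
rewrite !in_set2 !negb_or => /andP[dp dq].
rewrite /sigma /relabel; case: tpermP => [e|_|_ /eqP dtq].
- by rewrite e eqxx in dp.
- by rewrite pq eq_sym tqp.
- by rewrite dq dtq.
Qed.

Let relabel_q : sigma q = q. Proof. by rewrite tpermD // tN. Qed.
Let relabel_p : sigma p = t q. Proof. exact: tpermL. Qed.
Let relabel_tq : sigma (t q) = p. Proof. exact: tpermR. Qed.

Lemma relabelK : involutive sigma.
Proof. exact: tpermK. Qed.

Lemma relabel_moved d : (sigma d \in moved r) = (d \in moved r).
Proof.
by rewrite /sigma /relabel; case: tpermP => [->|->|]; rewrite // (stable_mem q tm) qm pm.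
Qed.

Lemma relabel_neq d : d != p -> d != t q -> sigma d = d.
Proof. by move=> dp dtq; rewrite /sigma /relabel tpermD // eq_sym. Qed.

Lemma suppressE : r' = r * tperm q (r (t q)) * tperm p q * tperm p (t q).
Proof.
rewrite /r' /suppress /skip conjgE -/q tpermV !mulgA; congr (_ * _ * _).
by rewrite conjgC tpermJ.
Qed.

Lemma suppress_perm d : r' (sigma d) = sigma (skip r p d).
Proof. exact: permJ. Qed.

Let skip_out d : d \notin [set p; q] -> skip r p d = r d.
Proof.
rewrite in_set2 negb_or => /andP[dp dq]; rewrite skip_neq //.
by rewrite -[X in _ != X]deg2 (inj_eq perm_inj).
Qed.

Let suppress_out d : d \notin [set p; q] -> r' (sigma d) = sigma (r d).
Proof. by move=> dN; rewrite suppress_perm skip_out. Qed.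

Let skip_q : skip r p q = q. Proof. by rewrite permM deg2 tpermL. Qed.

Lemma suppress_q : r' q = q. Proof. by rewrite -{1}relabel_q suppress_perm skip_q relabel_q. Qed.

Lemma suppress_tq : r' (t q) = t q.
Proof. by rewrite -{1}relabel_p suppress_perm skip_id relabel_p. Qed.

Lemma porbit_suppress d e : d \notin [set q; t q] ->
  (e \in porbit r' d) = (sigma e \in porbit r (sigma d)).
Proof.
move=> dN; have dN' := relabel_out dN.
have pow i : sigma ((r' ^+ i) d) = (skip r p ^+ i) (sigma d).
  by rewrite -{1}[d]relabelK /r' /suppress -conjXg permJ relabelK.
have -> : (e \in porbit r' d) = (sigma e \in porbit (skip r p) (sigma d)).
  apply/porbitP/porbitP => -[i e_i]; exists i; first by rewrite e_i pow.
  by apply: (@perm_inj _ sigma); rewrite e_i pow.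
rewrite porbit_skip; last by move: dN'; rewrite in_set2 negb_or => /andP[].
rewrite in_setD1; have [->|//] := eqVneq (sigma e) p.
by rewrite porbit_sym porbit_p (negPf dN').
Qed.

Lemma suppress_moved : moved r' = moved r :\: [set q; t q].
Proof.
apply/setP => d; rewrite in_setD; have [/set2P[]->|dN] := boolP (d \in [set q; t q]).
- by rewrite inE suppress_q eqxx.
- by rewrite inE suppress_tq eqxx.
rewrite /= inE -{1}[d]relabelK suppress_out ?relabel_out //.
by rewrite -[X in _ != X]relabelK (inj_eq perm_inj) -relabel_moved [RHS]inE.
Qed.

Let face_q : (t * r) q = r (t q). Proof. exact: permM. Qed.
Let face_tq : (t * r) (t q) = p. Proof. by rewrite permM tK deg2. Qed.
Let face_tp : (t * r) (t p) = q. Proof. by rewrite permM tK. Qed.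

Lemma face_suppress d : d \notin [set q; t q] ->
  porbit (t * r') d = porbit (t * r) d :\: [set q; t q].
Proof.
rewrite in_set2 negb_or => /andP[dq dtq].
have skip_tq : skip (t * r) q (t q) = p by rewrite skip_neq // face_tq.
have -> : t * r' = skip (skip (t * r) q) (t q) * tperm q (t q).
  rewrite suppressE !mulgA {1}/skip skip_tq /skip face_q -!mulgA; do 3!congr (_ * _).
  rewrite [tperm (t q) p]tpermC conjgC tpermJ tpermL tpermD //.
  by rewrite [tperm (t q) q]tpermC.
have fix_q : skip (skip (t * r) q) (t q) q = q.
  by rewrite skip_neq ?skip_id // eq_sym.
rewrite (@porbit_tperm_out _ (skip (skip (t * r) q) (t q))).
- by rewrite !porbit_skip //; apply/setP => e; rewrite !inE negb_or andbCA andbA.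
- by rewrite (porbit_fix fix_q) in_set1.
- by rewrite (porbit_fix (skip_id _ _)) in_set1.
Qed.

Lemma face_relabel d : porbit (t * r) (sigma d) = porbit (t * r) d.
Proof.
have face_p : porbit (t * r) (t q) = porbit (t * r) p by rewrite -porbit1 face_tq.
by rewrite /sigma /relabel; case: tpermP => [->|->|].
Qed.

Let rtq_out : r (t q) \notin [set p; q].
Proof. by rewrite -porbit_p stable_mem ?stable_porbit // porbit_p. Qed.

Lemma suppress_planar : planar t r'.
Proof.
have [rtqp rtqq] : r (t q) != p /\ r (t q) != q.
  by move: rtq_out; rewrite in_set2 negb_or => /andP[].
pose r1 := r * tperm q (r (t q)).
have r1q : r1 q = p by rewrite permM deg2 tpermD // eq_sym.
have r2tq : (r1 * tperm p q) (t q) = p by rewrite 2!permM !tpermR.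
rewrite suppressE -/r1; apply: euler_mul_tperm; last 2 first.
- by rewrite eq_sym.
- by have := mem_porbit1 (r1 * tperm p q) (t q); rewrite r2tq porbit_sym => ->.
apply: euler_mul_tperm => //; last by have := mem_porbit1 r1 q; rewrite r1q porbit_sym => ->.
apply: euler_mul_tperm; first exact: irreducible_planar irr.
  by rewrite eq_sym.
by have := mem_porbit1 (t * r) q; rewrite face_q => ->; rewrite orbT.
Qed.

Lemma suppress_ends : t q \notin porbit r (t p).
Proof.
apply/negP => tq_tp; have ends a b : a \in [set p; q] -> b \in [set p; q] -> a != b ->
    t b \in porbit r (t a) -> r (t a) = t b.
  move=> aN bN ab tab; apply: nr; first by rewrite porbit1.
  have rab : r b = a.
    by move: aN bN ab => /set2P[]-> /set2P[]->; rewrite ?eqxx // -/q ?deg2.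
  rewrite -eq_porbit_mem -[porbit _ (t b)]porbit1 [_ (t b)]permM tK rab.
  by rewrite -(porbit1 _ a) [_ a]permM.
have rtp : r (t p) = t q by apply: ends; rewrite ?set21 ?set22.
have rtq : r (t q) = t p by apply: ends; rewrite ?set21 ?set22 1?eq_sym 1?porbit_sym.
have : 3 < #|porbit r p|; last by rewrite porbit_p cards2; case: (_ != _).
apply: (two_vertices_degree irr pm).
have porbit_tp : porbit r (t p) = [set t p; t q] by rewrite porbit_invol rtp.
rewrite porbit_p porbit_tp; apply: homo_stable => a.
by rewrite !inE -!orbA => /or4P[]/eqP->; rewrite ?tK !eqxx ?orbT.
Qed.

Let porbit_end d : d \in [set q; t q] -> porbit r' d = [set d].
Proof. by case/set2P=> ->; rewrite porbit_fix ?suppress_q ?suppress_tq. Qed.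

Lemma suppress_loopless : loopless_map t r'.
Proof.
move=> d; have [dN|dN] := boolP (d \in [set q; t q]); first by rewrite porbit_end ?in_set1.
rewrite porbit_suppress //; have ends := suppress_ends.
have relabel_tp : sigma (t p) = t p by rewrite relabel_neq ?(inj_eq perm_inj).
have [->|dp] := eqVneq d p; first by rewrite relabel_p relabel_tp porbit_sym.
have [tdp|tdp] := eqVneq (t d) p; first by rewrite tdp relabel_p -[d]tK tdp relabel_tp.
have dtq : d != t q by move: dN; rewrite in_set2 negb_or => /andP[].
have tdq : t d != t q by rewrite (inj_eq perm_inj); move: dN; rewrite in_set2 negb_or => /andP[].
by rewrite !relabel_neq.
Qed.

Lemma mem_face_suppress d e : d \notin [set q; t q] -> e \notin [set q; t q] ->
  (e \in porbit (t * r') d) = (sigma e \in porbit (t * r) (sigma d)).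
Proof.
move=> dN eN; rewrite face_suppress // in_setD eN face_relabel /=.
by rewrite -!eq_porbit_mem face_relabel.
Qed.

Lemma suppress_nonrepeating : nonrepeating t r'.
Proof.
move=> x y; have [xN|xN] := boolP (x \in [set q; t q]); first by rewrite porbit_end // => /set1P.
rewrite porbit_suppress // => yx yfx; apply: (@perm_inj _ sigma); apply: nr => //.
by rewrite -mem_face_suppress //; move: yfx; rewrite face_suppress // => /setDP[].
Qed.

(* The darts of [r] that are carried to [S] when [q] and [t q] are merged into [p]. *)
Definition unsuppress_set S := [set d | (if d \in [set q; t q] then p else d) \in S].

Let p_out : p \notin [set q; t q].
Proof. by rewrite in_set2 negb_or pq eq_sym tqp. Qed.

Let mem_unsuppress_out S d : d \notin [set q; t q] -> (d \in unsuppress_set S) = (d \in S).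
Proof. by move=> /negPf dN; rewrite inE dN. Qed.

Lemma mem_unsuppress_relabel S d : d \notin [set q; t q] ->
  (sigma d \in unsuppress_set S) = (d \in S).
Proof.
move=> dN; rewrite inE /sigma /relabel; case: tpermP => [->|dtq|_ _]; last by rewrite (negPf dN).
  by rewrite set22.
by rewrite dtq set22 in dN.
Qed.

Let mem_unsuppress_pq S d : d \in [set p; q] -> (d \in unsuppress_set S) = (p \in S).
Proof. by case/set2P=> ->; rewrite inE ?set21 // (negPf p_out). Qed.

Lemma stable_unsuppress_flip S : stable t S -> stable t (unsuppress_set S).
Proof.
move=> tS; apply: homo_stable => d; rewrite !inE -!in_set2.
have -> : (t d \in [set q; t q]) = (d \in [set q; t q]).
  by rewrite !in_set2 (inj_eq perm_inj) orbC (can2_eq tK tK).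
by case: ifP => // _; rewrite stable_mem.
Qed.

Lemma stable_unsuppress_rot S (s : {perm D}) : s q = q -> s (t q) = t q ->
  stable (r' * s) S -> stable (r * s ^ sigma) (unsuppress_set S).
Proof.
move=> sq stq rS; apply: homo_stable => d; rewrite permM.
have s_sigma a : (s ^ sigma) (sigma a) = sigma (s a) := permJ s sigma a.
have [dN|dN] := boolP (d \in [set p; q]).
  have rdN : (s ^ sigma) (r d) \in [set p; q].
    case/set2P: dN => ->; rewrite -/q ?deg2.
      by rewrite -{1}relabel_q s_sigma sq relabel_q set22.
    by rewrite -{1}relabel_tq s_sigma stq relabel_tq set21.
  by rewrite !mem_unsuppress_pq.
have -> : (s ^ sigma) (r d) = sigma ((r' * s) (sigma d)).
  by rewrite (permM r' s) suppress_out // -s_sigma relabelK.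
rewrite -[d in d \in _]relabelK mem_unsuppress_relabel ?relabel_in //.
have end_stable : stable (r' * s) [set q; t q].
  apply: homo_stable => a /set2P[]->.
    by rewrite permM suppress_q sq set21.
  by rewrite permM suppress_tq stq set22.
have out : (r' * s) (sigma d) \notin [set q; t q] by rewrite stable_mem // relabel_in.
by rewrite mem_unsuppress_relabel // (stable_mem _ rS).
Qed.

Lemma suppress_linked : linked t r'.
Proof.
move=> d e; rewrite suppress_moved => /setDP[dm dN] /setDP[em eN].
pose S := component t r' d; have [tS rS] := (component_flip t r' d, component_rot t r' d).
have tS' := stable_unsuppress_flip tS; have rS' : stable r (unsuppress_set S).
  by have := @stable_unsuppress_rot S 1; rewrite conj1g !mulg1 !perm1; apply.
have dS : d \in unsuppress_set S by rewrite mem_unsuppress_out ?mem_component_id.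
by have := subsetP (linked_stable irr tS' rS' dS dm) e em; rewrite mem_unsuppress_out.
Qed.

Lemma relabel_off_faces x y d : x \in moved r' -> y \in moved r' ->
  off_faces t r' x y d -> off_faces t r (sigma x) (sigma y) (sigma d).
Proof.
rewrite suppress_moved => /setDP[_ xN] /setDP[_ yN] /and3P[+ dx dy].
rewrite suppress_moved => /setDP[dm dN].
by rewrite /off_faces relabel_moved dm -!mem_face_suppress // dx dy.
Qed.

Lemma suppress_not_reducing x y z w S : ~~ reducing t r' x y z w S.
Proof.
apply/negP => /and3P[sep offS offC]; have [xyzw tS cS xS yS] := and5P sep.
have out a : a \in moved r' -> a \notin [set q; t q].
  by rewrite suppress_moved => /setDP[].
have [xm ym zm wm] := curve_moved xyzw.
have [xN yN zN wN] := And4 (out _ xm) (out _ ym) (out _ zm) (out _ wm).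
have off_ex S' : [exists d in S', off_faces t r' x y d] ->
    [exists d in unsuppress_set S', off_faces t r (sigma x) (sigma y) d].
  case/exists_inP=> d dS offd; apply/exists_inP; exists (sigma d); last exact: relabel_off_faces.
  by rewrite mem_unsuppress_relabel //; case/and3P: offd => /out.
have unsuppressC : unsuppress_set (~: S) = ~: unsuppress_set S by apply/setP => d; rewrite !inE.
set xs := sigma x; set ys := sigma y; set zs := sigma z; set ws := sigma w.
apply/negP: (irreducible_not_reducing irr xs ys zs ws (unsuppress_set S)).
rewrite negbK /reducing off_ex // -unsuppressC off_ex // !andbT; apply/and5P; split.
- by move: xyzw; rewrite /curve !porbit_suppress // !mem_face_suppress.
- exact: stable_unsuppress_flip.
- rewrite /curve_cut (_ : swap _ _ _ _ = swap x y z w ^ sigma); last by rewrite conjMg !tpermJ.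
  apply: stable_unsuppress_rot cS; case: (swapP xyzw) => // e; move: xN yN zN wN;
    by rewrite -e !inE eqxx ?orbT.
- by rewrite mem_unsuppress_relabel.
- by rewrite mem_unsuppress_relabel.
Qed.

Lemma suppress_faces : 3 < #|porbit (t * r') @: moved r'|.
Proof.
apply: leq_trans (irreducible_faces irr) _.
apply: leq_trans (_ : _ <= #|porbit (t * r) @: moved r'|) _.
  apply/subset_leq_card/subsetP => _ /imsetP[d dm ->]; rewrite suppress_moved.
  have [/set2P[]->|dN] := boolP (d \in [set q; t q]).
  - have -> : porbit (t * r) q = porbit (t * r) (t p) by rewrite -[RHS]porbit1 face_tp.
    by rewrite imset_f // in_setD in_set2 negb_or tpq (inj_eq perm_inj) pq stable_mem.
  - by rewrite -porbit1 face_tq imset_f // in_setD p_out.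
  - by rewrite imset_f // in_setD dN.
apply: leq_card_imset_factor => a b; rewrite suppress_moved => /setDP[_ aN] _ ab.
apply/esym/eq_porbit; have : b \in porbit (t * r') a by rewrite ab porbit_id.
by rewrite face_suppress // => /setDP[].
Qed.

Lemma suppress_irreducible : irreducible t r'.
Proof.
split; [exact: suppress_planar|exact: suppress_loopless|exact: suppress_nonrepeating
  |exact: suppress_linked|exact: suppress_not_reducing|exact: suppress_faces].
Qed.

End Suppress.

(** * Connected graphs *)

Lemma adj_dart (G : graph) (d : dart G) : adj (source d) (target d).
Proof. by apply/existsP; exists d; rewrite !eqxx. Qed.

Lemma adj_sym (G : graph) : symmetric (@adj G).
Proof.
suff sub u v : @adj G u v -> adj v u by move=> u v; apply/idP/idP; apply: sub.
case/existsP=> d /andP[/eqP <- /eqP <-].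
by have := adj_dart (flip d); rewrite /target flipK.
Qed.

Definition adj_avoiding (G : graph) (S : {set vertex G}) : rel (vertex G) :=
  [rel x y | [&& x \notin S, y \notin S & adj x y]].

Lemma connected_graphE (G : graph) :
  connected_graph G <-> (exists v : vertex G, true) /\ forall u v, connect (@adj G) u v.
Proof.
have adjE : adj_avoiding set0 =2 @adj G.
  by move=> x y; rewrite /adj_avoiding /= !in_set0.
split=> -[[v0 _] conn]; split.
- by exists v0.
- by move=> u v; rewrite -(eq_connect adjE); apply: conn; rewrite in_set0.
- by exists v0; rewrite in_set0.
- by move=> u v _ _; rewrite -/(adj_avoiding set0) (eq_connect adjE).
Qed.

Lemma n_comp_connected (G : graph) : connected_graph G -> n_comp (@adj G) predT = 1%N.
Proof.
case/connected_graphE => -[v _] conn.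
rewrite -(n_comp_connect (sym_connect_sym (@adj_sym G)) v).
by apply: eq_n_comp_r => u; rewrite !inE; apply/esym/conn.
Qed.

Lemma incident_dart (G : embedded_graph) (d : dart G) f :
  incident (source d) f = [exists e : dart G, (source e == source d) && (side e == f)].
Proof.
rewrite /incident (_ : isolated _ = false) ?orbF //.
by apply/forallP => /(_ d); rewrite eqxx.
Qed.

Lemma graph_iso_refl G : graph_iso G G.
Proof. by exists id, id; split=> //; exists id. Qed.

Lemma graph_iso_connected G H : graph_iso G H -> connected_graph G -> connected_graph H.
Proof.
case=> fV [fD [[gV fK gK] _ fs ff]] /connected_graphE[[v0 _] conn]; apply/connected_graphE.
split=> [|u v]; first by exists (fV v0).
rewrite -(gK u) -(gK v); apply: connect_homo (conn _ _) => _ _ /existsP[d /andP[/eqP<- /eqP<-]].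
by rewrite /target -!fs -ff; apply/connect1/adj_dart.
Qed.

Lemma subdivide_connected G (d : dart G) : connected_graph G -> connected_graph (subdivide d).
Proof.
case/connected_graphE=> _ conn; apply/connected_graphE; split; first by exists None.
pose R := @adj (subdivide d); have symR : connect_sym R := sym_connect_sym (@adj_sym (subdivide d)).
have to_new : connect R (Some (source d)) None.
  by have := adj_dart (inl d : dart (subdivide d)); rewrite /target /= eqxx => /connect1.
have from_new : connect R None (Some (target d)).
  by have := adj_dart (inr true : dart (subdivide d)) => /connect1.
have old_old u v : connect R (Some u) (Some v).
  apply: connect_homo (conn u v) => _ _ /existsP[a /andP[/eqP<- /eqP<-]].
  have [->|ad] := eqVneq a d; first exact: connect_trans from_new.
  have [->|ad'] := eqVneq a (flip d).
    by rewrite /target flipK symR; apply: connect_trans from_new.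
  have := adj_dart (inl a : dart (subdivide d)).
  by rewrite /target /= (negPf ad) (negPf ad') => /connect1.
have old_new u : connect R (Some u) None by apply: connect_trans (old_old u _) to_new.
by move=> [u|] [v|]; rewrite ?connect0 // symR.
Qed.

Lemma subdivision_connected H G : subdivision_of H G -> connected_graph H -> connected_graph G.
Proof.
move=> sub connH; elim: sub => [G' iso|G1 d G2 _ conn1 iso].
  exact: graph_iso_connected iso connH.
exact: graph_iso_connected iso (subdivide_connected _ conn1).
Qed.

(** * The plane graph of an irreducible map *)

Section MapGraph.
Variables (D : finType) (t : {perm D}).
Hypotheses (tK : involutive t) (tN : forall d, t d != d).
Variable r : {perm D}.
Hypothesis irr : irreducible t r.

Let ll := irreducible_loopless irr.
Let nr := irreducible_nonrepeating irr.
Let tm : stable t (moved r) := nonrepeating_moved tK nr.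
Let rm : stable r (moved r) := stable_moved r.
Let fm : stable (t * r) (moved r) := face_moved tK nr.

Definition map_vertex := {A : {set D} | A \in porbit r @: moved r}.
Definition map_dart := {d : D | d \in moved r}.
Definition map_face := {A : {set D} | A \in porbit (t * r) @: moved r}.

Definition map_source (d : map_dart) : map_vertex :=
  exist _ (porbit r (val d)) (imset_f (porbit r) (valP d)).
Definition map_side (d : map_dart) : map_face :=
  exist _ (porbit (t * r) (val d)) (imset_f (porbit (t * r)) (valP d)).
Definition map_flip (d : map_dart) : map_dart :=
  exist _ (t (val d)) (etrans (stable_mem (val d) tm) (valP d)).
Definition map_next (d : map_dart) : map_dart :=
  exist _ (r (val d)) (etrans (stable_mem (val d) rm) (valP d)).

Lemma map_flipK : involutive map_flip.
Proof. by move=> d; apply: val_inj; rewrite /= tK. Qed.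

Lemma map_sourceE d e : (map_source d == map_source e) = (val e \in porbit r (val d)).
Proof. by rewrite -val_eqE /= eq_porbit_mem porbit_sym. Qed.

Lemma map_sideE d e : (map_side d == map_side e) = (val e \in porbit (t * r) (val d)).
Proof. by rewrite -val_eqE /= eq_porbit_mem porbit_sym. Qed.

Lemma map_source_next d : map_source (map_next d) = map_source d.
Proof. by apply: val_inj; rewrite /= porbit1. Qed.

Lemma map_loopless d : map_source (map_flip d) != map_source d.
Proof. by rewrite map_sourceE porbit_sym ll. Qed.

Definition map_graph : graph :=
  @Graph map_vertex map_dart map_source map_flip map_flipK map_loopless.

Lemma ex_map_source (v : map_vertex) : exists d, map_source d = v.
Proof.
case: v => A PA; case/imsetP: (PA) => d dm Ad.
by exists (exist _ d dm); apply: val_inj; rewrite /= Ad.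
Qed.

Lemma ex_map_side (f : map_face) : exists d, map_side d = f.
Proof.
case: f => A PA; case/imsetP: (PA) => d dm Ad.
by exists (exist _ d dm); apply: val_inj; rewrite /= Ad.
Qed.

Lemma map_nextP (d e : dart map_graph) : fconnect map_next d e = (source d == source e).
Proof.
have val_iter i (a : map_dart) : val (iter i map_next a) = (r ^+ i) (val a).
  by elim: i => [|i IHi]; rewrite ?expg0 ?perm1 //= IHi expgSr permM.
rewrite [RHS]map_sourceE; apply/idP/porbitP => [/iter_findex <-|[i e_i]].
  by exists (findex map_next d e); rewrite val_iter.
by rewrite (_ : e = iter i map_next d) ?fconnect_iter //; apply: val_inj; rewrite val_iter.
Qed.

Lemma map_sideP (d : dart map_graph) : map_side (map_next (flip d)) = map_side d.
Proof. by apply: val_inj; rewrite /= -permM porbit1. Qed.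

Lemma ex_map_dart : exists d : map_dart, true.
Proof.
have : 0 < #|porbit (t * r) @: moved r| by apply: leq_trans (irreducible_faces irr).
by case/card_gt0P => A /imsetP[d dm _]; exists (exist _ d dm).
Qed.

Definition map_embedding : embedded_graph :=
  @EmbeddedGraph map_graph map_next map_nextP map_face map_side map_sideP
    (fun _ => map_side (xchoose ex_map_dart)).

Lemma map_incident (v : vertex map_embedding) (f : face map_embedding) :
  incident v f = [exists d : map_dart, (map_source d == v) && (map_side d == f)].
Proof.
by have [d <-] := ex_map_source v; apply: (incident_dart (G := map_embedding)).
Qed.

Lemma map_source_incident (d : map_dart) :
  incident (G := map_embedding) (map_source d) (map_side d).
Proof. by rewrite map_incident; apply/existsP; exists d; rewrite !eqxx. Qed.

Lemma map_connect (T : finType) (R : rel T) (h : map_dart -> T) :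
  (forall d, connect R (h d) (h (map_flip d))) -> (forall d, connect R (h d) (h (map_next d))) ->
  forall d e, connect R (h d) (h e).
Proof.
move=> R_flip R_next d e; pose S := [set val a | a in [set a | connect R (h d) (h a)]].
have [tS rS] : stable t S /\ stable r S.
  split; apply: homo_stable => _ /imsetP[a + ->]; rewrite inE => da; apply/imsetP.
    by exists (map_flip a) => //; rewrite inE (connect_trans da).
  by exists (map_next a) => //; rewrite inE (connect_trans da).
have dS : val d \in S by rewrite imset_f // inE connect0.
have /imsetP[a] := subsetP (linked_stable irr tS rS dS (valP d)) _ (valP e).
by rewrite inE => da /val_inj->.
Qed.

Lemma map_graph_connected (u v : map_vertex) : connect (@adj map_graph) u v.
Proof.
have [d <-] := ex_map_source u; have [e <-] := ex_map_source v.
apply: map_connect => a; last by rewrite map_source_next connect0.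
exact/connect1/(adj_dart (a : dart map_graph)).
Qed.

Lemma map_incidence_connected (d e : map_dart) :
  connect (@incidence_rel map_embedding) (inl (map_source d)) (inl (map_source e)).
Proof.
apply: (map_connect (h := fun a => inl (map_source a))) => a.
  apply: (connect_trans (y := inr (map_side a))); apply: connect1.
    exact: map_source_incident.
  by rewrite /= -map_sideP -map_source_next map_source_incident.
by rewrite map_source_next connect0.
Qed.

Lemma components_irreducible : components t r = moved r |: porbit (t * r) @: ~: moved r.
Proof.
have inC d : d \in moved r -> component t r d = moved r.
  move=> dm; apply/eqP; rewrite eqEsubset component_sub_stable //=.
  by apply/subsetP => e em; apply: irreducible_linked.
have outC d : d \in ~: moved r -> component t r d = porbit (t * r) d.
  rewrite in_setC => dm; apply/eqP; rewrite eqEsubset face_sub_component andbT.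
  have tdm : t d \notin moved r by rewrite stable_mem.
  rewrite face_notin_moved // component_sub_stable ?set21 //; apply: homo_stable => a /set2P[]->;
    by rewrite ?tK ?(notin_moved dm) ?(notin_moved tdm) ?set21 ?set22.
apply/setP => A; rewrite in_setU1; apply/imsetP/orP => [[d _ ->]|].
  have [dm|dm] := boolP (d \in moved r); first by left; rewrite inC.
  by right; rewrite outC ?in_setC // imset_f ?in_setC.
have [d _] := ex_map_dart.
case=> [/eqP->|/imsetP[e em ->]]; first by exists (val d); rewrite ?inC ?(valP d).
by exists e; rewrite ?outC.
Qed.

Lemma map_euler : #|porbit r @: moved r| + #|porbit (t * r) @: moved r| = #|moved r|./2 + 2.
Proof.
have := euler_formula tK tN (irreducible_planar irr).
have out_faces : #|porbit (t * r) @: ~: moved r|.*2 = #|~: moved r|.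
  apply: card_porbit_invol => [|d]; first exact: stableC.
  rewrite in_setC => dm; have tdm : t d \notin moved r by rewrite stable_mem.
  by rewrite !permM (notin_moved tdm) tK (notin_moved dm).
have -> : #|components t r| = #|porbit (t * r) @: ~: moved r|.+1.
  rewrite components_irreducible cardsU1.
  suff -> : moved r \notin porbit (t * r) @: ~: moved r by [].
  apply/imsetP => -[d dm face_d]; have := porbit_id (t * r) d.
  by rewrite -face_d; apply/negP; rewrite -in_setC.
rewrite card_porbits_moved (card_porbits_stable fm).
by move: out_faces (cardsC (moved r)); clear; lia.
Qed.

Lemma map_spherical : spherical map_embedding.
Proof.
have [d0 _] := ex_map_dart; split=> [x y|].
  have sym : connect_sym (@incidence_rel map_embedding) by apply: sym_connect_sym => -[a|a] [b|b].
  have to_vertex (a : vertex map_embedding + face map_embedding) :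
      connect (@incidence_rel map_embedding) a (inl (map_source d0)).
    case: a => [v|f]; first by have [d <-] := ex_map_source v; apply: map_incidence_connected.
    have [d <-] := ex_map_side f; apply: connect_trans (map_incidence_connected d d0).
    exact/connect1/map_source_incident.
  by apply: connect_trans (to_vertex x) _; rewrite sym.
have -> : n_comp (@adj map_embedding) predT = 1%N.
  apply/n_comp_connected/connected_graphE; split; first by exists (map_source d0).
  exact: map_graph_connected.
by rewrite !card_sub map_euler -addnA.
Qed.

Definition map_plane : plane_graph := PlaneGraph map_spherical.

Lemma map_max_face_degree m : bounded_map t m r -> max_face_degree map_plane <= m.
Proof.
case=> _ _ deg; apply/bigmax_leqP => f _; have [d <-] := ex_map_side f.
apply: leq_trans (deg (val d)); rewrite /face_degree /facial_degree.
rewrite -(card_imset _ (val_inj : injective (val : map_vertex -> {set D}))).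
apply/subset_leq_card/subsetP => _ /imsetP[v vf ->]; move: vf; rewrite inE map_incident.
case/existsP => e /andP[/eqP <- ed]; rewrite /= imset_f //.
by rewrite porbit_sym -map_sideE.
Qed.

Lemma map_colorable k : 1 < k -> cyclically_colorable map_plane k -> colorable t k r.
Proof.
move=> k_gt1 /existsP[c /forallP c_cyclic].
pose c0 d := if insub d is Some d' then c (map_source d') else Ordinal k_gt1.
have c0E (d : map_dart) : c0 (val d) = c (map_source d) by rewrite /c0 valK.
apply: (colorable_moved tK tN (c := c0)) => // d dm; split.
  by rewrite -[d]/(val (exist _ d dm : map_dart)) -[r _]/(val (map_next _)) !c0E map_source_next.
move=> a b ad bd; have am : a \in moved r by rewrite (porbit_mem_stable fm ad).
have bm : b \in moved r by rewrite (porbit_mem_stable fm bd).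
pose a' : map_dart := exist _ a am; pose b' : map_dart := exist _ b bm.
rewrite -[a]/(val a') -[b]/(val b') !c0E => cab; rewrite -map_sourceE; apply: contraT => nab.
have /forallP/(_ (map_source a'))/forallP/(_ (map_source b')) := c_cyclic (map_side a').
rewrite cab eqxx implybF nab map_source_incident /= => /negP[].
have -> : map_side a' = map_side b' by apply/eqP; rewrite map_sideE (eq_porbit ad).
exact: map_source_incident.
Qed.

End MapGraph.

Section ThreeConnected.
Variables (D : finType) (t : {perm D}).
Hypotheses (tK : involutive t) (tN : forall d, t d != d).
Variable r : {perm D}.
Hypothesis irr : irreducible t r.
Hypothesis deg3 : {in moved r, forall d, r (r d) != d}.
Let G := map_graph tK irr.

Lemma map_simple : simple_graph G.
Proof.
move=> d e /eqP sde /eqP tde; apply/esym/val_inj.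
apply: (parallel_eq tK tN irr deg3 (valP d)); rewrite /parallel -map_sourceE sde.
by move: tde; rewrite /target map_sourceE.
Qed.

Lemma map_card_vertex : 3 < #|vertex G|.
Proof.
have [d _] := ex_map_dart irr.
pose d1 : dart G := d; pose d2 : dart G := map_next d1; pose d3 : dart G := map_next d2.
have [s2 s3] : source d2 = source d1 /\ source d3 = source d1.
  by split; apply: val_inj; rewrite /= ?porbit1.
have n12 : d2 != d1 by rewrite -val_eqE; have := valP d; rewrite inE.
have n23 : d3 != d2 by rewrite -val_eqE /= (inj_eq perm_inj).
have n13 : d3 != d1 by rewrite -val_eqE; apply: deg3 (valP d).
have target_neq (a b : dart G) : source a = source b -> a != b -> target a != target b.
  by move=> sab; apply: contraNneq => tab; rewrite (map_simple sab tab).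
have target_source (a : dart G) : source a = source d1 -> source d1 != target a.
  by move=> <-; rewrite eq_sym; apply: loopless.
have uniq4 : uniq [:: source d1; target d1; target d2; target d3].
  rewrite /= !inE !negb_or; apply/and4P; split=> //.
  - by rewrite !target_source.
  - by rewrite ![target d1 == _]eq_sym !target_neq.
  - by rewrite eq_sym target_neq // s2 s3.
by rewrite cardE; apply: (uniq_leq_size uniq4) => x _; rewrite mem_enum.
Qed.

Definition darts_at (A : {set vertex G}) : {set D} :=
  [set val d | d in [set d : dart G | source d \in A]].

Lemma mem_darts_at A (d : dart G) : (val d \in darts_at A) = (source d \in A).
Proof. by rewrite mem_imset ?inE //; apply: val_inj. Qed.

Lemma darts_at_sub A : darts_at A \subset moved r.
Proof. by apply/subsetP => _ /imsetP[d _ ->]; apply: valP. Qed.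

Lemma darts_at_stable A : stable r (darts_at A).
Proof.
apply: homo_stable => _ /imsetP[d + ->]; rewrite inE => dA.
by rewrite -[r _]/(val (map_next d)) mem_darts_at [source _]map_source_next.
Qed.

Lemma darts_at_two_vertices (S : {set vertex G}) : #|S| < 3 ->
  {in darts_at S & &, forall a b c,
    b \notin porbit r a -> c \notin porbit r a -> c \in porbit r b}.
Proof.
move=> S2 _ _ _ /imsetP[a + ->] /imsetP[b + ->] /imsetP[c + ->].
rewrite !inE -!map_sourceE => aS bS cS ab ac; apply: contraLR S2 => bc; rewrite -leqNgt.
have uniq3 : uniq [:: @source G a; @source G b; @source G c].
  by rewrite /= !inE negb_or ab ac bc.
by rewrite cardE; apply: (uniq_leq_size uniq3) => x; rewrite mem_enum !inE => /or3P[]/eqP->.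
Qed.

Lemma map_vertex_cut (S : {set vertex G}) u : #|S| < 3 -> u \notin S ->
  vertex_cut t r (darts_at [set x | connect (adj_avoiding S) u x]) (darts_at S).
Proof.
move=> S2 uS; have reachable x : connect (adj_avoiding S) u x -> x \notin S.
  case/connectP=> p; case/lastP: p => [_ ->//|p y].
  by rewrite rcons_path last_rcons => /andP[_ /and3P[_ yS _]] ->.
split; [exact: darts_at_stable| | |exact: darts_at_stable|exact: darts_at_sub|].
- apply/subsetP => _ /imsetP[a + ->]; rewrite in_setD mem_darts_at (valP a) andbT !inE.
  exact: reachable.
- move=> _ /imsetP[a + ->]; rewrite !inE => ua.
  rewrite -[t (val a)]/(val (@flip G a)) !mem_darts_at inE.
  have [_|aS] := boolP (source (@flip G a) \in S); first by rewrite orbT.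
  rewrite orbF (connect_trans ua) //; apply: connect1; apply/and3P; split=> //.
    exact: reachable.
  exact: adj_dart.
- exact: darts_at_two_vertices.
Qed.

Lemma map_three_connected : three_connected G.
Proof.
split=> [|S S2]; first exact: map_card_vertex.
split=> [|u v uS vS].
  apply/existsP; apply: contraT => /existsPn all_in.
  have leVS : #|vertex G| <= #|S|.
    by apply/subset_leq_card/subsetP => v _; have := all_in v; rewrite negbK.
  by have := leq_ltn_trans leVS S2; rewrite ltnNge (ltnW map_card_vertex).
have [d du] := ex_map_source u; have [e ev] := ex_map_source v.
have cut := map_vertex_cut S2 uS.
have : moved r \subset darts_at [set x | connect (adj_avoiding S) u x] :|: darts_at S.
  apply: (vertex_cut_total tK tN irr deg3 cut); apply/set0Pn; exists (val d).
  by rewrite (mem_darts_at _ (d : dart G)) inE [source _]du connect0.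
move/subsetP/(_ _ (valP e)); rewrite in_setU !(mem_darts_at _ (e : dart G)) inE [source _]ev.
by rewrite (negPf vS) orbF.
Qed.

End ThreeConnected.

(** * Suppression and subdivision *)

Section SuppressSubdivision.
Variables (D : finType) (t : {perm D}).
Hypotheses (tK : involutive t) (tN : forall d, t d != d).
Variables (r : {perm D}) (p : D).
Hypotheses (irr : irreducible t r) (pm : p \in moved r) (deg2 : r (r p) = p).
Let q := r p.
Let r' := suppress t r p.
Let sigma := relabel t r p.
Let irr' : irreducible t r' := suppress_irreducible tK tN irr pm deg2.
Let G := map_graph tK irr.
Let G' := map_graph tK irr'.

Let moved'E : moved r' = moved r :\: [set q; t q] := suppress_moved tK tN irr pm deg2.
Let porbit_p : porbit r p = [set p; q]. Proof. exact: porbit_invol. Qed.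
Let qm : q \in moved r. Proof. by rewrite stable_mem ?stable_moved. Qed.

Let moved'_out d : d \in moved r' -> d \notin [set q; t q].
Proof. by rewrite moved'E => /setDP[]. Qed.

Let relabel_moved_out d : d \in moved r' -> sigma d \notin [set p; q].
Proof. by move/moved'_out; apply: (relabel_out tN irr deg2). Qed.

Lemma moved_unsuppress d : d \in moved r' -> sigma d \in moved r.
Proof.
by rewrite moved'E => /setDP[dm _]; rewrite (relabel_moved tK irr pm).
Qed.

Lemma moved_suppress d : d \in moved r -> d \notin [set p; q] -> sigma d \in moved r'.
Proof.
by move=> dm dN; rewrite moved'E in_setD (relabel_in irr pm deg2 dN) (relabel_moved tK irr pm).
Qed.

Lemma porbit_unsuppress d : d \in moved r' -> sigma @: porbit r' d = porbit r (sigma d).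
Proof.
move=> dm; apply/setP => e.
rewrite -[in LHS](relabelK t r p e) (mem_imset _ _ perm_inj) (porbit_suppress tN irr deg2).
  by rewrite relabelK.
exact: moved'_out.
Qed.

Lemma unsuppress_vertex_subproof A :
  A \in porbit r' @: moved r' -> sigma @: A \in porbit r @: moved r.
Proof. by case/imsetP=> d dm ->; rewrite porbit_unsuppress // imset_f // moved_unsuppress. Qed.

Definition unsuppress_vertex (v : option (vertex G')) : vertex G :=
  if v is Some v' then exist _ (sigma @: val v') (unsuppress_vertex_subproof (valP v'))
  else exist _ (porbit r p) (imset_f (porbit r) pm).

Definition unsuppress_dart (x : dart G' + bool) : dart G :=
  match x with
  | inl d => exist _ (sigma (val d)) (moved_unsuppress (valP d))
  | inr b => if b then exist _ p pm else exist _ q qm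
  end.

Lemma unsuppress_vertex_bij : bijective unsuppress_vertex.
Proof.
apply: inj_surj_bij => [|v].
  have old_new (v : vertex G') : sigma @: val v <> porbit r p.
    have [d <-] := ex_map_source v; rewrite /= porbit_unsuppress ?(valP d) // => old_new.
    have := relabel_moved_out (valP d); by rewrite -porbit_p -old_new porbit_id.
  move=> [u|] [v|] // /(congr1 val) /=.
  - by move/(imset_inj perm_inj)/val_inj->.
  - by move/old_new.
  - by move/esym/old_new.
have [d <-] := ex_map_source v; have [dN|dN] := boolP (val d \in [set p; q]).
  by exists None; apply/val_inj/esym/eq_porbit; rewrite porbit_p.
exists (Some (map_source (exist _ (sigma (val d)) (moved_suppress (valP d) dN)))).
by apply: val_inj; rewrite /= porbit_unsuppress ?moved_suppress ?(valP d) // relabelK.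
Qed.

Lemma unsuppress_dart_bij : bijective unsuppress_dart.
Proof.
have pq : p <> q by apply/eqP; move: pm; rewrite inE eq_sym.
apply: inj_surj_bij => [|d].
  have old_new (d : dart G') (b : bool) : sigma (val d) <> val (unsuppress_dart (inr b)).
    move=> d_b; have := relabel_moved_out (valP d).
    by rewrite d_b; case: (b); rewrite !inE eqxx ?orbT.
  move=> [d|b] [e|b'] /(congr1 val).
  - by move/perm_inj/val_inj->.
  - by move/old_new.
  - by move/esym/old_new.
  - by case: b; case: b' => // /esym/pq.
have [dN|dN] := boolP (val d \in [set p; q]).
  by case/set2P: dN => d_pq; [exists (inr true)|exists (inr false)]; apply: val_inj.
exists (inl (exist _ (sigma (val d)) (moved_suppress (valP d) dN))).
by apply: val_inj; rewrite /= relabelK.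
Qed.

Let pm' : p \in moved r'.
Proof.
have := irreducible_loopless irr q; rewrite moved'E in_setD pm andbT porbit1 porbit_p.
rewrite !in_set2 !negb_or ![p == _]eq_sym => /andP[-> _].
by move: pm; rewrite inE => ->.
Qed.
Let d0 : dart G' := exist _ p pm'.

Lemma source_unsuppress x : source (unsuppress_dart x) = unsuppress_vertex (subdivide_source x).
Proof.
apply: val_inj; case: x => [d|[]] //=; first by rewrite porbit_unsuppress ?(valP d).
exact: porbit1.
Qed.

Lemma flip_unsuppress x : flip (unsuppress_dart x) = unsuppress_dart (subdivide_flip d0 x).
Proof.
have tp_neq : t p != p /\ t p != t q.
  by rewrite tN (inj_eq perm_inj); split=> //; move: pm; rewrite inE eq_sym.
apply: val_inj; case: x => [d|[]] /=.
- rewrite -!(inj_eq val_inj) /=; have [->|dp] := eqVneq (val d) p.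
    by rewrite /= /sigma /relabel tpermL tK.
  have [->|dtp] := eqVneq (val d) (t p); first by rewrite relabel_neq ?tK //; case: tp_neq.
  have := moved'_out (valP d); rewrite !inE negb_or => /andP[dq dtq].
  rewrite /= !relabel_neq ?(inj_eq perm_inj) //.
  by apply: contraNneq dtp => <-; rewrite tK.
- by rewrite relabel_neq //; case: tp_neq.
- by rewrite /sigma /relabel tpermL.
Qed.

Lemma suppress_iso : graph_iso (subdivide d0) G.
Proof.
exists unsuppress_vertex, unsuppress_dart; split.
- exact: unsuppress_vertex_bij.
- exact: unsuppress_dart_bij.
- exact: source_unsuppress.
- exact: flip_unsuppress.
Qed.

End SuppressSubdivision.

Lemma irreducible_subdivision (D : finType) (t : {perm D}) (tK : involutive t) r
    (irr : irreducible t r) : (forall d, t d != d) ->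
  exists H : plane_graph,
    [/\ simple_graph H, three_connected H & subdivision_of H (map_graph tK irr)].
Proof.
move=> tN; have [n] := ubnP #|moved r|; elim: n r irr => // n IHn r irr; rewrite ltnS => moved_le.
have [/exists_inP[p pm /eqP deg2]|/exists_inPn deg3] := boolP [exists p in moved r, r (r p) == p].
  have [|H [simpleH connH subH]] := IHn _ (suppress_irreducible tK tN irr pm deg2).
    apply: leq_trans moved_le; rewrite suppress_moved //; apply/proper_card/properP.
    by split; [exact: subsetDl|exists (r p); rewrite ?in_setD ?set21 // stable_mem ?stable_moved].
  by exists H; split=> //; apply: Subdivision_step subH (suppress_iso tK tN irr pm deg2).
exists (map_plane tK tN irr); split.
- exact: map_simple.
- exact: map_three_connected.
- exact/Subdivision_refl/graph_iso_refl.
Qed.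

(** * The map of a connected plane graph *)

Section PlaneMap.
Variable G : plane_graph.
Hypothesis connG : connected_graph G.
Variable d0 : dart G.

Lemma plane_rot_inj : injective (@Defs.rot G).
Proof.
move=> a b rot_ab; have source_rot (d : dart G) : source d = source (Defs.rot d).
  by apply/eqP; rewrite -rotP fconnect1.
have /(orbitPcycle 2 5) : a \in fconnect (@Defs.rot G) (Defs.rot a).
  by rewrite inE rotP -source_rot.
by apply; rewrite -?fconnect_orbit ?rotP ?(source_rot a) ?rot_ab -?source_rot.
Qed.

Definition plane_flip : {perm dart G} := perm (can_inj (@flipK G)).
Definition plane_rot : {perm dart G} := perm plane_rot_inj.
Let t := plane_flip.
Let r := plane_rot.

Let flipE d : t d = flip d. Proof. exact: permE. Qed.

Lemma plane_flipK : involutive t.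
Proof. by move=> d; rewrite !flipE flipK. Qed.

Lemma plane_flip_neq d : t d != d.
Proof. by rewrite flipE; apply: contraNneq (loopless d) => ->. Qed.

Lemma mem_plane_vertex d e : (e \in porbit r d) = (source d == source e).
Proof. by rewrite -rotP porbit_fconnect; apply: eq_fconnect => a; rewrite permE. Qed.

Lemma side_plane_face d e : e \in porbit (t * r) d -> side e = side d.
Proof. by apply: (porbit_invariant (f := @side G)) => a; rewrite permM flipE permE sideP. Qed.

Lemma ex_plane_source (v : vertex G) : exists d : dart G, source d == v.
Proof.
have [_ conn] := iffLR (connected_graphE G) connG.
have /connectP[[|u p] /=] := conn v (source d0); first by move=> _ <-; exists d0.
by case/andP=> /existsP[d /andP[dv _]] _ _; exists d.
Qed.

Lemma plane_incident (v : vertex G) (f : face G) :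
  incident v f = [exists d : dart G, (source d == v) && (side d == f)].
Proof. by have [d /eqP<-] := ex_plane_source v; apply: incident_dart. Qed.

Lemma ex_plane_side (f : face G) : exists d : dart G, side d = f.
Proof.
have [/(_ (inr f) (inl (source d0)))/connectP[[|[v|g] p] //= /andP[vf _] _] _] := plane_spherical G.
by move: vf; rewrite plane_incident => /existsP[d /andP[_ /eqP <-]]; exists d.
Qed.

Lemma card_plane_components : #|components t r| <= 1.
Proof.
have [_ conn] := iffLR (connected_graphE G) connG.
pose component_of v := component t r (xchoose (ex_plane_source v)).
have component_source d : component_of (source d) = component t r d.
  apply/eq_component/(subsetP (porbit_sub_component t r d)).
  by rewrite mem_plane_vertex eq_sym; apply: xchooseP (ex_plane_source _).
have closed_component A : closed (@adj G) [pred v | component_of v == A].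
  move=> _ _ /existsP[d /andP[/eqP<- /eqP<-]]; rewrite !inE !component_source -flipE.
  by rewrite (eq_component (x := d) (y := t d)) // stable_mem ?component_flip ?mem_component_id.
apply/card_le1_eqP => _ _ /imsetP[d _ ->] /imsetP[e _ ->].
have := closed_connect (closed_component (component t r d)) (conn (source d) (source e)).
by rewrite !inE !component_source eqxx => /esym/eqP->.
Qed.

Lemma card_plane_vertices : #|vertex G| <= #|porbits r|.
Proof.
rewrite porbitsT -cardsT (_ : [set: vertex G] = @source G @: [set: dart G]).
  by apply: leq_card_imset_factor => a b _ _ ab; apply/eqP; rewrite -mem_plane_vertex ab porbit_id.
by apply/setP => v; rewrite in_setT; have [d /eqP<-] := ex_plane_source v; rewrite imset_f ?in_setT.
Qed.

Let faces_image : [set: face G] = @side G @: [set: dart G].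
Proof.
by apply/setP => f; rewrite in_setT; have [d <-] := ex_plane_side f; rewrite imset_f ?in_setT.
Qed.

Let porbit_side a b : porbit (t * r) a = porbit (t * r) b -> side a = side b.
Proof. by move=> ab; apply: side_plane_face; rewrite -ab porbit_id. Qed.

Lemma plane_euler : #|dart G|./2 + 2 = #|vertex G| + #|face G|.
Proof.
by have [_ ->] := plane_spherical G; rewrite n_comp_connected // -addnA.
Qed.

Lemma mem_plane_face d e : (e \in porbit (t * r) d) = (side d == side e).
Proof.
apply/idP/eqP => [/side_plane_face->//|].
have inj : {in [set: dart G] &, forall a b, side a = side b -> porbit (t * r) a = porbit (t * r) b}.
  apply: imset_factor_inj => [a b _ _|]; first exact: porbit_side.
  rewrite -porbitsT -faces_image cardsT; have := euler_le plane_flipK plane_flip_neq r.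
  by move: plane_euler card_plane_components card_plane_vertices; clear; lia.
by move/inj => ->; rewrite ?inE ?porbit_id.
Qed.

Lemma plane_map_bounded : bounded_map t (max_face_degree G) r.
Proof.
split.
- have leF : #|face G| <= #|porbits (t * r)|.
    rewrite porbitsT -cardsT faces_image; apply: leq_card_imset_factor => a b _ _.
    exact: porbit_side.
  rewrite /planar /euler_excess.
  by move: plane_euler card_plane_components card_plane_vertices leF; clear; lia.
- by move=> d; rewrite mem_plane_vertex flipE eq_sym loopless.
move=> d; apply: leq_trans (leq_bigmax (side d)); rewrite /facial_degree /face_degree.
apply: leq_trans (_ : _ <= #|@source G @: porbit (t * r) d|) _.
  apply: leq_card_imset_factor => a b _ _ ab.
  by apply/esym/eq_porbit; rewrite mem_plane_vertex ab.
apply/subset_leq_card/subsetP => _ /imsetP[a ad ->]; rewrite inE plane_incident.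
by apply/existsP; exists a; rewrite eqxx (side_plane_face ad) eqxx.
Qed.

Lemma plane_map_colorable k : colorable t k r -> cyclically_colorable G k.
Proof.
case=> c pc; pose c' := [ffun v => c (xchoose (ex_plane_source v))].
have c'E d : c' (source d) = c d.
  rewrite ffunE; apply: (proper_vertex pc); rewrite mem_plane_vertex eq_sym.
  exact: xchooseP (ex_plane_source (source d)).
apply/existsP; exists c'; apply/forallP => f; apply/forallP => u; apply/forallP => v.
apply/implyP; rewrite !plane_incident => /and3P[uv /existsP[d /andP[/eqP du /eqP df]]].
move=> /existsP[e /andP[/eqP ev /eqP ef]]; apply: contra uv; rewrite -du -ev !c'E => /eqP cde.
rewrite -mem_plane_vertex (proper_face pc _ cde) // mem_plane_face.
by rewrite df ef.
Qed.

End PlaneMap.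

Lemma cyclic_chromatic_number_le (G : plane_graph) k :
  (cyclic_chromatic_number G <= k) = cyclically_colorable G k.
Proof.
rewrite /cyclic_chromatic_number; case: ex_minnP => m /existsP[c c_cyclic] min_m.
apply/idP/idP => [mk|]; last exact: min_m.
apply/existsP; exists [ffun v => widen_ord mk (c v)].
apply/forallP => f; apply/forallP => u; apply/forallP => v; rewrite !ffunE -val_eqE.
exact: (forallP (forallP (forallP c_cyclic f) u) v).
Qed.

Lemma edgeless_cyclically_colorable (G : plane_graph) : connected_graph G -> #|dart G| = 0 ->
  cyclically_colorable G ((3 * max_face_degree G) %/ 2).
Proof.
case/connected_graphE=> -[v0 _] conn no_dart.
have dart_free (d : dart G) : False by have /card0_eq/(_ d) := no_dart.
have eq_vertex u v : u = v :> vertex G.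
  have /connectP[[|w p] //= /andP[/existsP[d _] _] _] := conn u v; case: (dart_free d).
have face_gt0 : 0 < max_face_degree G.
  apply: leq_trans (leq_bigmax (home v0)); apply/card_gt0P; exists v0.
  rewrite inE /incident eqxx andbT; apply/orP; right; apply/forallP => d; case: (dart_free d).
have k_gt0 : 0 < (3 * max_face_degree G) %/ 2 by move: face_gt0; clear; lia.
apply/existsP; exists [ffun _ => Ordinal k_gt0].
apply/forallP => f; apply/forallP => u; apply/forallP => v.
by rewrite (eq_vertex u v) eqxx.
Qed.

Local Close Scope group_scope.

Theorem theorem4 :
  (forall G : plane_graph, connected_graph G ->
     cyclic_chromatic_number G <= (3 * max_face_degree G) %/ 2)
  <->
  (forall G : plane_graph,
     (exists H : plane_graph,
        [/\ simple_graph H, three_connected H & subdivision_of H G]) ->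
     cyclic_chromatic_number G <= (3 * max_face_degree G) %/ 2).
Proof.
split=> [bound G [H [_ [_ conn3] sub]]|bound3 G connG].
  by apply/bound/(subdivision_connected sub)/conn3; rewrite cards0.
rewrite cyclic_chromatic_number_le.
have [D0|/card_gt0P[d0 _]] := posnP #|dart G|; first exact: edgeless_cyclically_colorable.
have [tK tN] := (@plane_flipK G, @plane_flip_neq G).
apply: (plane_map_colorable connG d0).
apply: (colorable_bounded tK tN erefl) (plane_map_bounded connG d0) => r br irr.
have k_gt1 : 1 < (3 * max_face_degree G) %/ 2 by have := bounded_map_gt1 d0 br; clear; lia.
apply: (map_colorable (tK := tK) (tN := tN) (irr := irr) k_gt1).
rewrite -cyclic_chromatic_number_le; apply: leq_trans (bound3 _ _) _.
  exact: irreducible_subdivision.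
by rewrite leq_div2r // leq_mul2l map_max_face_degree.
Qed.
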